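(* Let $a,b,\tilde a,\tilde b\in L^\infty$ and let $\ker\Sigma_{a,b}\neq\{0\}$. Then: (i) $\ker\Sigma_{a,b}\subseteq\ker\Sigma_{\tilde a,\tilde b}$ if and only if $\tilde a/a=\tilde\psi_-/\psi_-$ for some $\psi_-,\tilde\psi_-\in H^2_-$ with $\psi_-$ outer, and $\tilde b/b=\tilde\psi_+/\psi_+$ for some $\psi_+,\tilde\psi_+\in H^2_+$ with $\psi_+$ outer. (ii) $\ker\Sigma_{a,b}=\ker\Sigma_{\tilde a,\tilde b}$ if and only if $\tilde a/a$ and $\tilde b/b$ can be written as in (i) with, in addition, $\tilde\psi_-$ and $\tilde\psi_+$ outer in $H^2_-$ and $H^2_+$, respectively. (iii) If $h_-\in\overline{H^\infty}$ and $h_+\in H^\infty$, then $$\ker\Sigma_{a,b}\subseteq\ker\Sigma_{ah_-,bh_+},$$ where the inclusion is strict if $\overline{h_-}$ or $h_+$ has a nonconstant inner factor, and is an equality if $h_-$ and $h_+$ are outer functions.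
   Context: $\mathbb T$ is the unit circle, $L^2=L^2(\mathbb T)$, $L^\infty=L^\infty(\mathbb T)$; $H^2_+=H^2(\mathbb D)$ is the Hardy space regarded as a closed subspace of $L^2$ via boundary values, $H^2_-=(H^2_+)^\perp$ in $L^2$, and $P^\pm$ are the orthogonal projections of $L^2$ onto $H^2_\pm$. $H^\infty=H^\infty(\mathbb D)$ and $\overline{H^\infty}$ is the set of complex conjugates of (boundary values of) functions in $H^\infty$. For $a,b\in L^\infty$, $\Sigma_{a,b}f=P^+(af)+P^-(bf)$ for $f\in L^2$. A function $O_-\in H^2_-$ is called outer if $\overline z\,\overline{O_-}$ is outer in $H^2_+$; a function $O_-\in\overline{H^\infty}$ is called outer if $\overline{O_-}$ is outer in $H^\infty$. Standing assumption: every symbol pair $(a,b)$ considered (here $(a,b)$, $(\tilde a,\tilde b)$ and $(ah_-,bh_+)$) consists of $L^\infty$ functions such that $a\neq0$ a.e., $b\neq0$ a.e. on $\mathbb T$, and either $a=b$ or $a-b\neq0$ a.e. on $\mathbb T$. *)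

(* Defs.v *)
From HB Require Import structures.
From mathcomp Require Import all_boot all_order all_algebra.
From mathcomp Require Import complex.
From mathcomp Require Import all_classical all_reals all_analysis.
Set Implicit Arguments.
Unset Strict Implicit.
Unset Printing Implicit Defensive.
Import Order.TTheory GRing.Theory Num.Theory.
Import Normc.
Import numFieldTopology.Exports numFieldNormedType.Exports.
Local Open Scope classical_set_scope.
Local Open Scope ring_scope.
Local Open Scope complex_scope.

(* Functions on the unit circle are plain functions [circle R -> R[i]]; as
   usual in L^p they only matter up to equality almost everywhere, and this
   is made explicit in each definition instead of passing to a quotient.
   Measure and integral on the circle are those of the arc length dt carried
   by t |-> e^{it}, t in [0, 2pi]; the factor 1/(2pi) is written out where it
   is needed. *)

Definition circle (R : realType) := {z : R[i] | normc z == 1}.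

Lemma normc_cis (R : realType) (t : R) : normc (cos t +i* sin t) == 1.
Proof. by rewrite /normc cos2Dsin2 sqrtr1. Qed.

Definition cis (R : realType) (t : R) : circle R :=
  exist (fun z : R[i] => normc z == 1) (cos t +i* sin t) (normc_cis t).

Definition cexp (R : realType) (z : R[i]) : R[i] :=
  (expR (complex.Re z))%:C * val (cis (complex.Im z)).

Section LebesgueSpaces.
Variable R : realType.
Implicit Types f g a : circle R -> R[i].

Definition period : set R := `[0, 2 * pi]%classic.

Definition ae_circle (P : circle R -> Prop) : Prop :=
  {ae @lebesgue_measure R, forall t, period t -> P (cis t)}.

Definition measurable_circle f : Prop :=
  measurable_fun period (fun t => complex.Re (f (cis t))) /\
  measurable_fun period (fun t => complex.Im (f (cis t))).

Definition cintegral f : R[i] :=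
  (Rintegral (@lebesgue_measure R) period (fun t => complex.Re (f (cis t)))) +i*
  (Rintegral (@lebesgue_measure R) period (fun t => complex.Im (f (cis t)))).

Definition sqnorm_integral f : \bar R :=
  (\int[@lebesgue_measure R]_(t in period) (normc (f (cis t)) ^+ 2)%:E)%E.

Definition L2 : set (circle R -> R[i]) :=
  [set f | measurable_circle f /\ (sqnorm_integral f < +oo)%E].

Definition Linfty : set (circle R -> R[i]) :=
  [set f | measurable_circle f /\
           exists M : R, ae_circle (fun w => normc (f w) <= M)].

Definition inner f g : R[i] :=
  ((2 * pi)^-1)%:C * cintegral (fun w => f w * (g w)^*).

Definition orthocompl (M : set (circle R -> R[i])) : set (circle R -> R[i]) :=
  [set f | L2 f /\ forall g, M g -> inner f g = 0].

(* A representative of the projection, for f in L^2 and M a closed subspace;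
   the default value 0 is irrelevant in that case. *)
Definition orthoproj (M : set (circle R -> R[i])) f : circle R -> R[i] :=
  xget (fun=> 0) [set g | M g /\ orthocompl M (fun w => f w - g w)].

End LebesgueSpaces.

Section Hardy.
Variable R : realType.
Implicit Types (F : R[i] -> R[i]) (f h : circle R -> R[i]).

(* Functions on the unit disc are functions on R[i], whose values outside the
   disc are ignored. *)
Definition analytic_disc F : Prop :=
  exists c : nat -> R[i], forall z : R[i], normc z < 1 ->
    (\sum_(0 <= k < n) c k * z ^+ k : R[i]^o) @[n --> \oo] -->
    (F z : R[i]^o).

Definition on_circle F (r : R) : circle R -> R[i] :=
  fun w => F (r%:C * val w).

Definition H2_disc F : Prop :=
  analytic_disc F /\
  exists M : R, forall r : R, 0 <= r < 1 ->
    (sqnorm_integral (on_circle F r) <= M%:E)%E.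

Definition Hinfty_disc F : Prop :=
  analytic_disc F /\
  exists M : R, forall z : R[i], normc z < 1 -> normc (F z) <= M.

(* f is the function of radial limits of F. *)
Definition boundary_values F f : Prop :=
  ae_circle (fun w =>
    (on_circle F r w : R[i]^o) @[r --> (1 : R)^'-] --> (f w : R[i]^o)).

(* F(z) = c exp (1/(2pi) int (e^{it} + z) / (e^{it} - z) k(e^{it}) dt), |c| = 1,
   with k real and integrable (so that k = log |F| a.e. on the circle). *)
Definition outer_disc F : Prop :=
  exists (c : R[i]) (k : circle R -> R),
    [/\ normc c = 1,
        (@lebesgue_measure R).-integrable (@period R) (fun t => (k (cis t))%:E)
      & forall z : R[i], normc z < 1 ->
          F z = c * cexp (((2 * pi)^-1)%:C *
            cintegral (fun w => (val w + z) / (val w - z) * (k w)%:C))].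

Definition H2p : set (circle R -> R[i]) :=
  [set f | L2 f /\ exists F, H2_disc F /\ boundary_values F f].

Definition H2m : set (circle R -> R[i]) := orthocompl H2p.

Definition Hinfty : set (circle R -> R[i]) :=
  [set f | Linfty f /\ exists F, Hinfty_disc F /\ boundary_values F f].

Definition conj_Hinfty : set (circle R -> R[i]) :=
  [set f | Hinfty (fun w => (f w)^*)].

Definition outer_H2p : set (circle R -> R[i]) :=
  [set f | L2 f /\
           exists F, [/\ H2_disc F, boundary_values F f & outer_disc F]].

Definition outer_H2m : set (circle R -> R[i]) :=
  [set f | H2m f /\ outer_H2p (fun w => (val w)^* * (f w)^*)].

Definition outer_Hinfty : set (circle R -> R[i]) :=
  [set f | Linfty f /\
           exists F, [/\ Hinfty_disc F, boundary_values F f & outer_disc F]].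

Definition outer_conj_Hinfty : set (circle R -> R[i]) :=
  [set f | outer_Hinfty (fun w => (f w)^*)].

Definition inner_function : set (circle R -> R[i]) :=
  [set f | Hinfty f /\ ae_circle (fun w => normc (f w) = 1)].

Definition has_nonconstant_inner_factor h : Prop :=
  exists u g, [/\ inner_function u,
                  ~ (exists c : R[i], ae_circle (fun w => u w = c)),
                  Hinfty g
                & ae_circle (fun w => h w = u w * g w)].

End Hardy.

Section Paired.
Variable R : realType.
Implicit Types a b f : circle R -> R[i].

Definition symbol_pair a b : Prop :=
  [/\ Linfty a, Linfty b,
      ae_circle (fun w => a w != 0), ae_circle (fun w => b w != 0)
    & ae_circle (fun w => a w = b w) \/ ae_circle (fun w => a w - b w != 0)].

(* Sigma_{a,b} f = P^+ (a f) + P^- (b f) *)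
Definition paired_op a b f : circle R -> R[i] :=
  fun w => orthoproj (@H2p R) (fun v => a v * f v) w +
           orthoproj (@H2m R) (fun v => b v * f v) w.

Definition paired_ker a b : set (circle R -> R[i]) :=
  [set f | L2 f /\ ae_circle (fun w => paired_op a b f w = 0)].

End Paired.

(* Main.v *)
(* [f] lies in the kernel of Sigma_{a,b} iff [a f] is in H^2_- and [b f] is in H^2_+.
   Dividing the inner factor out of [b f] (resp. of the reflection of [a f] into H^2_+)
   keeps [f] in the kernel, so a nontrivial kernel contains [f1], [f2] with [a f1] and
   [b f2] outer; they provide the quotients of (i), and everything else follows from
   the Smirnov principle (a quotient in L^2 of an H^2 product by an outer function is in
   H^2) and from the fact that an outer function has no nonconstant inner divisor.

   The Hardy space theory is built on Poisson integrals.  The radial boundary values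
   come from Fatou's theorem.  Inner-outer factorization needs no Blaschke products: with
   [O] the outer function of modulus [|f|], it suffices that [|F| <= |O|] on the disc,
   and this Jensen inequality is the limit as [e -> 0] of the maximum principle for
   [F / O_e], where [O_e] is outer of modulus [|f| + e]. *)

From HB Require Import structures.
Require Import Defs.
From mathcomp Require Import all_boot all_order all_algebra.
From mathcomp Require Import complex zify ring lra.
From mathcomp Require Import all_classical all_reals all_analysis.
From mathcomp Require Import measurable_realfun.
Set Implicit Arguments.
Unset Strict Implicit.
Unset Printing Implicit Defensive.
Import Order.TTheory GRing.Theory Num.Theory.
Import Normc.
Import numFieldTopology.Exports numFieldNormedType.Exports.
Local Open Scope classical_set_scope.
Local Open Scope ring_scope.
Local Open Scope complex_scope.

(** Membership is tested on Fourier coefficients: by [H2pP] a function of L^2 lies in H^2_+ iff its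
    coefficients of negative index vanish, and the involution [flip], f |-> conj z conj f, exchanges
    H^2_- and H^2_+, so that arguments on the minus side are transported to the plus side. Removing
    the inner factor j of [b f] means multiplying f by conj j, which H^2_- tolerates because it is
    stable under conjugates of H^infty. For the reflection of [a f] the same removal multiplies f by
    j, which H^2_+ tolerates. Hence two witnesses instead of one; and if u is a nonconstant inner
    factor of h_+ or of conj h_-, the element showing strictness in (iii) is conj u or u times such
    a witness. For the converse in (i), [ta f] is tpsi (a f) / psi, whose numerator is a product of
    two H^2 functions, in general only in H^1: this is why the Smirnov principle takes two
    numerators. Since H^2 is defined by means over circles inside the disc, the boundary function
    and the orthogonal projections have to be constructed. Both come from summing Fourier
    coefficients with the Riesz-Fischer theorem. *)

Local Notation Re := complex.Re.
Local Notation Im := complex.Im.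
Local Notation mu := lebesgue_measure.

(** * Modulus, real and imaginary parts, and limits in the complex numbers *)

Section ComplexModulus.
Variable R : realType.
Local Notation "x ^*" := (conjc x) : ring_scope.
Implicit Types (x y : R) (z w : R[i]).

Lemma normc_ge0 z : 0 <= normc z.
Proof. by case: z => a b; rewrite sqrtr_ge0. Qed.

Lemma normc_eq0 z : (normc z == 0) = (z == 0).
Proof. by apply/eqP/eqP => [/eq0_normc//|->]; exact: normc0. Qed.

Lemma normc_gt0 z : (0 < normc z) = (z != 0).
Proof. by rewrite lt_def normc_ge0 andbT normc_eq0. Qed.

Lemma normcBC z w : normc (z - w) = normc (w - z).
Proof. by rewrite -opprB normcN. Qed.

Lemma normcD_le z w : normc (z + w) <= normc z + normc w.
Proof. exact: le_normcD. Qed.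

Lemma sqr_normc z : normc z ^+ 2 = Re z ^+ 2 + Im z ^+ 2.
Proof. by case: z => a b; rewrite /normc sqr_sqrtr// addr_ge0 ?sqr_ge0. Qed.

Lemma normc_real x : normc x%:C = `|x|.
Proof. by rewrite /normc/= expr0n/= addr0 sqrtr_sqr. Qed.

Lemma normcJ z : normc z^* = normc z.
Proof. by case: z => a b; rewrite /= sqrrN. Qed.

Lemma Re_le_normc z : `|Re z| <= normc z.
Proof.
by rewrite -(@ler_pXn2r _ 2)// ?nnegrE ?normc_ge0// sqr_normc real_normK ?num_real//
  lerDl sqr_ge0.
Qed.

Lemma Im_le_normc z : `|Im z| <= normc z.
Proof.
by rewrite -(@ler_pXn2r _ 2)// ?nnegrE ?normc_ge0// sqr_normc real_normK ?num_real//
  lerDr sqr_ge0.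
Qed.

Lemma Re_ler_normc z : Re z <= normc z.
Proof. exact: le_trans (ler_norm _) (Re_le_normc z). Qed.

Lemma normc_le_ReIm z : normc z <= `|Re z| + `|Im z|.
Proof.
rewrite -(@ler_pXn2r _ 2)// ?nnegrE ?normc_ge0 ?addr_ge0// sqr_normc sqrrD.
by rewrite !real_normK ?num_real// lerD2r lerDl mulrn_wge0// mulr_ge0.
Qed.

Lemma mulC_conj z : z * z^* = (normc z ^+ 2)%:C.
Proof.
rewrite sqr_normc; case: z => a b; apply/eqP; rewrite eq_complex/=.
by apply/andP; split; apply/eqP; ring.
Qed.

Lemma normcX z n : normc (z ^+ n) = normc z ^+ n.
Proof. by elim: n => [|n ih]; rewrite ?expr0 ?normc1// !exprS normcM ih. Qed.

Lemma normc_sum (I : Type) (s : seq I) (P : pred I) (f : I -> R[i]) :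
  normc (\sum_(i <- s | P i) f i) <= \sum_(i <- s | P i) normc (f i).
Proof.
elim/big_ind2 : _ => [|z x w y h k|//]; first by rewrite normc0.
exact: le_trans (normcD_le _ _) (lerD h k).
Qed.

Lemma normcB_le z w : normc z - normc w <= normc (z - w).
Proof. by rewrite lerBlDr (le_trans _ (normcD_le _ _))// subrK. Qed.

Lemma dist_normc_le z w : `|normc z - normc w| <= normc (z - w).
Proof. by rewrite ler_norml normcB_le lerNl opprB normcBC normcB_le. Qed.

Lemma normc_div z w : normc (z / w) = normc z / normc w.
Proof. by rewrite normcM normcV. Qed.

Lemma ReZ x z : Re (x%:C * z) = x * Re z.
Proof. by case: z => a b /=; ring. Qed.

Lemma ImZ x z : Im (x%:C * z) = x * Im z.
Proof. by case: z => a b /=; ring. Qed.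

Lemma ReM z w : Re (z * w) = Re z * Re w - Im z * Im w.
Proof. by case: z w => a b [c d]. Qed.

Lemma ImM z w : Im (z * w) = Re z * Im w + Im z * Re w.
Proof. by case: z w => a b [c d]. Qed.

Lemma ReD z w : Re (z + w) = Re z + Re w.
Proof. by case: z w => a b [c d]. Qed.

Lemma ImD z w : Im (z + w) = Im z + Im w.
Proof. by case: z w => a b [c d]. Qed.

Lemma ReN z : Re (- z) = - Re z. Proof. by case: z. Qed.
Lemma ImN z : Im (- z) = - Im z. Proof. by case: z. Qed.
Lemma ReJ z : Re z^* = Re z. Proof. by case: z. Qed.
Lemma ImJ z : Im z^* = - Im z. Proof. by case: z. Qed.

Let normE z : `|z| = (normc z)%:C. Proof. by []. Qed.

(** The norm of [R[i]] is itself complex-valued, so the radii of the topology are complex numbers; a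
    positive one is real, which leaves the usual real epsilon. *)
Lemma cvgCP T (F : set_system T) {FF : Filter F} (f : T -> R[i]) (l : R[i]) :
  ((f x : R[i]^o) @[x --> F] --> (l : R[i]^o)) <->
  forall e : R, 0 < e -> \forall x \near F, normc (f x - l) < e.
Proof.
split=> [/cvgrPdist_lt h e e0|h].
  have := h e%:C; rewrite ltcR => /(_ e0); apply: filterS => x.
  by rewrite normE ltcR normcBC.
apply/cvgrPdist_lt => e; rewrite ltcE/= => /andP[/eqP e1 e0].
have := h _ e0; apply: filterS => x xe.
by rewrite normE [e]complexE e1 mulr0 addr0 ltcR normcBC.
Qed.

Lemma cvgC_unique T (F : set_system T) {FF : ProperFilter F} (f : T -> R[i]) (l m : R[i]) :
  ((f x : R[i]^o) @[x --> F] --> (l : R[i]^o)) ->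
  ((f x : R[i]^o) @[x --> F] --> (m : R[i]^o)) -> l = m.
Proof.
move=> /cvgCP h /cvgCP k; apply/eqP; rewrite -subr_eq0 -normc_eq0.
rewrite eq_le normc_ge0 andbT; apply/ler_addgt0Pl => e e0; rewrite addr0.
have e2 : 0 < e / 2 by rewrite divr_gt0.
near F => x.
have -> : l - m = (f x - m) - (f x - l) by ring.
rewrite (le_trans (normcD_le _ _))// normcN [e]splitr lerD// ltW//.
  by near: x; exact: k.
by near: x; exact: h.
Unshelve. all: by end_near. Qed.

Lemma cvgC_normc T (F : set_system T) {FF : Filter F} (f : T -> R[i]) (l : R[i]) :
  ((f x : R[i]^o) @[x --> F] --> (l : R[i]^o)) ->
  normc (f x) @[x --> F] --> normc l.
Proof.
move=> /cvgCP h; apply/cvgrPdist_lt => e e0; have := h e e0.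
apply: filterS => x; apply: le_lt_trans.
by rewrite distrC dist_normc_le.
Qed.

Lemma cvgC_ReIm T (F : set_system T) {FF : Filter F} (f : T -> R[i]) (l : R[i]) :
  (Re (f x)) @[x --> F] --> Re l -> (Im (f x)) @[x --> F] --> Im l ->
  ((f x : R[i]^o) @[x --> F] --> (l : R[i]^o)).
Proof.
move=> /cvgrPdist_lt h /cvgrPdist_lt k; apply/cvgCP => e e0.
have e2 : 0 < e / 2 by rewrite divr_gt0.
near=> x.
apply: le_lt_trans (normc_le_ReIm _) _.
rewrite [e]splitr ltrD// ?(ReD, ImD, ReN, ImN) distrC.
  by near: x; exact: h.
by near: x; exact: k.
Unshelve. all: by end_near. Qed.

Lemma cvgC_Re T (F : set_system T) {FF : Filter F} (f : T -> R[i]) (l : R[i]) :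
  ((f x : R[i]^o) @[x --> F] --> (l : R[i]^o)) ->
  (Re (f x)) @[x --> F] --> Re l.
Proof.
move=> /cvgCP h; apply/cvgrPdist_lt => e e0; have := h e e0.
apply: filterS => x; apply: le_lt_trans.
by rewrite distrC -ReN -ReD Re_le_normc.
Qed.

Lemma cvgC_Im T (F : set_system T) {FF : Filter F} (f : T -> R[i]) (l : R[i]) :
  ((f x : R[i]^o) @[x --> F] --> (l : R[i]^o)) ->
  (Im (f x)) @[x --> F] --> Im l.
Proof.
move=> /cvgCP h; apply/cvgrPdist_lt => e e0; have := h e e0.
apply: filterS => x; apply: le_lt_trans.
by rewrite distrC -ImN -ImD Im_le_normc.
Qed.

Lemma cvgCM T (F : set_system T) {FF : Filter F} (f g : T -> R[i]) (l m : R[i]) :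
  ((f x : R[i]^o) @[x --> F] --> (l : R[i]^o)) ->
  ((g x : R[i]^o) @[x --> F] --> (m : R[i]^o)) ->
  ((f x * g x : R[i]^o) @[x --> F] --> (l * m : R[i]^o)).
Proof. exact: cvgM. Qed.

Lemma cvgCV T (F : set_system T) {FF : Filter F} (f : T -> R[i]) (l : R[i]) :
  l != 0 ->
  ((f x : R[i]^o) @[x --> F] --> (l : R[i]^o)) ->
  (((f x)^-1 : R[i]^o) @[x --> F] --> (l^-1 : R[i]^o)).
Proof. exact: cvgV. Qed.

Lemma circle_normc (w : circle R) : normc (val w) = 1.
Proof. by case: w => z /= /eqP. Qed.

Lemma circle_neq0 (w : circle R) : val w != 0.
Proof. by rewrite -normc_eq0 circle_normc oner_eq0. Qed.

Lemma circle_conj (w : circle R) : val w * (val w)^* = 1.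
Proof. by rewrite mulC_conj circle_normc expr1n. Qed.

Lemma circleB_neq0 (w : circle R) z : normc z < 1 -> val w - z != 0.
Proof.
by apply: contraTneq => /eqP; rewrite subr_eq0 => /eqP <-; rewrite circle_normc ltxx.
Qed.

End ComplexModulus.
#[global] Hint Extern 0 (is_true (0 <= normc _)) => exact: normc_ge0 : core.

(** * Almost everywhere statements and means of real functions on the circle *)

Section CircleIntegration.
Variable R : realType.
Implicit Types (f g h : circle R -> R) (u v : circle R -> R[i]).

Local Notation mu := (@lebesgue_measure R).

Lemma measurable_period : measurable (@period R : set (measurableTypeR R)).
Proof. exact: measurable_itv. Qed.
Let mP := measurable_period.

Let ae_filter : Filter (almost_everywhere mu) := ae_filter_ringOfSetsType mu.

Lemma twopi_gt0 : 0 < 2 * pi :> R.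
Proof. by rewrite mulr_gt0// pi_gt0. Qed.

Lemma measure_period : mu (@period R) = (2 * pi)%:E.
Proof.
by rewrite lebesgue_measure_itv/= lte_fin twopi_gt0 -EFinD subr0.
Qed.

(** Properness holds because the period has measure 2 pi > 0; it allows one to pick a point where
    several almost sure statements hold together. *)
#[global] Instance ae_circle_filter : ProperFilter (@ae_circle R).
Proof.
split; last first.
  split; rewrite /ae_circle.
  - exact: aeW.
  - move=> P Q hP hQ; apply: (@filterS _ _ ae_filter _ _ _ (@filterI _ _ ae_filter _ _ hP hQ)).
    by move=> t [p q] pt; split; [exact: p|exact: q].
  - by move=> P Q PQ; apply: (@filterS _ _ ae_filter) => t p pt; exact/PQ/p.
rewrite /ae_circle => -[N [mN N0 sN]].
have : (mu (@period R) <= mu N)%E.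
  by apply: le_measure; rewrite ?inE// => t pt; apply: sN => /= /(_ pt).
by rewrite N0 measure_period lee_fin leNgt twopi_gt0.
Qed.

Lemma aeP (P : circle R -> Prop) (Q : R -> Prop) :
  (forall t, @period R t -> P (cis t) -> Q t) ->
  ae_circle P -> {ae mu, forall t, @period R t -> Q t}.
Proof.
move=> PQ; apply: (@filterS _ _ ae_filter) => t pt p; apply: PQ => //.
exact: pt.
Qed.

Definition mcirc f : Prop := measurable_fun (@period R) (fun t => f (cis t)).
Definition L1 f : Prop := mu.-integrable (@period R) (fun t => (f (cis t))%:E).
Definition mean f : R := (2 * pi)^-1 * Rintegral mu (@period R) (fun t => f (cis t)).

Lemma L1_mcirc f : L1 f -> mcirc f.
Proof. by move=> /measurable_int/measurable_EFinP. Qed.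

Lemma mcircD f g : mcirc f -> mcirc g -> mcirc (fun w => f w + g w).
Proof. exact: measurable_funD. Qed.
Lemma mcircB f g : mcirc f -> mcirc g -> mcirc (fun w => f w - g w).
Proof. exact: measurable_funB. Qed.
Lemma mcircM f g : mcirc f -> mcirc g -> mcirc (fun w => f w * g w).
Proof. exact: measurable_funM. Qed.
Lemma mcirc_cst c : mcirc (fun=> c).
Proof. exact: measurable_cst. Qed.
Lemma mcircN f : mcirc f -> mcirc (fun w => - f w).
Proof. exact: measurable_funN. Qed.
Lemma mcircX f n : mcirc f -> mcirc (fun w => f w ^+ n).
Proof. exact: measurable_funX. Qed.
Lemma mcirc_comp (p : R -> R) f : measurable_fun setT p -> mcirc f -> mcirc (p \o f).
Proof. by move=> mp mf; exact: measurableT_comp. Qed.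
Lemma mcirc_norm f : mcirc f -> mcirc (fun w => `|f w|).
Proof. by move=> mf; apply: (@mcirc_comp Num.norm). Qed.
Lemma mcirc_lim (h_ : nat -> circle R -> R) f : (forall n, mcirc (h_ n)) ->
  (forall w, h_ n w @[n --> \oo] --> f w) -> mcirc f.
Proof.
move=> mh hf; exact: (@measurable_fun_cvg _ _ _ _ (fun n t => h_ n (cis t))).
Qed.

Lemma L1_cst c : L1 (fun=> c).
Proof.
apply: (@measurable_bounded_integrable _ _ _ _ (fun=> c)) => //.
  by have : (mu (@period R) < +oo)%E by rewrite measure_period ltry.
by exists `|c|; split => // x xc y _; exact: ltW.
Qed.

Lemma L1D f g : L1 f -> L1 g -> L1 (fun w => f w + g w).
Proof. by move=> hf hg; have := integrableD mP hf hg. Qed.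

Lemma L1Z c f : L1 f -> L1 (fun w => c * f w).
Proof. by move=> hf; have := integrableZl mP c hf. Qed.

Lemma L1N f : L1 f -> L1 (fun w => - f w).
Proof. by move=> hf; have := integrableN hf. Qed.

Lemma L1B f g : L1 f -> L1 g -> L1 (fun w => f w - g w).
Proof. by move=> hf hg; apply: L1D => //; exact: L1N. Qed.

Lemma L1_norm f : L1 f -> L1 (fun w => `|f w|).
Proof. by move=> hf; have := integrable_abse hf. Qed.

Lemma L1_le f g : mcirc f -> L1 g -> ae_circle (fun w => `|f w| <= g w) -> L1 f.
Proof.
move=> mf ig fg; apply/integrableP; split; first exact/measurable_EFinP.
have /integrableP[mg] := ig; apply: le_lt_trans.
apply: ae_ge0_le_integral => //.
- by apply/measurable_EFinP; exact: mcirc_norm.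
- exact: measurableT_comp.
- apply: aeP fg => t pt fgt /=.
  by rewrite lee_fin (le_trans fgt)// ler_norm.
Qed.

Lemma L1_bdM f g c : mcirc f -> (forall w, `|f w| <= c) -> L1 g ->
  L1 (fun w => f w * g w).
Proof.
move=> mf fc ig; apply: (@L1_le _ (fun w => c * `|g w|)).
- by apply: mcircM => //; exact: L1_mcirc.
- by apply: L1Z; exact: L1_norm.
- by apply: aeW => t _; rewrite normrM ler_wpM2r.
Qed.

Lemma L1_bd f c : mcirc f -> (forall w, `|f w| <= c) -> L1 f.
Proof. by move=> mf fc; apply: (L1_le mf (L1_cst c)); apply: aeW => t _. Qed.

Lemma L1_sum (I : Type) (s : seq I) (f_ : I -> circle R -> R) :
  (forall i, L1 (f_ i)) -> L1 (fun w => \sum_(i <- s) f_ i w).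
Proof.
move=> hf; elim: s => [|i s ih].
  by under eq_fun do rewrite big_nil; exact: L1_cst.
by under eq_fun do rewrite big_cons; exact: L1D.
Qed.

Lemma meanD f g : L1 f -> L1 g -> mean (fun w => f w + g w) = mean f + mean g.
Proof. by move=> hf hg; rewrite /mean RintegralD// mulrDr. Qed.

Lemma meanZ c f : L1 f -> mean (fun w => c * f w) = c * mean f.
Proof. by move=> hf; rewrite /mean RintegralZl// mulrCA. Qed.

Lemma meanN f : L1 f -> mean (fun w => - f w) = - mean f.
Proof.
by move=> hf; rewrite -mulN1r -meanZ//; congr mean; apply/funext => w; rewrite mulN1r.
Qed.

Lemma meanB f g : L1 f -> L1 g -> mean (fun w => f w - g w) = mean f - mean g.
Proof. by move=> hf hg; rewrite meanD ?meanN//; exact: L1N. Qed.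

Lemma mean_cst c : mean (fun=> c) = c.
Proof.
rewrite /mean (Rintegral_cst mu mP) (_ : fine _ = 2 * pi); last first.
  by rewrite -[LHS]/(fine (mu (@period R))) measure_period.
rewrite mulrCA mulVf ?mulr1//.
exact/lt0r_neq0/twopi_gt0.
Qed.

Lemma mean_sum (I : Type) (s : seq I) (f_ : I -> circle R -> R) :
  (forall i, L1 (f_ i)) ->
  mean (fun w => \sum_(i <- s) f_ i w) = \sum_(i <- s) mean (f_ i).
Proof.
move=> hf; elim: s => [|i s ih].
  rewrite big_nil -[RHS](mean_cst 0); congr mean.
  by apply/funext => w; rewrite big_nil.
rewrite big_cons -ih -meanD//; last exact: L1_sum.
by congr mean; apply/funext => w; rewrite big_cons.
Qed.

Lemma mean_ge0 f : L1 f -> ae_circle (fun w => 0 <= f w) -> 0 <= mean f.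
Proof.
move=> lf f0; rewrite /mean mulr_ge0 ?invr_ge0 ?(ltW twopi_gt0)//.
have mf := L1_mcirc lf.
rewrite /Rintegral (@ae_eq_integral _ _ _ mu _ (fun t => `|f (cis t)|%:E))//.
- by apply/fine_ge0/integral_ge0 => t _.
- exact/measurable_EFinP.
- by apply/measurable_EFinP; exact: mcirc_norm.
- by apply: aeP f0 => t pt ft; rewrite ger0_norm.
Qed.

Lemma le_mean f g : L1 f -> L1 g -> ae_circle (fun w => f w <= g w) ->
  mean f <= mean g.
Proof.
move=> hf hg fg; rewrite -subr_ge0 -meanB//; apply: mean_ge0; first exact: L1B.
by apply: filterS fg => w; rewrite subr_ge0.
Qed.

Lemma eq_mean f g : L1 f -> L1 g -> ae_circle (fun w => f w = g w) -> mean f = mean g.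
Proof.
move=> hf hg fg; apply/eqP; rewrite eq_le; apply/andP.
by split; apply: le_mean => //; apply: filterS fg => w ->.
Qed.

Lemma norm_mean_le f : L1 f -> `|mean f| <= mean (fun w => `|f w|).
Proof.
move=> hf; have hn := L1_norm hf; rewrite ler_norml lerNl -meanN//.
apply/andP; split; apply: le_mean => //; first exact: L1N.
  by apply: aeW => t _; rewrite -normrN ler_norm.
by apply: aeW => t _; rewrite ler_norm.
Qed.

(** The variance, that is the mean of [(f - m)^2] with [m] the mean of [f], is nonnegative. *)
Lemma sqr_mean_le f : L1 f -> L1 (fun w => f w ^+ 2) ->
  mean f ^+ 2 <= mean (fun w => f w ^+ 2).
Proof.
move=> hf hf2; set m := mean f.
have : 0 <= mean (fun w => f w ^+ 2 - (2 * m) * f w + m ^+ 2).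
  apply: mean_ge0.
    by apply: L1D; [apply: L1B => //; exact: L1Z|exact: L1_cst].
  apply: aeW => t _.
  have -> : forall x : R, x ^+ 2 - 2 * m * x + m ^+ 2 = (x - m) ^+ 2 by move=> x; ring.
  exact: sqr_ge0.
have h1 := L1Z (2 * m) hf.
rewrite meanD; [|exact: L1B|exact: L1_cst].
rewrite meanB// meanZ// mean_cst -/m; lra.
Qed.

Lemma mean_eq0 f : L1 f -> ae_circle (fun w => 0 <= f w) -> mean f = 0 ->
  ae_circle (fun w => f w = 0).
Proof.
move=> lf f0 /eqP; rewrite /mean mulf_eq0 invr_eq0 (gt_eqF twopi_gt0)/= => /eqP h.
have mf := L1_mcirc lf.
have [+ _] := @ae_eq_integral_abs _ _ _ mu _ mP (fun t => (f (cis t))%:E)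
  (measurable_int _ lf).
case.
  rewrite -[RHS]/((0 : R)%:E) -h /Rintegral fineK; last exact: integrable_fin_num.
  apply: ae_eq_integral => //.
  - by apply/measurable_EFinP; exact: mcirc_norm.
  - exact/measurable_EFinP.
  - by apply: aeP f0 => t pt ft /=; rewrite ger0_norm.
move=> N [mN N0 sN]; exists N; split => // t /= nt; apply: sN => /= ft; apply: nt => pt.
by have [] := ft pt.
Qed.

Lemma mean_dominated_cvg (f_ : nat -> circle R -> R) f g :
  (forall n, mcirc (f_ n)) -> mcirc f -> L1 g ->
  ae_circle (fun w => f_ n w @[n --> \oo] --> f w) ->
  (forall n, ae_circle (fun w => `|f_ n w| <= g w)) ->
  L1 f /\ mean (f_ n) @[n --> \oo] --> mean f.
Proof.
move=> mf_ mf ig cf bf.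
have [] := @dominated_convergence _ _ _ mu (@period R) mP
  (fun n t => (f_ n (cis t))%:E) (fun t => (f (cis t))%:E) (fun t => (g (cis t))%:E).
- by move=> n; by apply/measurable_EFinP; exact: mf_.
- exact/measurable_EFinP.
- apply: aeP cf => t pt ct; apply/cvg_EFin; last exact: ct.
  exact: nearW.
- exact: ig.
(* The exceptional null sets of the countably many bounds are merged into one. *)
- have : {ae mu, forall t n, @period R t -> `|f_ n (cis t)| <= g (cis t)}.
    exact: ae_foralln.
  apply: (@filterS _ _ ae_filter) => t h n pt; exact: h.
move=> iF _ c; split => //.
apply: cvgM; first exact: cvg_cst.
apply: (fine_cvg (f := fun n => (\int[mu]_(t in @period R) (f_ n (cis t))%:E)%E)).
by rewrite /Rintegral fineK//; exact: integrable_fin_num.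
Qed.

(** Fatou's lemma in the form that produces integrability of the limit; it is what places limits in
    L^2 and makes [ln |f|] integrable. *)
Lemma mean_fatou (f_ : nat -> circle R -> R) f c :
  (forall n, L1 (f_ n)) -> (forall n w, 0 <= f_ n w) -> (forall n, mean (f_ n) <= c) ->
  mcirc f -> ae_circle (fun w => f_ n w @[n --> \oo] --> f w) ->
  L1 f /\ mean f <= c.
Proof.
move=> i_ p_ mc mf cf.
pose F n t := (f_ n (cis t))%:E.
have mF n : measurable_fun (@period R) (F n) by apply/measurable_EFinP; exact: L1_mcirc.
have F0 n t : (@period R) t -> (0 <= F n t)%E by rewrite lee_fin p_.
have f0 : ae_circle (fun w => 0 <= f w).
  apply: filterS cf => w cw; rewrite -(cvg_lim _ cw)//.
  by apply: limr_ge; [apply/cvg_ex; exists (f w)|exact: nearW].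
have mf' : measurable_fun (@period R) (fun t => `|(f (cis t))%:E|%E).
  by apply/measurable_EFinP; exact: mcirc_norm.
have E : (\int[mu]_(t in @period R) `|(f (cis t))%:E| <= (2 * pi * c)%:E)%E.
  have -> : (\int[mu]_(t in @period R) `|(f (cis t))%:E| =
      \int[mu]_(t in @period R) limn_einf (F ^~ t))%E.
    apply: ge0_ae_eq_integral => //.
    - apply: measurableT_comp => //; apply: measurable_fun_limn_esup => n.
      by apply: measurableT_comp => //; exact: mF.
    - move=> t pt; rewrite limn_einf_lim; apply: lime_ge.
        exact: is_cvg_einfs.
      by apply: nearW => n; apply: le_ereal_inf_tmp => _ [k _ <-]; exact: F0.
    - apply: (aeP _ (filterI cf f0)) => t pt [ct ft].
      have /cvg_limn_einf_sup[-> _] : F ^~ t @ \oo --> (f (cis t))%:E.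
        by apply/cvg_EFin; [exact: nearW|exact: ct].
      by rewrite /= ger0_norm.
  apply: le_trans (fatou mu mP mF F0) _.
  rewrite limn_einf_lim; apply: lime_le; first exact: is_cvg_einfs.
  apply: nearW => n; apply: ereal_inf_le; exists (\int[mu]_(t in @period R) F n t)%E.
    by exists n => /=.
  rewrite -[leLHS]fineK; last exact: integrable_fin_num (i_ n).
  by rewrite lee_fin -ler_pdivrMl ?twopi_gt0//; exact: mc.
have If : L1 f.
  by apply/integrableP; split; [exact/measurable_EFinP|exact: le_lt_trans E (ltry _)].
split => //; rewrite /mean ler_pdivrMl ?twopi_gt0//.
rewrite -lee_fin (le_trans _ E)// /Rintegral fineK; last exact: integrable_fin_num If.
apply: le_trans (lee_abs _) _.
by apply: (le_abse_integral mu mP); apply/measurable_EFinP; exact: mf.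
Qed.

End CircleIntegration.

(** * Complex means, and L^2 of the circle *)

Section ComplexCircleIntegration.
Variable R : realType.
Local Notation "x ^*" := (conjc x) : ring_scope.
Implicit Types (f g h : circle R -> R) (u v : circle R -> R[i]).

Lemma mcP u : measurable_circle u <->
  mcirc (fun w => Re (u w)) /\ mcirc (fun w => Im (u w)).
Proof. by []. Qed.

Lemma mc_Re u : measurable_circle u -> mcirc (fun w => Re (u w)).
Proof. by case. Qed.
Lemma mc_Im u : measurable_circle u -> mcirc (fun w => Im (u w)).
Proof. by case. Qed.

Lemma mc_cst c : measurable_circle (fun=> c : R[i]).
Proof. by split; exact: mcirc_cst. Qed.

Lemma mcD u v : measurable_circle u -> measurable_circle v ->
  measurable_circle (fun w => u w + v w).
Proof.
move=> /mcP[u1 u2] /mcP[v1 v2]; apply/mcP; split.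
- by under eq_fun do rewrite ReD; exact: mcircD u1 v1.
- by under eq_fun do rewrite ImD; exact: mcircD u2 v2.
Qed.

Lemma mcM u v : measurable_circle u -> measurable_circle v ->
  measurable_circle (fun w => u w * v w).
Proof.
move=> /mcP[u1 u2] /mcP[v1 v2]; apply/mcP; split.
- by under eq_fun do rewrite ReM; exact: mcircB (mcircM u1 v1) (mcircM u2 v2).
- by under eq_fun do rewrite ImM; exact: mcircD (mcircM u1 v2) (mcircM u2 v1).
Qed.

Lemma mcN u : measurable_circle u -> measurable_circle (fun w => - u w).
Proof.
by move=> hu; under eq_fun do rewrite -mulN1r; exact: mcM (mc_cst _) hu.
Qed.

Lemma mcB u v : measurable_circle u -> measurable_circle v ->
  measurable_circle (fun w => u w - v w).
Proof. by move=> hu hv; apply: mcD => //; exact: mcN. Qed.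

Lemma mcJ u : measurable_circle u -> measurable_circle (fun w => (u w)^*).
Proof.
move=> /mcP[u1 u2]; apply/mcP; split.
- by under eq_fun do rewrite ReJ.
- by under eq_fun do rewrite ImJ; exact: mcircN u2.
Qed.

Lemma mcX u n : measurable_circle u -> measurable_circle (fun w => u w ^+ n).
Proof.
move=> hu; elim: n => [|n ih]; first exact: mc_cst.
by under eq_fun do rewrite exprS; exact: mcM.
Qed.

Lemma mc_sum (I : Type) (s : seq I) (u_ : I -> circle R -> R[i]) :
  (forall i, measurable_circle (u_ i)) ->
  measurable_circle (fun w => \sum_(i <- s) u_ i w).
Proof.
move=> hu; elim: s => [|i s ih].
  by under eq_fun do rewrite big_nil; exact: mc_cst.
by under eq_fun do rewrite big_cons; exact: mcD.
Qed.

Lemma mc_real f : mcirc f -> measurable_circle (fun w => (f w)%:C).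
Proof. by move=> hf; split => //; exact: mcirc_cst. Qed.

Lemma mc_id : measurable_circle (fun w : circle R => val w).
Proof.
split; apply: measurable_funTS; apply: continuous_measurable_fun.
- exact: continuous_cos.
- exact: continuous_sin.
Qed.

Lemma mc_normc u : measurable_circle u -> mcirc (fun w => normc (u w)).
Proof.
move=> /mcP[u1 u2].
have : mcirc (fun w => Num.sqrt (Re (u w) ^+ 2 + Im (u w) ^+ 2)).
  apply: (@mcirc_comp _ Num.sqrt); last by apply: mcircD; exact: mcircX.
  by apply: continuous_measurable_fun; exact: sqrt_continuous.
by congr measurable_fun; apply/funext => t; case: (u (cis t)).
Qed.

Lemma mc_lim (u_ : nat -> circle R -> R[i]) u :
  (forall n, measurable_circle (u_ n)) ->
  (forall w, (u_ n w : R[i]^o) @[n --> \oo] --> (u w : R[i]^o)) ->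
  measurable_circle u.
Proof.
move=> mu_ cu; apply/mcP; split.
- by apply: (mcirc_lim (fun n => mc_Re (mu_ n))) => w; exact: cvgC_Re.
- by apply: (mcirc_lim (fun n => mc_Im (mu_ n))) => w; exact: cvgC_Im.
Qed.

Definition CL1 u : Prop := L1 (fun w => Re (u w)) /\ L1 (fun w => Im (u w)).
Definition cmean u : R[i] := mean (fun w => Re (u w)) +i* mean (fun w => Im (u w)).

Lemma cmeanE u : ((2 * pi)^-1)%:C * cintegral u = cmean u.
Proof. by apply/eqP; rewrite eq_complex ReZ ImZ /= !eqxx. Qed.

Lemma CL1_mc u : CL1 u -> measurable_circle u.
Proof. by move=> [a b]; apply/mcP; split; exact: L1_mcirc. Qed.

Lemma CL1_normc u : CL1 u -> L1 (fun w => normc (u w)).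
Proof.
move=> hu; apply: (L1_le (mc_normc (CL1_mc hu))
    (L1D (L1_norm hu.1) (L1_norm hu.2))).
by apply: aeW => t _; rewrite ger0_norm// normc_le_ReIm.
Qed.

Lemma CL1_le u f : measurable_circle u -> L1 f ->
  ae_circle (fun w => normc (u w) <= f w) -> CL1 u.
Proof.
move=> mu_ lf uf; split; [apply: (L1_le (mc_Re mu_) lf)|apply: (L1_le (mc_Im mu_) lf)].
- by apply: filterS uf => w; apply: le_trans; exact: Re_le_normc.
- by apply: filterS uf => w; apply: le_trans; exact: Im_le_normc.
Qed.

Lemma CL1_bd u c : measurable_circle u -> (forall w, normc (u w) <= c) -> CL1 u.
Proof. by move=> hu uc; apply: (CL1_le hu (L1_cst c)); apply: aeW => t _. Qed.

Lemma CL1_bdM u v c : measurable_circle u -> ae_circle (fun w => normc (u w) <= c) ->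
  CL1 v -> CL1 (fun w => u w * v w).
Proof.
move=> hu uc hv; apply: (CL1_le (mcM hu (CL1_mc hv)) (L1Z c (CL1_normc hv))).
by apply: filterS uc => w uc; rewrite normcM ler_wpM2r.
Qed.

Lemma CL1_real f : L1 f -> CL1 (fun w => (f w)%:C).
Proof. by move=> lf; split => //; exact: L1_cst. Qed.

Lemma CL1_cst c : CL1 (fun=> c).
Proof. by split; exact: L1_cst. Qed.

Lemma CL1D u v : CL1 u -> CL1 v -> CL1 (fun w => u w + v w).
Proof.
move=> [u1 u2] [v1 v2]; split.
- by under eq_fun do rewrite ReD; exact: L1D.
- by under eq_fun do rewrite ImD; exact: L1D.
Qed.

Lemma CL1Z c u : CL1 u -> CL1 (fun w => c * u w).
Proof.
by move=> hu; apply: (CL1_bdM (mc_cst c) _ hu (c := normc c)); apply: aeW => t _.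
Qed.

Lemma CL1N u : CL1 u -> CL1 (fun w => - u w).
Proof. by move=> hu; under eq_fun do rewrite -mulN1r; exact: CL1Z. Qed.

Lemma CL1B u v : CL1 u -> CL1 v -> CL1 (fun w => u w - v w).
Proof. by move=> hu hv; apply: CL1D => //; exact: CL1N. Qed.

Lemma CL1J u : CL1 u -> CL1 (fun w => (u w)^*).
Proof.
move=> [u1 u2]; split.
- by under eq_fun do rewrite ReJ.
- by under eq_fun do rewrite ImJ; exact: L1N.
Qed.

Lemma CL1_sum (I : Type) (s : seq I) (u_ : I -> circle R -> R[i]) :
  (forall i, CL1 (u_ i)) -> CL1 (fun w => \sum_(i <- s) u_ i w).
Proof.
move=> hu; elim: s => [|i s ih].
  by under eq_fun do rewrite big_nil; exact: CL1_cst.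
by under eq_fun do rewrite big_cons; exact: CL1D.
Qed.

Lemma cmeanD u v : CL1 u -> CL1 v -> cmean (fun w => u w + v w) = cmean u + cmean v.
Proof.
move=> [u1 u2] [v1 v2]; apply/eqP; rewrite eq_complex/=; apply/andP; split; apply/eqP.
- by rewrite -meanD//; congr mean; apply/funext => w; rewrite ReD.
- by rewrite -meanD//; congr mean; apply/funext => w; rewrite ImD.
Qed.

Lemma cmeanZ c u : CL1 u -> cmean (fun w => c * u w) = c * cmean u.
Proof.
move=> [u1 u2]; apply/eqP; rewrite eq_complex ReM ImM/=; apply/andP.
have l a f : L1 f -> L1 (fun w => a * f w) by exact: L1Z.
split; apply/eqP.
- by rewrite -!meanZ// -meanB//; [|exact: l..]; congr mean; apply/funext => w; rewrite ReM.
- by rewrite -!meanZ// -meanD//; [|exact: l..]; congr mean; apply/funext => w; rewrite ImM.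
Qed.

Lemma cmeanN u : CL1 u -> cmean (fun w => - u w) = - cmean u.
Proof. by move=> hu; rewrite -mulN1r -cmeanZ//; under eq_fun do rewrite -mulN1r. Qed.

Lemma cmeanB u v : CL1 u -> CL1 v -> cmean (fun w => u w - v w) = cmean u - cmean v.
Proof. by move=> hu hv; rewrite cmeanD ?cmeanN//; exact: CL1N. Qed.

Lemma cmean_cst c : cmean (fun=> c) = c.
Proof. by rewrite /cmean !mean_cst; case: c. Qed.

Lemma cmean_sum (I : Type) (s : seq I) (u_ : I -> circle R -> R[i]) :
  (forall i, CL1 (u_ i)) ->
  cmean (fun w => \sum_(i <- s) u_ i w) = \sum_(i <- s) cmean (u_ i).
Proof.
move=> hu; elim: s => [|i s ih].
  by under eq_fun do rewrite big_nil; rewrite big_nil cmean_cst.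
by under eq_fun do rewrite big_cons; rewrite big_cons -ih cmeanD//; exact: CL1_sum.
Qed.

Lemma cmeanJ u : CL1 u -> cmean (fun w => (u w)^*) = (cmean u)^*.
Proof.
move=> [u1 u2]; apply/eqP; rewrite eq_complex ReJ ImJ/=; apply/andP; split; apply/eqP.
- by congr mean; apply/funext => w; rewrite ReJ.
- by rewrite -meanN//; congr mean; apply/funext => w; rewrite ImJ.
Qed.

Lemma cmean_real f : cmean (fun w => (f w)%:C) = (mean f)%:C.
Proof. by rewrite /cmean/= mean_cst. Qed.

Lemma eq_cmean u v : CL1 u -> CL1 v -> ae_circle (fun w => u w = v w) ->
  cmean u = cmean v.
Proof.
move=> [u1 u2] [v1 v2] uv.
by congr (_ +i* _); apply: eq_mean => //; apply: filterS uv => w ->.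
Qed.

(** A unimodular [c] rotates the mean onto the positive real axis, where it is the mean of the real
    part of [c u]. *)
Lemma normc_cmean_le u : CL1 u -> normc (cmean u) <= mean (fun w => normc (u w)).
Proof.
move=> hu; have [->|m0] := eqVneq (cmean u) 0.
  by rewrite normc0; apply: mean_ge0; [exact: CL1_normc|exact: aeW].
set m := normc (cmean u).
have m0' : m != 0 by rewrite normc_eq0.
pose c := (cmean u)^* / m%:C.
have nc : normc c = 1 by rewrite normc_div normcJ normc_real ger0_norm ?divff ?normc_ge0.
have -> : m = Re (cmean (fun w => c * u w)).
  rewrite cmeanZ// /c mulrAC [_ * cmean u]mulrC mulC_conj -/m -fmorphV -rmorphM/=.
  by rewrite expr2 mulfK.
apply: le_mean; [exact: (CL1Z c hu).1|exact: CL1_normc|].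
by apply: aeW => t _; rewrite (le_trans (Re_ler_normc _))// normcM nc mul1r.
Qed.

Lemma mulrC_normc2 (x y : R) : x * y <= (x ^+ 2 + y ^+ 2) / 2.
Proof. by have := sqr_ge0 (x - y); lra. Qed.

Lemma L2P u : L2 u <-> measurable_circle u /\ L1 (fun w => normc (u w) ^+ 2).
Proof.
have E : sqnorm_integral u =
    (\int[mu]_(t in @period R) `|(normc (u (cis t)) ^+ 2)%:E|)%E.
  by apply: eq_integral => t _; rewrite /= ger0_norm// exprn_ge0.
split=> -[m h]; split => //.
- apply/integrableP; split; last by rewrite -E.
  by apply/measurable_EFinP; exact: mcircX (mc_normc m).
- by move/integrableP : h => [_]; rewrite -E.
Qed.

Definition nrm2 u : R := mean (fun w => normc (u w) ^+ 2).

Lemma L2_sqnorm u c : L2 u -> (sqnorm_integral u <= c%:E)%E = (nrm2 u <= (2 * pi)^-1 * c).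
Proof.
move=> /L2P[m h]; rewrite /nrm2 /mean ler_pM2l ?invr_gt0 ?twopi_gt0//.
rewrite -lee_fin /Rintegral fineK//.
exact: integrable_fin_num (@measurable_period R) _ h.
Qed.

Lemma L2_mc u : L2 u -> measurable_circle u. Proof. by case. Qed.
Lemma L2_L1 u : L2 u -> L1 (fun w => normc (u w) ^+ 2). Proof. by case/L2P. Qed.

Lemma L2_le u f : measurable_circle u -> L1 f ->
  ae_circle (fun w => normc (u w) ^+ 2 <= f w) -> L2 u.
Proof.
move=> m h le; apply/L2P; split => //; apply: (L1_le (mcircX _ (mc_normc m)) h).
by apply: filterS le => w; rewrite ger0_norm// exprn_ge0.
Qed.

Lemma L2M_CL1 u v : L2 u -> L2 v -> CL1 (fun w => u w * v w).
Proof.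
move=> /L2P[mu_ lu] /L2P[mv lv]; apply: (CL1_le (mcM mu_ mv) (L1D lu lv)).
apply: aeW => t _; rewrite normcM (le_trans (mulrC_normc2 _ _))//.
by rewrite ler_pdivrMr// ler_peMr// ?addr_ge0 ?exprn_ge0// ler1n.
Qed.

Lemma L2_bd u c : measurable_circle u -> (forall w, normc (u w) <= c) -> L2 u.
Proof.
move=> m h; apply: (L2_le m (L1_cst (c ^+ 2))); apply: aeW => t _.
by rewrite ler_pXn2r// nnegrE// (le_trans _ (h (cis t))).
Qed.

Lemma L2_CL1 u : L2 u -> CL1 u.
Proof.
move=> hu; have := L2M_CL1 (L2_bd (mc_cst 1) (fun=> lexx _)) hu.
by under eq_fun do rewrite mul1r.
Qed.

Lemma L2_bdM u v c : measurable_circle u -> ae_circle (fun w => normc (u w) <= c) ->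
  L2 v -> L2 (fun w => u w * v w).
Proof.
move=> hu uc hv.
apply: (L2_le (mcM hu (L2_mc hv)) (L1Z (c ^+ 2) (L2_L1 hv))).
apply: filterS uc => w uc; rewrite normcM exprMn ler_wpM2r ?exprn_ge0//.
by rewrite ler_pXn2r// nnegrE// (le_trans _ uc).
Qed.

Lemma L2J u : L2 u -> L2 (fun w => (u w)^*).
Proof.
move=> /L2P[m h]; apply/L2P; split; first exact: mcJ.
by under eq_fun do rewrite normcJ.
Qed.

Lemma L2Z c u : L2 u -> L2 (fun w => c * u w).
Proof. by apply: L2_bdM; [exact: mc_cst|apply: (@aeW _ _ _ _ _)=> t _; exact: lexx]. Qed.

Lemma normcD_sqr_le (z w : R[i]) : normc (z + w) ^+ 2 <= 2 * normc z ^+ 2 + 2 * normc w ^+ 2.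
Proof.
have : normc (z + w) ^+ 2 <= (normc z + normc w) ^+ 2.
  by rewrite ler_pXn2r ?nnegrE ?addr_ge0 ?normcD_le.
move=> h; apply: le_trans h _.
by have := sqr_ge0 (normc z - normc w); lra.
Qed.

Lemma L2D u v : L2 u -> L2 v -> L2 (fun w => u w + v w).
Proof.
move=> /L2P[mu_ lu] /L2P[mv lv].
apply: (L2_le (mcD mu_ mv) (L1D (L1Z 2 lu) (L1Z 2 lv))).
by apply: aeW => t _; exact: normcD_sqr_le.
Qed.

Lemma L2N u : L2 u -> L2 (fun w => - u w).
Proof. by move=> hu; under eq_fun do rewrite -mulN1r; exact: L2Z. Qed.

Lemma L2B u v : L2 u -> L2 v -> L2 (fun w => u w - v w).
Proof. by move=> hu hv; apply: L2D => //; exact: L2N. Qed.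

Lemma nrm2_ge0 u : L2 u -> 0 <= nrm2 u.
Proof.
by move=> /L2_L1 h; apply: mean_ge0 => //; apply: aeW => t _; exact: exprn_ge0.
Qed.

Lemma nrm2_eq0 u : L2 u -> nrm2 u = 0 -> ae_circle (fun w => u w = 0).
Proof.
move=> /L2_L1 hu u0.
have h0 : ae_circle (fun w => 0 <= normc (u w) ^+ 2).
  by apply: aeW => t _; exact: exprn_ge0.
apply: filterS (mean_eq0 hu h0 u0).
by move=> w /eqP; rewrite expf_eq0/= normc_eq0 => /eqP.
Qed.

Lemma cauchy_schwarz u v : L2 u -> L2 v ->
  mean (fun w => normc (u w) * normc (v w)) ^+ 2 <= nrm2 u * nrm2 v.
Proof.
move=> hu hv; have lu := L2_L1 hu; have lv := L2_L1 hv.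
have luv : L1 (fun w => normc (u w) * normc (v w)).
  by under eq_fun do rewrite -normcM; exact: CL1_normc (L2M_CL1 hu hv).
set m := mean _; have m0 : 0 <= m.
  by apply: mean_ge0 => //; apply: aeW => t _; exact: mulr_ge0.
have key (x y : R) : 2 * x * y * m <= x ^+ 2 * nrm2 u + y ^+ 2 * nrm2 v.
  rewrite /m /nrm2 -!meanZ// -meanD; [|exact: L1Z..].
  apply: le_mean; [exact: L1Z|by apply: L1D; exact: L1Z|].
  apply: aeW => t _.
  by have := sqr_ge0 (x * normc (u (cis t)) - y * normc (v (cis t))); lra.
have nu := nrm2_ge0 hu; have nv := nrm2_ge0 hv.
(* If [v] has norm 0, the weights [m] and [nrm2 u + 1] in [key] force [m = 0]; otherwise [nrm2 v]
   and [m] are the optimal weights. *)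
have [nv0|nv0] := eqVneq (nrm2 v) 0.
  have := key m (nrm2 u + 1); rewrite nv0 => k1.
  nra.
have nv1 : 0 < nrm2 v by rewrite lt_def nv0.
have := key (nrm2 v) m => k.
nra.
Qed.

Lemma normc_cmeanM_le u v : L2 u -> L2 v ->
  normc (cmean (fun w => u w * v w)) ^+ 2 <= nrm2 u * nrm2 v.
Proof.
move=> hu hv; apply: le_trans (cauchy_schwarz hu hv).
have h := normc_cmean_le (L2M_CL1 hu hv).
rewrite (_ : (fun w => normc (u w) * _) = fun w => normc (u w * v w)).
  by rewrite ler_pXn2r ?nnegrE// (le_trans _ h).
by apply/funext => w; rewrite normcM.
Qed.

End ComplexCircleIntegration.

(** * Orthogonality of the characters and Fourier coefficients of polynomials *)

Section Moments.
Variable R : realType.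
Local Notation "x ^*" := (conjc x) : ring_scope.
Implicit Types (p : {poly R[i]}) (z : R[i]).

Lemma val_cisX (t : R) n : val (cis t) ^+ n = cos (n%:R * t) +i* sin (n%:R * t).
Proof.
elim: n => [|n ih]; first by rewrite expr0 mul0r cos0 sin0.
rewrite exprS ih -(@natr1 R) mulrDl mul1r cosD sinD; apply/eqP.
by rewrite eq_complex/=; apply/andP; split; apply/eqP; ring.
Qed.

Let mean_primitive (f F : R -> R) (g : circle R -> R) :
  (forall t, g (cis t) = f t) -> continuous f ->
  (forall t : R, is_derive t (1 : R) F (f t)) -> F (2 * pi) = F 0 -> mean g = 0.
Proof.
move=> gf cf dF E; rewrite /mean /Rintegral.
under eq_integral do rewrite gf.
have dF' (t : R) : derivable F t 1 by have [] := dF t.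
have cF : continuous F by move=> t; apply/differentiable_continuous/derivable1_diffP.
rewrite /period (@continuous_FTC2 R f F) ?twopi_gt0//.
- by rewrite E -EFinB subrr mulr0.
- exact: continuous_subspaceT.
- split; first by move=> t _.
  + exact: cvg_at_right_filter (cF _).
  + exact: cvg_at_left_filter (cF _).
- by move=> t _; rewrite derive1E; have [] := dF t.
Qed.

(** For [a = n + 1] the functions cos (a t) and sin (a t) have the 2 pi-periodic primitives sin (a
    t) / a and - cos (a t) / a. *)
Lemma cmean_expn n : cmean (fun w : circle R => val w ^+ n) = (n == 0%N)%:R.
Proof.
case: n => [|n].
  by under eq_fun do rewrite expr0; rewrite cmean_cst.
pose a : R := n.+1%:R.
have a0 : a != 0 by rewrite pnatr_eq0.
have da (t : R) : is_derive t (1 : R) (fun t => a * t) a.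
  by apply: is_derive_eq; rewrite /GRing.scale/= mulr1.
have E : a * (2 * pi) = 0 + (pi *+ 2) *+ n.+1 :> R.
  by rewrite add0r -[RHS]mulr_natl -(mulr_natl pi 2).
have ca : continuous (fun t : R => a * t) by move=> t; exact: mulrl_continuous.
apply/eqP; rewrite eq_complex/=; apply/andP; split; apply/eqP.
- apply: (@mean_primitive (fun t => cos (a * t)) (fun t => a^-1 * sin (a * t))).
  + by move=> t; rewrite val_cisX.
  + by move=> t; apply: continuous_comp; [exact: ca|exact: continuous_cos].
  + move=> t; have h := is_deriveZ a^-1 (is_derive1_comp (is_derive_sin _) (da t)).
    rewrite (_ : cos (a * t) = a^-1 *: (cos (a * t) * a)); first exact: h.
    by rewrite /GRing.scale/= mulrCA mulVf ?mulr1.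
  + by rewrite E (periodicn (@sinD2pi R)) mulr0.
- apply: (@mean_primitive (fun t => sin (a * t)) (fun t => - a^-1 * cos (a * t))).
  + by move=> t; rewrite val_cisX.
  + by move=> t; apply: continuous_comp; [exact: ca|exact: continuous_sin].
  + move=> t; have h := is_deriveZ (- a^-1) (is_derive1_comp (is_derive_cos _) (da t)).
    rewrite (_ : sin (a * t) = - a^-1 *: (- sin (a * t) * a)); first exact: h.
    by rewrite /GRing.scale/= mulNr mulNr mulrN opprK mulrCA mulVf ?mulr1.
  + by rewrite E (periodicn (@cosD2pi R)) mulr0.
Qed.

Lemma normc_circleX (w : circle R) n : normc (val w ^+ n) = 1.
Proof. by rewrite normcX circle_normc expr1n. Qed.

Lemma mc_circleX n : measurable_circle (fun w : circle R => val w ^+ n).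
Proof. exact: mcX (@mc_id R). Qed.

Lemma mc_circleXJ n : measurable_circle (fun w : circle R => (val w)^* ^+ n).
Proof. exact: mcX (mcJ (@mc_id R)). Qed.

Lemma CL1_expnM n u : CL1 u -> CL1 (fun w : circle R => val w ^+ n * u w).
Proof.
move=> hu; apply: (CL1_bdM (mc_circleX n) _ hu (c := 1)).
by apply: aeW => t _; rewrite normc_circleX.
Qed.

Lemma CL1_expnJM n u : CL1 u -> CL1 (fun w : circle R => (val w)^* ^+ n * u w).
Proof.
move=> hu; apply: (CL1_bdM (mc_circleXJ n) _ hu (c := 1)).
by apply: aeW => t _; rewrite normcX normcJ circle_normc expr1n.
Qed.

Lemma CL1_expn n : CL1 (fun w : circle R => val w ^+ n).
Proof. by apply: (CL1_bd (mc_circleX n) (c := 1)) => w; rewrite normc_circleX. Qed.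

Lemma cmean_expnJ n m :
  cmean (fun w : circle R => (val w)^* ^+ n * val w ^+ m) = (n == m)%:R.
Proof.
have [nm|mn] := leqP n m.
  rewrite -(subnK nm); under eq_fun do rewrite exprD mulrCA -exprMn mulrC
    [_^* * _]mulrC circle_conj expr1n mul1r.
  by rewrite cmean_expn; congr (nat_of_bool _)%:R; apply/eqP/eqP; lia.
rewrite -(subnK (ltnW mn)); under eq_fun do rewrite exprD -mulrA -exprMn
   [_^* * _]mulrC circle_conj expr1n mulr1 -rmorphXn/=.
rewrite cmeanJ; last exact: CL1_expn.
by rewrite cmean_expn conjc_nat; congr (nat_of_bool _)%:R; apply/eqP/eqP; lia.
Qed.

Definition pcirc p : circle R -> R[i] := fun w => p.[val w].

Lemma normc_horner_le p z r : normc z <= r ->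
  normc p.[z] <= \sum_(i < size p) normc p`_i * r ^+ i.
Proof.
move=> zr; rewrite horner_coef (le_trans (normc_sum _ _ _))//.
apply: ler_sum => i _; rewrite normcM normcX ler_wpM2l//.
by rewrite lerXn2r// nnegrE// (le_trans _ zr).
Qed.

Lemma mc_horner p (u : circle R -> R[i]) : measurable_circle u ->
  measurable_circle (fun w => p.[u w]).
Proof.
move=> hu; under eq_fun do rewrite horner_coef.
by apply: mc_sum => i; apply: mcM; [exact: mc_cst|exact: mcX].
Qed.

Lemma L2_pcirc p : L2 (pcirc p).
Proof.
apply: (L2_bd (mc_horner p (@mc_id R))) => w.
by apply: normc_horner_le; rewrite circle_normc.
Qed.

Lemma cmean_pcircX p (r : R) n :
  cmean (fun w : circle R => (val w)^* ^+ n * p.[r%:C * val w]) = p`_n * r%:C ^+ n.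
Proof.
under eq_fun do rewrite horner_coef mulr_sumr.
rewrite cmean_sum; last first.
  move=> i; under eq_fun do rewrite exprMn mulrA.
  have := CL1Z (p`_i * r%:C ^+ i) (CL1_expnJM n (CL1_expn i)).
  by congr CL1; apply/funext => w; ring.
transitivity (\sum_(i < size p) p`_i * r%:C ^+ i * (n == i)%:R).
  apply: eq_bigr => i _; rewrite -cmean_expnJ -cmeanZ; last first.
    exact: CL1_expnJM (CL1_expn i).
  by congr cmean; apply/funext => w; rewrite exprMn; ring.
have [np|pn] := ltnP n (size p).
  rewrite (bigD1 (Ordinal np))//= eqxx mulr1 big1 ?addr0// => i /negPf ni.
  by rewrite eq_sym -val_eqE/= in ni; rewrite ni mulr0.
rewrite nth_default// mul0r big1// => i _.
by rewrite gtn_eqF ?mulr0// (leq_trans (ltn_ord i)).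
Qed.

Lemma cmean_pcirc0 p n : (0 < n)%N -> cmean (fun w => val w ^+ n * pcirc p w) = 0.
Proof.
move=> n0; rewrite /pcirc.
under eq_fun do rewrite horner_coef mulr_sumr.
rewrite cmean_sum; last first.
  move=> i; have := CL1Z (p`_i) (CL1_expnM n (CL1_expn i)).
  by congr CL1; apply/funext => w; ring.
rewrite big1// => i _.
transitivity (p`_i * cmean (fun w => val w ^+ (n + i))).
  rewrite -cmeanZ; last exact: CL1_expn.
  by congr cmean; apply/funext => w; rewrite exprD; ring.
by rewrite cmean_expn addn_eq0 -leqn0 leqNgt n0/= mulr0.
Qed.

End Moments.

(** * Quantitative estimates for the complex exponential *)

Section Cexp.
Variable R : realType.
Implicit Types (z w : R[i]) (x y : R).

Lemma cexpE z : cexp z = (expR (Re z))%:C * (cos (Im z) +i* sin (Im z)).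
Proof. by []. Qed.

Lemma cexpD z w : cexp (z + w) = cexp z * cexp w.
Proof.
rewrite !cexpE ReD ImD expRD cosD sinD; apply/eqP; rewrite eq_complex.
by rewrite !(ReM, ImM)/=; apply/andP; split; apply/eqP; ring.
Qed.

Lemma cexp0 : cexp (0 : R[i]) = 1.
Proof. by rewrite cexpE/= expR0 cos0 sin0 mul1r. Qed.

Lemma normc_cexp z : normc (cexp z) = expR (Re z).
Proof.
by rewrite normcM circle_normc mulr1 normc_real ger0_norm// expR_ge0.
Qed.

Lemma cexp_neq0 z : cexp z != 0.
Proof. by rewrite -normc_eq0 normc_cexp gt_eqF// expR_gt0. Qed.

Lemma cexpN z : cexp (- z) = (cexp z)^-1.
Proof.
by apply: (mulfI (cexp_neq0 z)); rewrite -cexpD subrr cexp0 divff// cexp_neq0.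
Qed.

Lemma cexpMn z n : cexp (n%:R * z) = cexp z ^+ n.
Proof.
elim: n => [|n ih]; first by rewrite mul0r cexp0 expr0.
by rewrite -natr1 mulrDl mul1r cexpD ih exprSr.
Qed.

(** The mean value theorem from the origin. Applied in turn to sin, to cos and to sin t - t, it
    yields the three trigonometric bounds, each from the preceding one. *)
Let lip0 (f df : R -> R) (M x : R) : (forall t : R, is_derive t (1 : R) f (df t)) ->
  (forall t, `|t| <= `|x| -> `|df t| <= M) -> `|f x - f 0| <= M * `|x|.
Proof.
move=> hd hM.
have dF' (t : R) : derivable f t 1 by have [] := hd t.
have cF : continuous f by move=> t; apply/differentiable_continuous/derivable1_diffP.
have [x0|x0] := leP 0 x.
- have [c] := @MVT_segment R f df 0 x x0 (fun t _ => hd t) (continuous_subspaceT cF).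
  rewrite in_itv/= subr0 => /andP[c0 cx] ->; rewrite normrM ler_wpM2r// hM//.
  by rewrite !ger0_norm.
- have [c] := @MVT_segment R f df x 0 (ltW x0) (fun t _ => hd t) (continuous_subspaceT cF).
  rewrite in_itv/= sub0r distrC => /andP[c0 cx] ->; rewrite normrM normrN ler_wpM2r// hM//.
  by rewrite !ler0_norm ?lerN2// ltW.
Qed.

Lemma sin_le x : `|sin x| <= `|x|.
Proof.
have := @lip0 sin cos 1 x (fun t => is_derive_sin t) (fun t _ => cos_max t).
by rewrite sin0 subr0 mul1r.
Qed.

Lemma cos_le x : `|cos x - 1| <= `|x| ^+ 2.
Proof.
have := @lip0 cos (fun t => - sin t) `|x| x (fun t => is_derive_cos t).
rewrite cos0 expr2; apply => t tx; rewrite normrN.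
exact: le_trans (sin_le _) tx.
Qed.

Lemma sin_quad x : `|x| <= 1 -> `|sin x - x| <= `|x| ^+ 2.
Proof.
move=> x1.
have h (t : R) : is_derive t (1 : R) (fun t => sin t - t) (cos t - 1).
  by apply: is_deriveB.
have := @lip0 _ _ `|x| x h; rewrite sin0 !subr0 expr2; apply => t tx.
by rewrite (le_trans (cos_le _))// (le_trans _ tx)// expr2 ler_piMr// (le_trans tx).
Qed.

(** Everything follows from [1 + x <= expR x] at [x] and at [- x]: the latter gives
    [expR x * (1 - x) <= 1], the bound from above. *)
Lemma expR_quad x : `|x| <= 2^-1 -> `|expR x - 1 - x| <= 2 * `|x| ^+ 2.
Proof.
move=> x1; have h := expR_ge1Dx x; have h' := expR_ge1Dx (- x).
have : expR x * expR (- x) = 1 by rewrite -expRD subrr expR0.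
have e0 := expR_gt0 x; move: (expR x) (expR (- x)) e0 h h' => a b a0 h h' ab.
rewrite ger0_norm; last lra.
rewrite real_normK ?num_real//.
have [x2 x3] : -(2^-1) <= x /\ x <= 2^-1 by move: x1; rewrite ler_norml => /andP[].
have : a * (1 - x) <= a * b by rewrite ler_pM2l.
rewrite ab => abx.
have -> : a - 1 - x = a * (1 - x) - 1 + x * (a - 1) by ring.
nra.
Qed.

(** Each of the real and imaginary parts splits into two errors, of at most 3 and 2 times |z|^2. The
    total is 10 |z|^2, and 20 leaves a margin. *)
Lemma cexp_quad z : normc z <= 2^-1 -> normc (cexp z - 1 - z) <= 20 * normc z ^+ 2.
Proof.
move=> z1; have hx := Re_le_normc z; have hy := Im_le_normc z.
have Ex := expR_quad (le_trans hx z1).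
have ey : `|Im z| <= 1 by rewrite (le_trans hy)// (le_trans z1)//; lra.
have Ec := cos_le (Im z); have Es := sin_quad ey.
have n0 := normc_ge0 z.
have a2 : expR (Re z) <= 3.
  have : expR (Re z) - 1 - Re z <= 2 * `|Re z| ^+ 2 by apply: le_trans Ex; exact: ler_norm.
  have : Re z <= 2^-1 by rewrite (le_trans (ler_norm _))// (le_trans hx).
  have : `|Re z| ^+ 2 <= (2^-1) ^+ 2 by rewrite ler_pXn2r ?nnegrE// (le_trans hx).
  by lra.
have ex1 : `|expR (Re z) - 1| <= 2 * normc z.
  have -> : expR (Re z) - 1 = (expR (Re z) - 1 - Re z) + Re z by ring.
  apply: le_trans (ler_normD _ _) _.
  have : `|Re z| ^+ 2 <= normc z * 2^-1.
    by rewrite expr2 ler_pM// (le_trans hx).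
  by lra.
have hx2 : `|Re z| ^+ 2 <= normc z ^+ 2 by rewrite ler_pXn2r ?nnegrE.
have hy2 : `|Im z| ^+ 2 <= normc z ^+ 2 by rewrite ler_pXn2r ?nnegrE.
apply: le_trans (normc_le_ReIm _) _; rewrite !(ReD, ImD, ReN, ImN) !cexpE ReM ImM/=.
rewrite mul0r subr0 oppr0 addr0 mul0r addr0.
have -> : expR (Re z) * cos (Im z) - 1 - Re z =
  expR (Re z) * (cos (Im z) - 1) + (expR (Re z) - 1 - Re z) by ring.
have -> : expR (Re z) * sin (Im z) - Im z =
  expR (Re z) * (sin (Im z) - Im z) + Im z * (expR (Re z) - 1) by ring.
have e0 := expR_ge0 (Re z).
have k1 : `|expR (Re z) * (cos (Im z) - 1)| <= 3 * normc z ^+ 2.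
  by rewrite normrM ger0_norm// ler_pM// (le_trans Ec).
have k2 : `|expR (Re z) * (sin (Im z) - Im z)| <= 3 * normc z ^+ 2.
  by rewrite normrM ger0_norm// ler_pM// (le_trans Es).
have k3 : `|Im z * (expR (Re z) - 1)| <= 2 * normc z ^+ 2.
  by rewrite normrM expr2 mulrCA ler_pM.
have := ler_normD (expR (Re z) * (cos (Im z) - 1)) (expR (Re z) - 1 - Re z).
have := ler_normD (expR (Re z) * (sin (Im z) - Im z)) (Im z * (expR (Re z) - 1)).
have := sqr_ge0 (normc z).
by lra.
Qed.

Lemma normc_subX z w n x : normc z <= x -> normc w <= x ->
  normc (z ^+ n - w ^+ n) <= n%:R * x ^+ n.-1 * normc (z - w).
Proof.
move=> zx wx; rewrite subrXX normcM mulrC ler_wpM2r//.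
apply: le_trans (normc_sum _ _ _) _.
rewrite -[n in n%:R]card_ord -sumr_const mulr_suml; apply: ler_sum => i _.
rewrite mul1r normcM !normcX.
have -> : n.-1 = (n.-1 - i + i)%N by have := ltn_ord i; lia.
have x0 : 0 <= x by apply: le_trans zx.
rewrite exprD subnK; last by have := ltn_ord i; lia.
by apply: ler_pM; rewrite ?exprn_ge0// lerXn2r// nnegrE.
Qed.

(** Euler's limit of (1 + z / m)^m with a rate uniform on |z| <= x, where [m = n + 1]: the m-th
    powers of 1 + z / m and of exp (z / m) are compared by factoring their difference, both bases
    being at most exp (x / m). The condition [2 * x <= m] brings z / m into the range of
    [cexp_quad]. The point is that the approximant is a polynomial in z. *)
Lemma cexp_approx x n : 0 <= x -> 2 * x <= n.+1%:R -> forall z, normc z <= x ->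
  normc ((1 + n.+1%:R^-1 * z) ^+ n.+1 - cexp z) <= 20 * expR x * x ^+ 2 / n.+1%:R.
Proof.
move=> x0 xn z zx; set m : R[i] := n.+1%:R; set k : R := n.+1%:R.
have k0 : 0 < k by rewrite ltr0n.
have m0 : m != 0 by rewrite pnatr_eq0.
have mk : normc m^-1 = k^-1.
  rewrite normcV; congr (_^-1).
  by rewrite -[m](rmorph_nat (real_complex R) n.+1) normc_real ger0_norm ?ler0n.
have {2}-> : z = m * (m^-1 * z) by rewrite mulrA divff ?mul1r.
rewrite cexpMn; set v := m^-1 * z.
have nv : normc v <= x / k by rewrite /v normcM mk mulrC ler_pM2r ?invr_gt0.
have e1 : normc (1 + v) <= expR (x / k).
  apply: le_trans (normcD_le _ _) _; rewrite normc1.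
  by apply: le_trans (expR_ge1Dx _); rewrite lerD2l.
have e2 : normc (cexp v) <= expR (x / k).
  by rewrite normc_cexp ler_expR (le_trans (Re_ler_normc _)).
apply: le_trans (normc_subX _ e1 e2) _.
have hq : normc (1 + v - cexp v) <= 20 * (x / k) ^+ 2.
  rewrite normcBC opprD addrA.
  apply: le_trans (cexp_quad _) _.
    by rewrite (le_trans nv)// ler_pdivrMr// mulrC ler_pdivlMr// mulrC.
  by rewrite ler_pM2l// lerXn2r// nnegrE// divr_ge0// ltW.
have hx : expR (x / k) ^+ n <= expR x.
  by rewrite -expRM_natl ler_expR mulrCA ler_piMr// ler_pdivrMr// mul1r ler_nat.
rewrite -/k -pred_Sn.
apply: (@le_trans _ _ (k * expR x * (20 * (x / k) ^+ 2))).
  apply: ler_pM => //.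
    by rewrite mulr_ge0 ?exprn_ge0 ?expR_ge0// ltW.
  by rewrite ler_pM2l.
rewrite le_eqVlt; apply/orP; left; apply/eqP; rewrite expr_div_n.
by field; rewrite gt_eqF.
Qed.

(** The constant is 11 because 20 |d|^2 + |d| <= 11 |d| for |d| <= 1/2. *)
Lemma cexp_lip z w : normc (z - w) <= 2^-1 ->
  normc (cexp z - cexp w) <= 11 * expR (Re w) * normc (z - w).
Proof.
move=> h; rewrite -[z in cexp z](subrK w) cexpD -[X in _ - X]mul1r -mulrBl normcM.
rewrite normc_cexp mulrAC; apply: ler_wpM2r; first exact: expR_ge0.
have -> : cexp (z - w) - 1 = (cexp (z - w) - 1 - (z - w)) + (z - w) by ring.
apply: le_trans (normcD_le _ _) _.
have := cexp_quad h; have := normc_ge0 (z - w); nra.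
Qed.

End Cexp.

(** * Analytic functions of the disc as locally uniform limits of polynomials *)

Section LocallyUniformLimits.
Variable R : realType.
Local Notation "x ^*" := (conjc x) : ring_scope.
Implicit Types (F G : R[i] -> R[i]) (p q : {poly R[i]}) (z : R[i]) (r e : R).

(* Being a locally uniform limit of polynomials is equivalent to [analytic_disc],
   and is visibly stable under products and exponentials. *)
Definition lunif F : Prop := forall r, 0 <= r < 1 -> forall e, 0 < e ->
  exists p, forall z, normc z <= r -> normc (p.[z] - F z) < e.

Lemma inv_nat_lt e : 0 < e -> exists N, forall n, (N <= n)%N -> n.+1%:R^-1 < e.
Proof.
move=> e0; exists (Num.truncn e^-1) => n Nn.
rewrite invf_plt ?posrE ?ltr0n// (lt_le_trans (truncnS_gt _))//.
by rewrite ler_nat.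
Qed.

Lemma cvgC_inv (u : nat -> R[i]) l : (forall n, normc (u n - l) < n.+1%:R^-1) ->
  (u n : R[i]^o) @[n --> \oo] --> (l : R[i]^o).
Proof.
move=> h; apply/cvgCP => e e0; have [N hN] := inv_nat_lt e0.
by exists N => // n Nn; exact: lt_trans (h n) (hN n Nn).
Qed.

Lemma lunif_seq F r : lunif F -> 0 <= r < 1 ->
  exists p_ : nat -> {poly R[i]}, forall n z, normc z <= r ->
    normc ((p_ n).[z] - F z) < n.+1%:R^-1.
Proof.
move=> hF r01; suff [p_ h] : {p_ : nat -> {poly R[i]} & forall n z, normc z <= r ->
    normc ((p_ n).[z] - F z) < n.+1%:R^-1} by exists p_.
apply: (@choice _ _ (fun n p => forall z, normc z <= r ->
    normc (p.[z] - F z) < n.+1%:R^-1)) => n.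
by apply: hF => //; rewrite invr_gt0 ltr0n.
Qed.

Lemma lunif_ext F G : (forall z, normc z < 1 -> F z = G z) -> lunif F -> lunif G.
Proof.
move=> FG hF r /andP[r0 r1] e e0.
have [|p hp] := hF r _ e e0; first by rewrite r0.
by exists p => z zr; rewrite -FG ?hp// (le_lt_trans zr).
Qed.

Lemma lunif_horner p : lunif (fun z => p.[z]).
Proof. by move=> r _ e e0; exists p => z _; rewrite subrr normc0. Qed.

Lemma lunif_cst c : lunif (fun=> c).
Proof. by have := lunif_horner c%:P; under eq_fun do rewrite hornerC. Qed.

Lemma lunif_bd F r : lunif F -> 0 <= r < 1 ->
  exists2 M, 0 < M & forall z, normc z <= r -> normc (F z) <= M.
Proof.
move=> hF r01; have [p hp] := hF r r01 1 ltr01; have /andP[r0 _] := r01.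
exists (1 + \sum_(i < size p) normc p`_i * r ^+ i).
  by rewrite ltr_pwDl// sumr_ge0// => i _; rewrite mulr_ge0 ?exprn_ge0.
move=> z zr; rewrite -[F z](subKr p.[z]) (le_trans (normcD_le _ _))// normcN.
by rewrite addrC lerD//; [exact/ltW/hp|exact: normc_horner_le].
Qed.

Lemma lunifD F G : lunif F -> lunif G -> lunif (fun z => F z + G z).
Proof.
move=> hF hG r r01 e e0; have e2 : 0 < e / 2 by rewrite divr_gt0.
have [p hp] := hF r r01 _ e2; have [q hq] := hG r r01 _ e2.
exists (p + q) => z zr; rewrite hornerD.
have -> : p.[z] + q.[z] - (F z + G z) = (p.[z] - F z) + (q.[z] - G z) by ring.
by apply: le_lt_trans (normcD_le _ _) _; rewrite [e]splitr ltrD ?hp ?hq.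
Qed.

Lemma lunifM F G : lunif F -> lunif G -> lunif (fun z => F z * G z).
Proof.
move=> hF hG r r01 e e0.
have [A A0 hA] := lunif_bd hF r01; have [B B0 hB] := lunif_bd hG r01.
pose d := Num.min 1 (e / (A + B + 1)).
have AB : 0 < A + B + 1 by rewrite !addr_gt0.
have d0 : 0 < d by rewrite lt_min ltr01 divr_gt0.
have [p hp] := hF r r01 _ d0; have [q hq] := hG r r01 _ d0.
exists (p * q) => z zr; rewrite hornerM.
have -> : p.[z] * q.[z] - F z * G z =
  (p.[z] - F z) * (q.[z] - G z) + F z * (q.[z] - G z) + (p.[z] - F z) * G z by ring.
have a := hp z zr; have b := hq z zr; have c := hA z zr; have c' := hB z zr.
apply: (@le_lt_trans _ _ (normc (p.[z] - F z) * normc (q.[z] - G z) +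
   normc (F z) * normc (q.[z] - G z) + normc (p.[z] - F z) * normc (G z))).
  rewrite -!normcM (le_trans (normcD_le _ _))// lerD2r normcD_le//.
have d1 : d <= 1 by rewrite ge_min lexx.
have de : d * (A + B + 1) <= e by rewrite -ler_pdivlMr// ge_min lexx orbT.
have x0 := normc_ge0 (p.[z] - F z); have y0 := normc_ge0 (q.[z] - G z).
have f0 := normc_ge0 (F z); have g0 := normc_ge0 (G z).
move: (normc (p.[z] - F z)) (normc (q.[z] - G z)) (normc (F z)) (normc (G z))
  x0 y0 f0 g0 a b c c' => x y f g x0 y0 f0 g0 a b c c'.
have h1 : x * y <= x * 1 by rewrite ler_wpM2l// (le_trans (ltW b)).
have h2 : f * y <= A * y by rewrite ler_wpM2r.
have h3 : x * g <= x * B by rewrite ler_wpM2l.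
have h4 : x * (1 + B) < d * (1 + B) by rewrite ltr_pM2r// addr_gt0.
have h5 : A * y < A * d by rewrite ltr_pM2l.
lra.
Qed.

(** Two approximations are composed: a polynomial [p] for [F], then Euler's power (1 + p / (N +
    1))^(N + 1), again a polynomial, for exp p. *)
Lemma lunif_cexp F : lunif F -> lunif (fun z => cexp (F z)).
Proof.
move=> hF r r01 e e0.
have [A A0 hA] := lunif_bd hF r01.
(* 1/2 is the range of [cexp_lip], and the other term makes its bound at most e / 2; as [d <= 1],
   [p] is bounded by [B = A + 1]. *)
pose d := Num.min 2^-1 (e / 2 / (22 * expR A)).
have E0 : 0 < 22 * expR A by rewrite mulr_gt0// expR_gt0.
have d0 : 0 < d by rewrite lt_min invr_gt0 ltr0n /= !divr_gt0.
have [p hp] := hF r r01 _ d0.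
pose B := A + 1; have B0 : 0 < B by rewrite addr_gt0.
pose K := 20 * expR B * B ^+ 2.
have K0 : 0 < K by rewrite !mulr_gt0// ?expR_gt0// exprn_gt0.
have eK : 0 < Num.min (e / 2 / K) (2 * B)^-1.
  by rewrite lt_min !divr_gt0//= invr_gt0 mulr_gt0.
have [N hN] := inv_nat_lt eK.
have := hN N (leqnn _); rewrite lt_min => /andP[N1 N2].
exists ((1 + (N.+1%:R^-1) *: p) ^+ N.+1) => z zr.
have pz := hp z zr; have Az := hA z zr.
have pB : normc p.[z] <= B.
  rewrite -[p.[z]](subrK (F z)) (le_trans (normcD_le _ _))// addrC lerD//.
  rewrite (le_trans (ltW pz))// ge_min; apply/orP; left; lra.
rewrite horner_exp hornerD hornerC hornerZ.
have h1 : normc ((1 + N.+1%:R^-1 * p.[z]) ^+ N.+1 - cexp p.[z]) < e / 2.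
  apply: le_lt_trans (cexp_approx (ltW B0) _ pB) _.
    by rewrite -lef_pV2 ?posrE ?mulr_gt0 ?ltr0n// ltW.
  by rewrite -/K mulrC -ltr_pdivlMr.
have h2 : normc (cexp p.[z] - cexp (F z)) <= e / 2.
  apply: le_trans (cexp_lip _) _.
    by rewrite (le_trans (ltW pz))// ge_min lexx.
  have : normc (p.[z] - F z) * (22 * expR A) <= e / 2.
    by rewrite -ler_pdivlMr// (le_trans (ltW pz))// ge_min lexx orbT.
  apply: le_trans; rewrite mulrC ler_wpM2l//.
  have : expR (Re (F z)) <= expR A by rewrite ler_expR (le_trans (Re_ler_normc _)).
  have := expR_ge0 (Re (F z)); lra.
rewrite -(subrKA (cexp p.[z])).
by apply: le_lt_trans (normcD_le _ _) _; rewrite [e]splitr ltr_leD.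
Qed.

Lemma on_circle_norm r (w : circle R) : 0 <= r -> normc (r%:C * val w) = r.
Proof. by move=> r0; rewrite normcM circle_normc mulr1 normc_real ger0_norm. Qed.

Lemma lunif_mc F r : lunif F -> 0 <= r < 1 -> measurable_circle (on_circle F r).
Proof.
move=> hF r01; have [p_ hp] := lunif_seq hF r01; have /andP[r0 _] := r01.
apply: (@mc_lim _ (fun n w => (p_ n).[r%:C * val w])).
  by move=> n; apply: mc_horner; apply: mcM; [exact: mc_cst|exact: mc_id].
by move=> w; apply: cvgC_inv => n; apply: hp; rewrite on_circle_norm.
Qed.

Lemma lunif_L2 F r : lunif F -> 0 <= r < 1 -> L2 (on_circle F r).
Proof.
move=> hF r01; have [M _ hM] := lunif_bd hF r01; have /andP[r0 _] := r01.
by apply: (L2_bd (lunif_mc hF r01)) => w; apply: hM; rewrite on_circle_norm.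
Qed.

Lemma cmean_dist (u v : circle R -> R[i]) e : CL1 u -> CL1 v ->
  (forall w, normc (u w - v w) <= e) -> normc (cmean u - cmean v) <= e.
Proof.
move=> hu hv h; rewrite -cmeanB//; have huv := CL1B hu hv.
apply: le_trans (normc_cmean_le huv) _; rewrite -[leRHS](@mean_cst R).
by apply: le_mean; [exact: CL1_normc|exact: L1_cst|apply: aeW => t _].
Qed.

Lemma cmean_on_circle_approx F p r e n : lunif F -> 0 <= r < 1 ->
  (forall z, normc z <= r -> normc (p.[z] - F z) <= e) ->
  normc (cmean (fun w => (val w)^* ^+ n * on_circle F r w) - p`_n * r%:C ^+ n) <= e.
Proof.
move=> hF r01 hp; rewrite -cmean_pcircX; have /andP[r0 _] := r01.
apply: cmean_dist.
- by apply: CL1_expnJM; apply: L2_CL1; exact: lunif_L2.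
- apply: CL1_expnJM; apply: L2_CL1.
  by apply: (lunif_L2 (F := horner p)) => //; exact: lunif_horner.
- move=> w; rewrite -mulrBr normcM normcX normcJ circle_normc expr1n mul1r.
  by rewrite normcBC hp// on_circle_norm.
Qed.

(** The mean value property, inherited from the approximating polynomials. *)
Lemma cmean_on_circle F r : lunif F -> 0 <= r < 1 -> cmean (on_circle F r) = F 0.
Proof.
move=> hF r01; have /andP[r0 _] := r01.
apply/eqP; rewrite -subr_eq0 -normc_eq0 eq_le normc_ge0 andbT.
apply/ler_addgt0Pl => e e0; rewrite addr0.
have e2 : 0 < e / 2 by rewrite divr_gt0.
have [p hp] := hF r r01 _ e2.
have := @cmean_on_circle_approx F p r (e / 2) 0 hF r01 (fun z zr => ltW (hp z zr)).
rewrite (_ : (fun w => _ ^+ 0 * _) = on_circle F r); last first.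
  by apply/funext => w; rewrite expr0 mul1r.
rewrite expr0 mulr1 => h; have := hp 0; rewrite normc0 horner_coef0 => /(_ r0) h'.
have -> : cmean (on_circle F r) - F 0 = (cmean (on_circle F r) - p`_0) + (p`_0 - F 0) by ring.
by rewrite (le_trans (normcD_le _ _))// [e]splitr lerD// ltW.
Qed.

Lemma geo_le (x : R) m n : 0 <= x < 1 -> \sum_(m <= k < n) x ^+ k <= x ^+ m / (1 - x).
Proof.
move=> /andP[x0 x1]; have h : 0 < 1 - x by rewrite subr_gt0.
rewrite ler_pdivlMr//.
have [nm|mn] := leqP n m; first by rewrite big_geq// mul0r exprn_ge0.
suff -> : (\sum_(m <= k < n) x ^+ k) * (1 - x) = x ^+ m - x ^+ n.
  by rewrite lerBlDr lerDl exprn_ge0.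
rewrite mulr_suml (telescope_sumr_eq (fun k => - x ^+ k)) ?(ltnW mn)//.
  by rewrite opprK addrC.
by move=> k _; rewrite exprS; ring.
Qed.

Lemma horner_psum (c : nat -> R[i]) N z :
  (\poly_(k < N) c k).[z] = \sum_(0 <= k < N) c k * z ^+ k.
Proof. by rewrite horner_poly big_mkord. Qed.

(** Pointwise convergence at an intermediate radius [s] bounds the terms there, so on |z| <= r the
    tails are dominated by a geometric series of ratio [q = r / s]. *)
Lemma power_series_lunif F (c : nat -> R[i]) :
  (forall z, normc z < 1 ->
    (\sum_(0 <= k < n) c k * z ^+ k : R[i]^o) @[n --> \oo] --> (F z : R[i]^o)) ->
  forall r, 0 <= r < 1 -> forall e, 0 < e -> exists N, forall n, (N <= n)%N ->
  forall z, normc z <= r -> normc ((\poly_(k < n) c k).[z] - F z) <= e.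
Proof.
move=> hF r /andP[r0 r1] e e0.
pose s := (r + 1) / 2.
have [rs s1 s0] : [/\ r < s, s < 1 & 0 < s] by rewrite /s; split; lra.
have ns : normc (s%:C) = s by rewrite normc_real ger0_norm// ltW.
(* From the index [N] on, a term is the difference of two partial sums at distance less than 1 from
   the limit, hence the 2; the earlier terms are bounded by their sum. *)
have [M M0 hM] : exists2 M : R, 0 < M & forall n, normc (c n) * s ^+ n <= M.
  have := hF s%:C; rewrite ns => /(_ s1)/cvgCP/(_ 1 ltr01)[N _ hN].
  exists (2 + \sum_(k < N) normc (c k) * s ^+ k).
    by rewrite ltr_pwDl// sumr_ge0// => i _; rewrite mulr_ge0 ?exprn_ge0 ?(ltW s0).
  move=> n; have [nN|Nn] := ltnP n N.
    rewrite (bigD1 (Ordinal nN))//= addrCA lerDl addr_ge0// sumr_ge0// => i _.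
    by rewrite mulr_ge0 ?exprn_ge0 ?(ltW s0).
  have h1 := hN n Nn; have h2 := hN n.+1 (leqW Nn).
  have -> : normc (c n) * s ^+ n = normc (c n * s%:C ^+ n) by rewrite normcM normcX ns.
  have -> : c n * s%:C ^+ n = (\sum_(0 <= k < n.+1) c k * s%:C ^+ k - F s%:C) -
    (\sum_(0 <= k < n) c k * s%:C ^+ k - F s%:C) by rewrite big_nat_recr//=; ring.
  rewrite (le_trans (normcD_le _ _))// normcN.
  rewrite (@le_trans _ _ 2)//; last first.
    by rewrite lerDl sumr_ge0// => i _; rewrite mulr_ge0 ?exprn_ge0 ?(ltW s0).
  by rewrite -[2]/(1 + 1) lerD// ltW.
pose q := r / s.
have q01 : 0 <= q < 1 by rewrite divr_ge0 ?(ltW s0)//= ltr_pdivrMr// mul1r.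
have tail n m z : (n <= m)%N -> normc z <= r ->
  normc (\sum_(0 <= k < m) c k * z ^+ k - \sum_(0 <= k < n) c k * z ^+ k) <= M * (q ^+ n / (1 - q)).
  move=> nm zr; rewrite (@big_cat_nat _ _ _ n)//= addrAC subrr add0r.
  apply: le_trans (normc_sum _ _ _) _.
  apply: (@le_trans _ _ (M * \sum_(n <= k < m) q ^+ k)); last first.
    by rewrite ler_pM2l// geo_le.
  rewrite mulr_sumr; apply: ler_sum => k _.
  rewrite normcM normcX expr_div_n -(@ler_pM2r _ (s ^+ k)) ?exprn_gt0//.
  rewrite mulrAC -[leRHS]mulrA divfK ?expf_neq0 ?gt_eqF//.
  apply: ler_pM => //; first by rewrite mulr_ge0// exprn_ge0// ltW.
    by rewrite exprn_ge0.
  by rewrite lerXn2r// nnegrE.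
have tail' n z : normc z <= r -> normc (F z - \sum_(0 <= k < n) c k * z ^+ k) <= M * (q ^+ n / (1 - q)).
  move=> zr; apply/ler_addgt0Pl => d d0.
  have /cvgCP/(_ _ d0)[N _ hN] := hF z (le_lt_trans zr r1).
  have h1 := hN (maxn N n) (leq_maxl _ _); have h2 := tail n (maxn N n) z (leq_maxr _ _) zr.
  rewrite normcBC in h1.
  rewrite -(subrK (\sum_(0 <= k < maxn N n) c k * z ^+ k) (F z)) -addrA.
  by rewrite (le_trans (normcD_le _ _))// lerD// ltW.
have q1 : 0 < 1 - q by rewrite subr_gt0; case/andP: q01.
have /cvgrPdist_lt/(_ (e * (1 - q) / M)) : (q ^+ n) @[n --> \oo] --> (0 : R).
  by apply: cvg_expr; rewrite ger0_norm; case/andP: q01.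
case; first by rewrite !(divr_gt0, mulr_gt0).
move=> N _ hN; exists N => n Nn z zr; rewrite horner_psum normcBC.
apply: le_trans (tail' n z zr) _.
have := hN n Nn; rewrite sub0r normrN ger0_norm; last by rewrite exprn_ge0//; case/andP: q01.
by move/ltW; rewrite ler_pdivlMr// mulrC mulrA ler_pdivrMr.
Qed.

Lemma analytic_lunif F : analytic_disc F -> lunif F.
Proof.
move=> [c hF] r r01 e e0; have e2 : 0 < e / 2 by rewrite divr_gt0.
have [N hN] := power_series_lunif hF r01 e2.
by exists (\poly_(k < N) c k) => z zr; rewrite (le_lt_trans (hN N (leqnn _) z zr)) //; lra.
Qed.

(** Cauchy's coefficient formula: the coefficients of the truncations are exact as soon as their
    degree exceeds [n]. *)
Lemma power_series_coef F (c : nat -> R[i]) r n :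
  (forall z, normc z < 1 ->
    (\sum_(0 <= k < n) c k * z ^+ k : R[i]^o) @[n --> \oo] --> (F z : R[i]^o)) ->
  0 <= r < 1 ->
  cmean (fun w => (val w)^* ^+ n * on_circle F r w) = c n * r%:C ^+ n.
Proof.
move=> hF r01; have lF : lunif F by apply: analytic_lunif; exists c.
apply/eqP; rewrite -subr_eq0 -normc_eq0 eq_le normc_ge0 andbT.
apply/ler_addgt0Pl => e e0; rewrite addr0.
have [N hN] := power_series_lunif hF r01 e0.
have := cmean_on_circle_approx n lF r01 (hN (maxn N n.+1) (leq_maxl _ _)).
by rewrite coef_poly leq_max ltnSn orbT.
Qed.

(** The Taylor coefficients are read off as Fourier coefficients on the circle of radius 1/2. They
    are then compared with those of a polynomial close to [F] on a larger disc |z| <= r, by Cauchy's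
    formula on the circle of radius [r]. *)
Lemma lunif_analytic F : lunif F -> analytic_disc F.
Proof.
move=> hF; have h2 : 0 <= (2^-1 : R) < 1 by rewrite invr_ge0 ler0n invf_lt1 ?ltr1n.
pose A r n := cmean (fun w => (val w)^* ^+ n * on_circle F r w).
pose c n := A 2^-1 n * 2 ^+ n.
(* The coefficients do not depend on the radius: an approximation on |z| <= r controls both circles,
   since [r] is at least 1/2. This lower bound is why [r] below is taken as (1 + |z|) / 2. *)
have cA r n : 2^-1 <= r -> r < 1 -> c n * r%:C ^+ n = A r n.
  move=> r2 r1; have r0 : 0 <= r by rewrite (le_trans _ r2)// invr_ge0.
  have r01 : 0 <= r < 1 by rewrite r0.
  apply/eqP; rewrite -subr_eq0 -normc_eq0 eq_le normc_ge0 andbT.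
  apply/ler_addgt0Pl => e e0; rewrite addr0.
  pose d := e / (1 + 2 ^+ n).
  have D0 : 0 < 1 + 2 ^+ n :> R by rewrite ltr_pwDl// exprn_ge0.
  have d0 : 0 < d by rewrite divr_gt0.
  have [p hp] := hF r r01 _ d0.
  have a1 : normc (A r n - p`_n * r%:C ^+ n) <= d.
    by apply: cmean_on_circle_approx => // z zr; exact/ltW/hp.
  have a2 : normc (A 2^-1 n - p`_n * (2^-1)%:C ^+ n) <= d.
    by apply: cmean_on_circle_approx => // z zr; exact/ltW/hp/(le_trans zr).
  have -> : c n * r%:C ^+ n - A r n = (A 2^-1 n - p`_n * (2^-1)%:C ^+ n) * (2 ^+ n * r%:C ^+ n)
     - (A r n - p`_n * r%:C ^+ n).
    have : (2^-1)%:C ^+ n * 2 ^+ n = 1 :> R[i].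
      by rewrite -exprMn fmorphV rmorph_nat mulVf ?expr1n// pnatr_eq0.
    by rewrite /c => h; ring: h.
  rewrite (le_trans (normcD_le _ _))// normcN normcM.
  have n2 : normc (2 ^+ n * r%:C ^+ n) <= 2 ^+ n.
    have E2 : normc (2 : R[i]) = 2.
      by rewrite -(rmorph_nat (real_complex R)) normc_real ger0_norm.
    rewrite normcM !normcX E2 normc_real.
    rewrite !ger0_norm// ler_piMr ?exprn_ge0// exprn_ile1// ltW//.
  rewrite (@le_trans _ _ (d * 2 ^+ n + d))//.
    by rewrite lerD// ler_pM.
  by rewrite -[X in _ + X]mulr1 -mulrDr addrC /d divfK// gt_eqF.
exists c => z z1; apply/cvgCP => e e0.
pose r := (1 + normc z) / 2.
have z0 := normc_ge0 z.
have [zr r2 r1] : [/\ normc z < r, 2^-1 <= r & r < 1] by rewrite /r; split; lra.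
have r0 : 0 < r by lra.
have r01 : 0 <= r < 1 by rewrite (ltW r0).
pose q := normc z / r.
have q01 : 0 <= q < 1 by rewrite divr_ge0 ?(ltW r0)//= ltr_pdivrMr// mul1r.
have q1 : 0 < 1 - q by rewrite subr_gt0; case/andP: q01.
pose d := e / 2 / (1 + (1 - q)^-1).
have D0 : 0 < 1 + (1 - q)^-1 by rewrite addr_gt0// invr_gt0.
have d0 : 0 < d by rewrite !divr_gt0.
have [p hp] := hF r r01 _ d0.
(* From this index on the partial sum of [p] is [p] itself, and the remaining error is at most d /
   (1 - q) + d = e / 2. *)
exists (size p) => // n /= pn.
have pE : p.[z] = \sum_(0 <= k < n) p`_k * z ^+ k.
  by rewrite (horner_coef_wide _ pn) big_mkord.
have -> : \sum_(0 <= k < n) c k * z ^+ k - F z =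
    \sum_(0 <= k < n) (c k - p`_k) * z ^+ k + (p.[z] - F z).
  rewrite pE addrA -big_split/=; congr (_ - _); apply: eq_bigr => k _; ring.
apply: le_lt_trans (normcD_le _ _) _.
have h1 : normc (\sum_(0 <= k < n) (c k - p`_k) * z ^+ k) <= d * (1 - q)^-1.
  apply: le_trans (normc_sum _ _ _) _.
  apply: (@le_trans _ _ (d * \sum_(0 <= k < n) q ^+ k)); last first.
    by rewrite ler_pM2l// (le_trans (geo_le _ _ q01))// expr0 div1r.
  rewrite mulr_sumr; apply: ler_sum => k _.
  have a1 : normc (A r k - p`_k * r%:C ^+ k) <= d.
    by apply: cmean_on_circle_approx => // y yr; exact/ltW/hp.
  rewrite -cA ?(ltW r1)// -mulrBl in a1.
  rewrite normcM normcX normc_real (ger0_norm (ltW r0)) in a1.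
  rewrite normcM normcX expr_div_n mulrA ler_pdivlMr ?exprn_gt0//.
  by rewrite mulrAC ler_wpM2r ?exprn_ge0.
have h2' := hp z (ltW zr).
apply: (@le_lt_trans _ _ (d * (1 - q)^-1 + d)); first by rewrite lerD// ltW.
rewrite -[X in _ + X]mulr1 -mulrDr addrC /d divfK ?gt_eqF//; lra.
Qed.

End LocallyUniformLimits.

(** * Herglotz and Poisson kernels and their integrals *)

Section Kernels.
Variable R : realType.
Local Notation "x ^*" := (conjc x) : ring_scope.
Implicit Types (z : R[i]) (w : circle R) (u v : circle R -> R[i]) (g h k : circle R -> R).
Implicit Types (p : {poly R[i]}) (r e : R).

Definition hker z w : R[i] := (val w + z) / (val w - z).
(** The Herglotz kernel expands as 1 + 2 sum_(n >= 1) (z conj w)^n. *)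
Definition hcoef n : R[i] := if n == 0%N then 1 else 2.
Definition hker_trunc N z w := \sum_(0 <= n < N.+1) hcoef n * (z ^+ n * (val w)^* ^+ n).

Lemma hker_truncE N z w : (1 - z * (val w)^*) * hker_trunc N z w =
  1 + z * (val w)^* - 2 * (z * (val w)^*) ^+ N.+1.
Proof.
rewrite /hker_trunc; elim: N => [|N ih].
  by rewrite big_nat1 /hcoef/= !expr0; ring.
by rewrite big_nat_recr//= mulrDr ih /hcoef/= !exprMn !exprS; ring.
Qed.

Let q_neq1 z w : normc z < 1 -> 1 - z * (val w)^* != 0.
Proof.
move=> z1; rewrite subr_eq0; apply/eqP => /(congr1 (@normc R)).
by rewrite normcM normcJ circle_normc mulr1 normc1 => E; rewrite -E ltxx in z1.
Qed.

Lemma hkerE z w : normc z < 1 -> hker z w = (1 + z * (val w)^*) / (1 - z * (val w)^*).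
Proof.
move=> z1; have d0 := circleB_neq0 w z1; have d1 := q_neq1 w z1.
apply/eqP; rewrite /hker eqr_div//; apply/eqP.
have := circle_conj w; move: (val w)^* (val w) => a b ab.
by rewrite -ab; ring.
Qed.

Lemma hker_approx N z w r : normc z <= r -> r < 1 ->
  normc (hker z w - hker_trunc N z w) <= 2 * r ^+ N.+1 / (1 - r).
Proof.
move=> zr r1; have z1 := le_lt_trans zr r1; have d1 := q_neq1 w z1.
set q := z * (val w)^*.
have nq : normc q = normc z by rewrite normcM normcJ circle_normc mulr1.
have -> : hker z w - hker_trunc N z w = 2 * q ^+ N.+1 / (1 - q).
  rewrite hkerE//; apply: (mulfI d1); rewrite mulrBr hker_truncE -/q.
  by rewrite mulrCA divff// mulr1 mulrCA divff// mulr1; ring.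
have r0 : 0 <= r by apply: le_trans zr.
have n2 : normc (2 : R[i]) = 2 by rewrite -(rmorph_nat (real_complex R)) normc_real ger0_norm.
rewrite normc_div normcM n2 normcX nq; apply: ler_pM.
- by rewrite mulr_ge0// exprn_ge0.
- by rewrite invr_ge0.
- by rewrite ler_wpM2l// lerXn2r ?nnegrE.
- rewrite lef_pV2 ?posrE ?subr_gt0// ?normc_gt0//.
  apply: le_trans (normcB_le _ _); rewrite normc1 nq; lra.
Qed.

Lemma geo_bound_eq0 (x : R[i]) (K r : R) : 0 <= r < 1 ->
  (forall N, normc x <= K * r ^+ N) -> x = 0.
Proof.
move=> /andP[r0 r1] h; apply/eqP; rewrite -normc_eq0 eq_le normc_ge0 andbT.
have c : (K * r ^+ N) @[N --> \oo] --> K * 0.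
  by apply: cvgM; [exact: cvg_cst|apply: cvg_expr; rewrite ger0_norm].
rewrite mulr0 in c; rewrite -(cvg_lim _ c)//.
by apply: limr_ge; [apply/cvg_ex; exists 0|exact: nearW].
Qed.

Lemma hker_mc z : normc z < 1 -> measurable_circle (hker z).
Proof.
move=> z1; apply: (@mc_lim _ (fun N => hker_trunc N z)).
  move=> N; apply: mc_sum => i; apply: mcM; first exact: mc_cst.
  by apply: mcM; [exact: mc_cst|exact: mc_circleXJ].
move=> w; apply/cvgCP => e e0.
have r0 := normc_ge0 z; have r1 : 0 < 1 - normc z by rewrite subr_gt0.
have /cvgrPdist_lt/(_ (e * (1 - normc z) / 2)) :
    (normc z ^+ n) @[n --> \oo] --> (0 : R) by apply: cvg_expr; rewrite ger0_norm.
case; first by rewrite divr_gt0// mulr_gt0.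
move=> N _ hN; exists N => // n Nn; rewrite normcBC.
apply: le_lt_trans (hker_approx n w (lexx _) z1) _.
have := hN n.+1 (leqW Nn); rewrite sub0r normrN ger0_norm ?exprn_ge0//.
by rewrite ltr_pdivlMr// ltr_pdivrMr// mulrC.
Qed.

Lemma hker_bd z w : normc z < 1 -> normc (hker z w) <= 2 / (1 - normc z).
Proof.
move=> z1; have r1 : 0 < 1 - normc z by rewrite subr_gt0.
rewrite normc_div; apply: ler_pM; rewrite ?invr_ge0//.
  by rewrite (le_trans (normcD_le _ _))// circle_normc; lra.
rewrite lef_pV2 ?posrE// ?normc_gt0 ?circleB_neq0//.
by apply: le_trans (normcB_le _ _); rewrite circle_normc.
Qed.

Lemma CL1_hker u z : normc z < 1 -> CL1 u -> CL1 (fun w => hker z w * u w).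
Proof.
move=> z1 hu; apply: (CL1_bdM (hker_mc z1) _ hu).
by apply: aeW => t _; exact: hker_bd.
Qed.

Definition herglotz u z : R[i] := cmean (fun w => hker z w * u w).

Definition hpoly u N : {poly R[i]} :=
  \poly_(n < N.+1) (hcoef n * cmean (fun w => (val w)^* ^+ n * u w)).

Lemma hpolyE u N z : CL1 u -> (hpoly u N).[z] = cmean (fun w => hker_trunc N z w * u w).
Proof.
move=> hu; rewrite horner_psum /hker_trunc; under [in RHS]eq_fun do rewrite mulr_suml.
rewrite cmean_sum; last first.
  move=> n; have := CL1Z (hcoef n * z ^+ n) (CL1_expnJM n hu).
  by congr CL1; apply/funext => w; ring.
apply: eq_bigr => n _.
transitivity (hcoef n * z ^+ n * cmean (fun w => (val w)^* ^+ n * u w)); first ring.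
rewrite -cmeanZ; last exact: CL1_expnJM.
by congr cmean; apply/funext => w; ring.
Qed.

(** The truncated kernel integrates to a polynomial in z and the kernel error is uniform in w; this
    is the source of analyticity for Herglotz integrals of arbitrary integrable functions. *)
Lemma herglotz_approx u N z r : CL1 u -> normc z <= r -> r < 1 ->
  normc (herglotz u z - (hpoly u N).[z]) <=
  2 * r ^+ N.+1 / (1 - r) * mean (fun w => normc (u w)).
Proof.
move=> hu zr r1; have z1 := le_lt_trans zr r1.
have a : CL1 (fun w => hker z w * u w) by exact: CL1_hker.
have b : CL1 (fun w => hker_trunc N z w * u w).
  under eq_fun do rewrite mulr_suml; apply: CL1_sum => n.
  have := CL1Z (hcoef n * z ^+ n) (CL1_expnJM n hu).
  by congr CL1; apply/funext => w; ring.
rewrite hpolyE// /herglotz -cmeanB//; have ab := CL1B a b.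
apply: le_trans (normc_cmean_le ab) _.
rewrite -meanZ; last exact: CL1_normc.
apply: le_mean; [exact: CL1_normc|by apply: L1Z; exact: CL1_normc|].
by apply: aeW => t _; rewrite -mulrBl normcM ler_wpM2r// hker_approx.
Qed.

Lemma lunif_herglotz u : CL1 u -> lunif (herglotz u).
Proof.
move=> hu r /andP[r0 r1] e e0.
set K := mean (fun w => normc (u w)).
have K0 : 0 <= K by apply: mean_ge0; [exact: CL1_normc|exact: aeW].
have r1' : 0 < 1 - r by rewrite subr_gt0.
have d0 : 0 < 2 / (1 - r) * K + 1 by rewrite ltr_wpDl// mulr_ge0// divr_ge0// ltW.
have /cvgrPdist_lt/(_ (e / (2 / (1 - r) * K + 1))) :
    (r ^+ n) @[n --> \oo] --> (0 : R) by apply: cvg_expr; rewrite ger0_norm.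
case; first by rewrite divr_gt0.
move=> N _ hN; exists (hpoly u N) => z zr; rewrite normcBC.
apply: le_lt_trans (herglotz_approx N hu zr r1) _.
have := hN N.+1 (leqW (leqnn _)); rewrite sub0r normrN ger0_norm ?exprn_ge0//.
rewrite ltr_pdivlMr//; apply: le_lt_trans; rewrite -/K.
have : 0 <= r ^+ N.+1 by rewrite exprn_ge0.
have -> : 2 * r ^+ N.+1 / (1 - r) * K = r ^+ N.+1 * (2 / (1 - r) * K) by ring.
by move=> ?; rewrite mulrDr lerDl mulr1.
Qed.

Lemma herglotz_eq u z c : CL1 u -> normc z < 1 ->
  (exists N0, forall N, (N0 <= N)%N -> (hpoly u N).[z] = c) -> herglotz u z = c.
Proof.
move=> hu z1 [N0 hN]; apply/eqP; rewrite -subr_eq0; apply/eqP.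
have z0 := normc_ge0 z.
apply: (@geo_bound_eq0 _ (2 * normc z ^+ N0.+1 / (1 - normc z) * mean (fun w => normc (u w))) (normc z)).
  by rewrite z0.
move=> N; rewrite -(hN (N0 + N)%N (leq_addr _ _)).
apply: le_trans (herglotz_approx _ hu (lexx _) z1) _.
by rewrite le_eqVlt; apply/orP; left; apply/eqP; rewrite -addSn exprD; ring.
Qed.

Lemma herglotz_cst u z : CL1 u -> normc z < 1 ->
  (forall n, (0 < n)%N -> cmean (fun w => (val w)^* ^+ n * u w) = 0) ->
  herglotz u z = cmean u.
Proof.
move=> hu z1 h; apply: herglotz_eq => //; exists 0%N => N _.
rewrite horner_psum big_nat_recl//= big1_seq ?addr0; last first.
  by move=> n _; rewrite h// mulr0 mul0r.
rewrite expr0 mulr1 mul1r; congr cmean; apply/funext => w; by rewrite expr0 mul1r.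
Qed.

Lemma herglotz0 u : herglotz u 0 = cmean u.
Proof.
congr cmean; apply/funext => w.
by rewrite /hker addr0 subr0 divff ?mul1r// circle_neq0.
Qed.

(** The Poisson kernel. As a real part of the Herglotz kernel it inherits measurability and the
    upper bound. *)
Definition pker z w : R := Re (hker z w).

Lemma pkerE z w : normc z < 1 -> pker z w = (1 - normc z ^+ 2) / normc (val w - z) ^+ 2.
Proof.
move=> z1; have d0 := circleB_neq0 w z1.
have n0 : normc (val w - z) ^+ 2 != 0 by rewrite expf_neq0// normc_eq0.
have E : hker z w = ((normc (val w - z) ^+ 2)^-1)%:C * ((val w + z) * (val w - z)^*).
  rewrite fmorphV/= -mulC_conj /hker.
  have d1 : (val w - z)^* != 0 by rewrite conjc_eq0.
  by move: (val w + z) (val w - z) (val w - z)^* d0 d1 => ? ? ? ? ?; field; apply/andP.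
rewrite /pker E ReZ mulrC; congr (_ / _).
have : Re (val w) ^+ 2 + Im (val w) ^+ 2 = 1 by rewrite -sqr_normc circle_normc expr1n.
rewrite sqr_normc; case: (val w) => a b; case: z {z1 d0 n0 E} => c d /= ab.
by rewrite -ab; ring.
Qed.

Lemma pker_gt0 z w : normc z < 1 -> 0 < pker z w.
Proof.
move=> z1; rewrite pkerE// divr_gt0 ?exprn_gt0 ?normc_gt0 ?circleB_neq0//.
by rewrite subr_gt0 exprn_ilt1.
Qed.

(** |w - z| <= 1 + |z| gives the lower bound (1 - |z|) / (1 + |z|). It serves to pass from
    integrability against the kernel back to plain integrability. *)
Lemma pker_ge z w : normc z < 1 -> (1 - normc z) / 2 <= pker z w.
Proof.
move=> z1; rewrite pkerE//; have z0 := normc_ge0 z.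
have d0 : 0 < normc (val w - z) by rewrite normc_gt0 circleB_neq0.
rewrite ler_pdivlMr ?exprn_gt0//.
have : normc (val w - z) <= 1 + normc z.
  by rewrite (le_trans (normcD_le _ _))// normcN circle_normc.
move: (normc (val w - z)) (normc z) d0 z0 z1 => d x d0 x0 x1 dx.
have : d ^+ 2 <= (1 + x) ^+ 2 by rewrite lerXn2r ?nnegrE ?(ltW d0)//; lra.
move=> /(ler_wpM2l (_ : 0 <= (1 - x) / 2)) h; apply: (le_trans (h _)); first lra.
have : 0 <= (1 - x) * (1 - x) * (1 + x) by rewrite !mulr_ge0//; lra.
by lra.
Qed.

Lemma pker_le z w : normc z < 1 -> `|pker z w| <= 2 / (1 - normc z).
Proof. by move=> z1; apply: le_trans (Re_le_normc _) (hker_bd w z1). Qed.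

Lemma pker_mcirc z : normc z < 1 -> mcirc (pker z).
Proof. by move=> z1; exact: mc_Re (hker_mc z1). Qed.

Definition rpoisson g z : R := mean (fun w => pker z w * g w).
Definition poisson u z : R[i] := cmean (fun w => (pker z w)%:C * u w).

Lemma L1_pker g z : normc z < 1 -> L1 g -> L1 (fun w => pker z w * g w).
Proof.
by move=> z1 lg; apply: (L1_bdM (pker_mcirc z1) _ lg) => w; exact: pker_le.
Qed.

Lemma CL1_pker u z : normc z < 1 -> CL1 u -> CL1 (fun w => (pker z w)%:C * u w).
Proof.
move=> z1 hu; apply: (CL1_bdM (mc_real (pker_mcirc z1)) _ hu).
by apply: aeW => t _; rewrite normc_real; exact: pker_le.
Qed.

Lemma Re_herglotz g z : Re (herglotz (fun w => (g w)%:C) z) = rpoisson g z.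
Proof. by congr mean; apply/funext => w; rewrite mulrC ReZ mulrC. Qed.

Lemma Re_poisson u z : Re (poisson u z) = rpoisson (fun w => Re (u w)) z.
Proof. by congr mean; apply/funext => w; rewrite ReZ. Qed.
Lemma Im_poisson u z : Im (poisson u z) = rpoisson (fun w => Im (u w)) z.
Proof. by congr mean; apply/funext => w; rewrite ImZ. Qed.

Lemma poisson_herglotz u z : normc z < 1 -> CL1 u ->
  poisson u z = (herglotz u z + (herglotz (fun w => (u w)^*) z)^*) / 2.
Proof.
move=> z1 hu; have hj := CL1J hu.
have a := CL1_hker z1 hu; have b := CL1J (CL1_hker z1 hj).
have c2 : (2 : R[i]) != 0 by rewrite pnatr_eq0.
apply: (mulIf c2); rewrite divfK// /herglotz -cmeanJ; last exact: CL1_hker.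
rewrite -cmeanD// mulrC /poisson -cmeanZ; last exact: CL1_pker.
congr cmean; apply/funext => w; rewrite rmorphM/= conjcK -mulrDl mulrA; congr (_ * _).
by rewrite addcJ.
Qed.

(** The Poisson integral is half the sum of a Herglotz integral and of the conjugate of another one;
    when the coefficients of negative index vanish, the second is constant and only the analytic
    part varies. *)
Lemma poisson_analytic u z : normc z < 1 -> CL1 u ->
  (forall n, (0 < n)%N -> cmean (fun w => val w ^+ n * u w) = 0) ->
  poisson u z = (herglotz u z + cmean u) / 2.
Proof.
move=> z1 hu h; rewrite poisson_herglotz// (herglotz_cst (CL1J hu))//.
  by rewrite cmeanJ// conjcK.
move=> n n0; rewrite -[RHS]conjc0 -(h n n0) -cmeanJ; last exact: CL1_expnM.
by congr cmean; apply/funext => w; rewrite rmorphM rmorphXn.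
Qed.

Lemma lunif_poisson u : CL1 u ->
  (forall n, (0 < n)%N -> cmean (fun w => val w ^+ n * u w) = 0) -> lunif (poisson u).
Proof.
move=> hu h.
have : lunif (fun z => (herglotz u z + cmean u) * 2^-1).
  by apply: lunifM; [apply: lunifD; [exact: lunif_herglotz|]|]; exact: lunif_cst.
by apply: lunif_ext => z z1; rewrite poisson_analytic.
Qed.

Lemma poisson_pcirc p z : normc z < 1 -> poisson (pcirc p) z = p.[z].
Proof.
move=> z1; have hp := L2_CL1 (L2_pcirc p).
rewrite poisson_analytic//; last by move=> n; exact: cmean_pcirc0.
have E n : cmean (fun w => (val w)^* ^+ n * pcirc p w) = p`_n.
  have := cmean_pcircX p 1 n; rewrite expr1n mulr1 => <-.
  by congr cmean; apply/funext => w; rewrite mul1r.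
have -> : cmean (pcirc p) = p`_0.
  by rewrite -E; congr cmean; apply/funext => w; rewrite expr0 mul1r.
(* The Herglotz integral doubles every coefficient except the constant one. *)
rewrite (@herglotz_eq _ _ (2 * p.[z] - p`_0))//.
  by rewrite subrK mulrC mulKf// pnatr_eq0.
exists (size p) => N pN; rewrite horner_psum (horner_coef_wide _ (leqW pN)).
rewrite -(big_mkord xpredT (fun i => p`_i * z ^+ i)) !big_nat_recl//= E !expr0.
rewrite /hcoef/= mulrDr mulr_sumr.
have -> : forall x y : R[i], 2 * (x * 1) + y - x = 1 * x * 1 + y by move=> x y; ring.
by congr (_ + _); apply: eq_bigr => i _; rewrite E mulrA.
Qed.

Lemma mean_pker z : normc z < 1 -> mean (pker z) = 1.
Proof.
move=> z1; have := poisson_pcirc 1 z1; rewrite hornerC => /(congr1 (@complex.Re R)).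
rewrite Re_poisson/= => <-; congr mean; apply/funext => w.
by rewrite /pcirc hornerC mulr1.
Qed.

Lemma rpoisson_le g h z : normc z < 1 -> L1 g -> L1 h ->
  ae_circle (fun w => g w <= h w) -> rpoisson g z <= rpoisson h z.
Proof.
move=> z1 lg lh gh; apply: le_mean; [exact: L1_pker..|].
by apply: filterS gh => w gh; rewrite ler_wpM2l// ltW// pker_gt0.
Qed.

Lemma rpoisson_cst c z : normc z < 1 -> rpoisson (fun=> c) z = c.
Proof.
move=> z1; rewrite /rpoisson; under eq_fun do rewrite mulrC.
by rewrite meanZ ?mean_pker ?mulr1//; exact: L1_bd (pker_mcirc z1) (fun w => pker_le w z1).
Qed.

Lemma rpoissonD g h z : normc z < 1 -> L1 g -> L1 h ->
  rpoisson (fun w => g w + h w) z = rpoisson g z + rpoisson h z.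
Proof.
move=> z1 lg lh; rewrite /rpoisson; under eq_fun do rewrite mulrDr.
by rewrite meanD//; exact: L1_pker.
Qed.

Lemma rpoissonZ c g z : normc z < 1 -> L1 g ->
  rpoisson (fun w => c * g w) z = c * rpoisson g z.
Proof.
move=> z1 lg; rewrite /rpoisson; under eq_fun do rewrite mulrCA.
by rewrite meanZ//; exact: L1_pker.
Qed.

(* Jensen's inequality for the probability measure with density [pker z], by integrating
   the tangent line inequality [exp m * (1 + x - m) <= exp x] at the mean [m]. *)
Lemma expR_rpoisson_le k z : normc z < 1 -> L1 k -> L1 (fun w => expR (k w)) ->
  expR (rpoisson k z) <= rpoisson (fun w => expR (k w)) z.
Proof.
move=> z1 lk le; set m := rpoisson k z.
have l1 : L1 (fun w => expR m * (1 - m) + expR m * k w).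
  by apply: L1D; [exact: L1_cst|exact: L1Z].
have : rpoisson (fun w => expR m * (1 - m) + expR m * k w) z <= rpoisson (fun w => expR (k w)) z.
  apply: rpoisson_le => //; apply: aeW => t _.
  have := expR_ge1Dx (k (cis t) - m); rewrite expRD => /(ler_wpM2l (expR_ge0 m)).
  rewrite mulrCA -expRD subrr expR0 mulr1; lra.
rewrite rpoissonD ?rpoisson_cst ?rpoissonZ -/m//; [|exact: L1_cst|exact: L1Z].
by have -> : expR m * (1 - m) + expR m * m = expR m by ring.
Qed.

(** Jensen's inequality for the square, by integrating the tangent line inequality 2 m x - m^2 <=
    x^2 at the Poisson mean [m] of |u|. *)
Lemma normc_poisson_sqr_le u z : normc z < 1 -> L2 u ->
  normc (poisson u z) ^+ 2 <= rpoisson (fun w => normc (u w) ^+ 2) z.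
Proof.
move=> z1 hu; have cu := L2_CL1 hu; have lu := CL1_normc cu; have l2 := L2_L1 hu.
pose m := rpoisson (fun w => normc (u w)) z.
have h1 : normc (poisson u z) <= m.
  have cp := CL1_pker z1 cu.
  apply: le_trans (normc_cmean_le cp) _; apply: le_mean; [exact: CL1_normc|exact: L1_pker|].
  by apply: aeW => t _; rewrite normcM normc_real ger0_norm// ltW// pker_gt0.
apply: (@le_trans _ _ (m ^+ 2)).
  by rewrite lerXn2r ?nnegrE// (le_trans _ h1).
have l1 : L1 (fun w => - m ^+ 2 + 2 * m * normc (u w)).
  by apply: L1D; [exact: L1_cst|exact: L1Z].
have : rpoisson (fun w => - m ^+ 2 + 2 * m * normc (u w)) z <=
    rpoisson (fun w => normc (u w) ^+ 2) z.
  apply: rpoisson_le => //; apply: aeW => t _.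
  by have := sqr_ge0 (m - normc (u (cis t))); lra.
rewrite rpoissonD ?rpoisson_cst ?rpoissonZ -/m//; [|exact: L1_cst|exact: L1Z].
by have -> : - m ^+ 2 + 2 * m * m = m ^+ 2 by ring.
Qed.

(** No exchange of integrals is involved: the Poisson integral is the real part of a Herglotz
    integral, whose mean over a circle is its value at 0. *)
Lemma mean_rpoisson g r : L1 g -> 0 <= r < 1 ->
  L1 (fun w : circle R => rpoisson g (r%:C * val w)) /\
  mean (fun w : circle R => rpoisson g (r%:C * val w)) = mean g.
Proof.
move=> lg r01; have cg := CL1_real lg; have lh := lunif_herglotz cg.
have [E _] := L2_CL1 (lunif_L2 lh r01).
have EE : (fun w : circle R => Re (on_circle (herglotz (fun w => (g w)%:C)) r w)) =
    fun w => rpoisson g (r%:C * val w).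
  by apply/funext => w; rewrite -Re_herglotz.
rewrite EE in E; split => //.
have := cmean_on_circle lh r01; rewrite herglotz0 => /(congr1 (@complex.Re R)).
by rewrite /= EE.
Qed.

(** The Poisson integral of [g] is a harmonic majorant of |F|^2, and its circle means do not depend
    on the radius. The factor 2 pi appears because [sqnorm_integral] is not normalised. *)
Lemma H2_disc_bound F g : lunif F -> L1 g ->
  (forall z, normc z < 1 -> normc (F z) ^+ 2 <= rpoisson g z) -> H2_disc F.
Proof.
move=> lF lg h; split; first exact: lunif_analytic.
exists (2 * pi * mean g) => r r01; have l2 := lunif_L2 lF r01.
have /andP[r0 r1] := r01.
have [lp mp] := mean_rpoisson lg r01.
rewrite L2_sqnorm// mulKf ?gt_eqF ?twopi_gt0// -mp; apply: le_mean => //.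
  exact: L2_L1.
by apply: aeW => t _; apply: h; rewrite on_circle_norm.
Qed.

End Kernels.

(** * Fatou's theorem on radial limits of Poisson integrals *)

Section Fatou.
Variable R : realType.
Implicit Types (w : circle R) (g : circle R -> R) (r e t : R).
Local Notation mu := (@lebesgue_measure R).

(** The indicator of an arc around [w0], measured by chords so that no choice of argument is
    involved. *)
Definition chord w0 h w : R := if normc (val w - val w0) < h then 1 else 0.

Lemma chord_mcirc w0 h : mcirc (chord w0 h).
Proof.
have hm : mcirc (fun w => normc (val w - val w0)).
  by apply: mc_normc; apply: mcB; [exact: mc_id|exact: mc_cst].
apply: measurable_fun_if; first exact: (@measurable_period R).
- by apply: measurable_fun_ltr => //; exact: measurable_cst.
- exact: measurable_cst.
- exact: measurable_cst.
Qed.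

Lemma chord_le1 w0 h w : `|chord w0 h w| <= 1.
Proof. by rewrite /chord; case: ifP; rewrite ?normr1 ?normr0. Qed.

Lemma chord_ge0 w0 h w : 0 <= chord w0 h w.
Proof. by rewrite /chord; case: ifP. Qed.

Lemma pker_chord r w0 w : 0 <= r < 1 ->
  pker (r%:C * val w0) w * normc (val w - val w0) ^+ 2 <= 8 * (1 - r).
Proof.
move=> /andP[r0 r1].
have nr : normc (r%:C * val w0) = r by exact: on_circle_norm.
have z1 : normc (r%:C * val w0) < 1 by rewrite nr.
have d0 : 0 < normc (val w - r%:C * val w0) by rewrite normc_gt0 circleB_neq0.
rewrite pkerE// nr mulrAC ler_pdivrMr ?exprn_gt0//.
(* Moving the pole from r w0 to w0 costs 1 - r, which is itself at most |w - r w0|. *)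
have h1 : normc (val w - val w0) <= 2 * normc (val w - r%:C * val w0).
  have -> : val w - val w0 = (val w - r%:C * val w0) - (1 - r)%:C * val w0.
    by rewrite rmorphB rmorph1; ring.
  apply: le_trans (normcD_le _ _) _; rewrite normcN on_circle_norm ?subr_ge0 ?(ltW r1)//.
  have : 1 - r <= normc (val w - r%:C * val w0).
    by apply: le_trans (normcB_le _ _); rewrite circle_normc nr.
  by lra.
have c0 := normc_ge0 (val w - val w0).
have h2 : normc (val w - val w0) ^+ 2 <= (2 * normc (val w - r%:C * val w0)) ^+ 2.
  by rewrite lerXn2r ?nnegrE//; lra.
move: (normc (val w - r%:C * val w0)) (normc (val w - val w0)) d0 h1 c0 h2 => d c d0 h1 c0 h2.
apply: (@le_trans _ _ ((1 - r ^+ 2) * (2 * d) ^+ 2)).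
  by rewrite ler_wpM2l// subr_ge0 exprn_ile1// ltW.
have -> : (1 - r ^+ 2) * (2 * d) ^+ 2 = 4 * (1 - r) * (1 + r) * d ^+ 2 by ring.
rewrite ler_wpM2r ?exprn_ge0 ?(ltW d0)//.
have : 0 <= (1 - r) * (1 - r) by rewrite mulr_ge0// subr_ge0 ltW.
by lra.
Qed.

(* Dyadic domination of the Poisson kernel by indicators of arcs centred at [w0]. *)
Lemma pker_dyadic r w0 w N : 0 <= r < 1 ->
  pker (r%:C * val w0) w <=
  \sum_(k < N) 32 * 4^-1 ^+ k / (1 - r) * chord w0 (2 ^+ k * (1 - r)) w +
  32 * 4^-1 ^+ N / (1 - r).
Proof.
move=> r01; have /andP[r0 r1] := r01; have d0 : 0 < 1 - r by rewrite subr_gt0.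
elim: N => [|N ih].
  rewrite big_ord0 add0r expr0 mulr1.
  have z1 : normc (r%:C * val w0) < 1 by rewrite on_circle_norm.
  apply: le_trans (ler_norm _) (le_trans (pker_le w z1) _).
  by rewrite on_circle_norm// ler_wpM2r ?invr_ge0 ?(ltW d0)// ler_nat.
rewrite big_ord_recr/=.
have [h|h] := boolP (normc (val w - val w0) < 2 ^+ N * (1 - r)).
  rewrite [X in _ + _ * X + _](_ : _ = 1) ?mulr1; last by rewrite /chord h.
  by rewrite (le_trans ih)// lerDl divr_ge0 ?(ltW d0)// mulr_ge0// exprn_ge0.
rewrite [X in _ + _ * X + _](_ : _ = 0); last by rewrite /chord (negPf h).
rewrite mulr0 addr0 -leNgt in h *.
rewrite (@le_trans _ _ (32 * 4^-1 ^+ N.+1 / (1 - r)))//; last first.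
  rewrite lerDr sumr_ge0// => k _; rewrite mulr_ge0 ?chord_ge0// divr_ge0 ?(ltW d0)//.
(* Outside the arc of radius 2^N (1 - r) the kernel is at most 8 / (4^N (1 - r)), which is the
   remainder of index N + 1: hence 32 = 4 * 8. *)
have := pker_chord w0 w r01.
set p := pker _ _ => hp.
have p0 : 0 <= p by rewrite ltW// pker_gt0// on_circle_norm.
have q0 : 0 < 2 ^+ N :> R by rewrite exprn_gt0.
have h2 : (2 ^+ N * (1 - r)) ^+ 2 <= normc (val w - val w0) ^+ 2.
  by rewrite lerXn2r ?nnegrE// mulr_ge0// ltW.
have h3 : p * (2 ^+ N * (1 - r)) ^+ 2 <= 8 * (1 - r).
  by apply: le_trans hp; rewrite ler_wpM2l.
have E4 : 4^-1 ^+ N.+1 = (4 * (2 ^+ N) ^+ 2)^-1 :> R.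
  rewrite exprVn exprS -exprM mulnC exprM; congr (_ * _)^-1.
  by congr (_ ^+ _); rewrite expr2; ring.
rewrite E4 ler_pdivlMr// ler_pdivlMr ?mulr_gt0 ?exprn_gt0//.
rewrite exprMn in h3; move: (2 ^+ N) q0 h3 {h h2 E4 ih hp} => q q0 h3.
have : p * q ^+ 2 * (1 - r) <= 8.
  by rewrite -(ler_pM2r d0) (le_trans _ h3)// le_eqVlt; apply/orP; left; apply/eqP; ring.
by lra.
Qed.

(** In the dyadic bound the arc of radius 2^k (1 - r) contributes at most (e / 4) 2^-k as long as
    this radius is at most [s], which sums to e / 2; the remainder involves only the total mean of
    [g] and tends to 0 with 1 - r. *)
Lemma rpoisson_approach g w0 : L1 g -> (forall w, 0 <= g w) ->
  (forall e, 0 < e -> exists2 s, 0 < s & forall h, 0 < h <= s ->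
     mean (fun w => chord w0 h w * g w) <= e * h) ->
  forall e, 0 < e -> exists2 d, 0 < d & forall r, 0 <= r -> 1 - d < r < 1 ->
     rpoisson g (r%:C * val w0) <= e.
Proof.
move=> lg g0 hyp e e0.
have e64 : 0 < e / 128 by rewrite divr_gt0.
have [s s0 hs] := hyp _ e64.
have G0 : 0 <= mean g by apply: mean_ge0 => //; exact: aeW.
have K0 : 0 < 64 * (mean g + 1) / s ^+ 2.
  by rewrite divr_gt0 ?exprn_gt0// mulr_gt0// ltr_wpDl.
(* The remainder is at most 32 (1 - r) (mean g + 1) / s^2, so this choice makes it at most e / 2;
   the 1 avoids a zero denominator. *)
exists (e / (64 * (mean g + 1) / s ^+ 2)); first by rewrite divr_gt0.
move=> r r0 /andP[rd r1].
have r01 : 0 <= r < 1 by rewrite r0.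
have d0 : 0 < 1 - r by rewrite subr_gt0.
have ex : exists N, s < 2 ^+ N * (1 - r).
  exists (Num.truncn (s / (1 - r))); rewrite -ltr_pdivrMr//.
  apply: lt_le_trans (truncnS_gt _) _.
  by rewrite -natrX ler_nat; exact: ltn_expl.
(* Minimality keeps all earlier arcs within radius [s], while 2^N (1 - r) > s controls the
   remainder. *)
pose N := ex_minn ex.
have [sN Nmin] : s < 2 ^+ N * (1 - r) /\ forall k, (k < N)%N -> 2 ^+ k * (1 - r) <= s.
  rewrite /N; case: ex_minnP => m sm mmin; split => // k km.
  by rewrite leNgt; apply/negP => /mmin; rewrite leqNgt km.
have lc k : L1 (fun w => chord w0 (2 ^+ k * (1 - r)) w * g w).
  exact: L1_bdM (chord_mcirc _ _) (chord_le1 _ _) lg.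
pose c k : R := 32 * 4^-1 ^+ k / (1 - r).
have lS : L1 (fun w => \sum_(k < N) c k * (chord w0 (2 ^+ k * (1 - r)) w * g w)).
  by apply: L1_sum => i; exact: L1Z.
have z1 : normc (r%:C * val w0) < 1 by rewrite on_circle_norm.
apply: (@le_trans _ _ (mean (fun w => \sum_(k < N) c k * (chord w0 (2 ^+ k * (1 - r)) w * g w)
   + c N * g w))).
  apply: le_mean; [exact: L1_pker|by apply: L1D => //; exact: L1Z|].
  apply: aeW => t _; have := pker_dyadic w0 (cis t) N r01.
  move=> /(ler_wpM2r (g0 (cis t))); rewrite mulrDl mulr_suml => h.
  apply: le_trans h _; rewrite lerD2r le_eqVlt; apply/orP; left; apply/eqP.
  by apply: eq_bigr => k _; rewrite /c mulrA.
rewrite meanD//; last exact: L1Z.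
rewrite mean_sum; last by move=> i; exact: L1Z.
rewrite meanZ// [e]splitr; apply: lerD.
  apply: (@le_trans _ _ (\sum_(k < N) 32 * (e / 128) * 2^-1 ^+ k)).
    apply: ler_sum => k _; rewrite meanZ//.
    have kN := ltn_ord k; have h0 : 0 < 2 ^+ k * (1 - r) <= s.
      by rewrite mulr_gt0 ?exprn_gt0//= Nmin.
    have := hs _ h0; move=> /(ler_wpM2l (_ : 0 <= c k)) h; apply: (le_trans (h _)).
      by rewrite divr_ge0 ?(ltW d0)// mulr_ge0// exprn_ge0.
    rewrite le_eqVlt; apply/orP; left; apply/eqP.
    have E4 : 4^-1 ^+ k = 2^-1 ^+ k * 2^-1 ^+ k :> R.
      by rewrite -exprMn; congr (_ ^+ _); rewrite -invfM; congr (_^-1); ring.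
    have E1 : 2^-1 ^+ k * 2 ^+ k = 1 :> R by rewrite -exprMn mulVf ?expr1n.
    rewrite /c E4; transitivity (32 * (e / 128) * 2^-1 ^+ k * (2^-1 ^+ k * 2 ^+ k) * ((1 - r) / (1 - r))).
      by ring.
    by rewrite E1 divff ?gt_eqF// !mulr1.
  rewrite -mulr_sumr -(big_mkord xpredT (fun k => 2^-1 ^+ k)).
  have q01 : 0 <= (2^-1 : R) < 1 by rewrite invr_ge0 ler0n invf_lt1 ?ltr1n.
  have := geo_le 0 N q01; rewrite expr0 => h.
  have : \sum_(0 <= k < N) 2^-1 ^+ k <= 2 :> R.
    by apply: le_trans h _; rewrite le_eqVlt; apply/orP; left; apply/eqP; field.
  by move=> /(ler_wpM2l (_ : 0 <= 32 * (e / 128))) h'; apply: (le_trans (h' _)); lra.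
have d1 : 1 - r < e / (64 * (mean g + 1) / s ^+ 2) by lra.
rewrite ltr_pdivlMr// in d1.
have q0 : 0 < 2 ^+ N :> R by rewrite exprn_gt0.
have E4 : 4^-1 ^+ N = ((2 ^+ N) ^+ 2)^-1 :> R.
  by rewrite exprVn -exprM mulnC exprM; congr (_ ^+ _)^-1; rewrite expr2; ring.
have s2 : s ^+ 2 < (2 ^+ N * (1 - r)) ^+ 2.
  by rewrite ltr_pXn2r ?nnegrE ?(ltW s0)// mulr_ge0// ltW.
rewrite /c E4.
apply: (@le_trans _ _ (32 * (1 - r) * (mean g + 1) / s ^+ 2)).
  have -> : 32 / (2 ^+ N) ^+ 2 / (1 - r) * mean g =
      32 * (1 - r) * mean g / (2 ^+ N * (1 - r)) ^+ 2.
    by field; rewrite !gt_eqF.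
  apply: ler_pM.
  - exact: mulr_ge0 (mulr_ge0 (ler0n _ _) (ltW d0)) G0.
  - by rewrite invr_ge0 exprn_ge0// mulr_ge0 ?(ltW d0) ?(ltW q0).
  - by rewrite ler_wpM2l ?mulr_ge0 ?(ltW d0)// lerDl.
  - by rewrite lef_pV2 ?posrE ?exprn_gt0 ?mulr_gt0// ltW.
have -> : 32 * (1 - r) * (mean g + 1) / s ^+ 2 = (1 - r) * (64 * (mean g + 1) / s ^+ 2) / 2.
  by field; rewrite gt_eqF.
by rewrite ler_pM2r// ltW.
Qed.

Lemma normc_cisB t t0 : normc (val (cis t) - val (cis t0)) = 2 * `|sin ((t - t0) / 2)|.
Proof.
apply/eqP; rewrite -(@eqrXn2 _ 2)// ?mulr_ge0// sqr_normc exprMn real_normK ?num_real//=.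
have := cosB t t0; have {1}-> : t - t0 = ((t - t0) / 2) *+ 2 by rewrite -mulr_natr divfK.
rewrite cos_mulr2n cos2sin2 => h.
have h1 := cos2Dsin2 t; have h2 := cos2Dsin2 t0.
apply/eqP; rewrite mulr2n in h.
move: (sin ((t - t0) / 2)) h => x h.
transitivity ((cos t ^+ 2 + sin t ^+ 2) + (cos t0 ^+ 2 + sin t0 ^+ 2)
  - 2 * (cos t * cos t0 + sin t * sin t0)); first ring.
by rewrite -h h1 h2; ring.
Qed.

Lemma sin_ge_cos1 x : 0 <= x <= 1 -> cos 1 * x <= sin x :> R.
Proof.
move=> /andP[x0 x1].
have cs : {within `[0, x], continuous (@sin R)}.
  by apply: continuous_subspaceT; exact: continuous_sin.
have [c] := @MVT_segment R sin cos 0 x x0 (fun t _ => is_derive_sin t) cs.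
rewrite sin0 !subr0 in_itv/= => /andP[c0 cx] ->.
rewrite ler_wpM2r//; have c1 := le_trans cx x1.
have pi1 : 1 <= pi :> R by apply: le_trans (@pi_ge2 R); rewrite ler1n.
rewrite leNgt ltr_cos -?leNgt// in_itv/= ?c0 ?(le_trans c1)//.
by rewrite ler01.
Qed.

(** Chords control parameters only away from the ends of the period, which are the same point of the
    circle. With x = |t - t0| / 2 and [x <= pi - d], sin x is at least cos 1 * x for x <= 1 and at
    least sin d beyond. *)
Lemma chord_arc t0 : 0 < t0 < 2 * pi -> exists2 c, 0 < c &
  forall t, period t -> c * `|t - t0| <= normc (val (cis t) - val (cis t0)).
Proof.
move=> /andP[t00 t01].
pose d : R := Num.min 1 (Num.min (t0 / 2) (pi - t0 / 2)).
have d0 : 0 < d.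
  by rewrite !lt_min ltr01 divr_gt0//= subr_gt0 ltr_pdivrMr// mulrC.
have d1 : d <= 1 by rewrite ge_min lexx.
have pi0 := @pi_gt0 R; have pi2 := @pi_ge2 R.
have sd : 0 < sin d by apply: sin_gt0_pi; rewrite d0/= (le_lt_trans d1)//; lra.
pose c : R := Num.min (cos 1) (sin d / pi).
have c0 : 0 < c by rewrite lt_min cos1_gt0 divr_gt0.
exists c => // t tP.
have /andP[tt0 tt1] : 0 <= t <= 2 * pi by have := tP; rewrite /period/= in_itv.
rewrite normc_cisB.
set x := `|t - t0| / 2.
have -> : `|t - t0| = 2 * x by rewrite /x mulrC divfK.
rewrite mulrCA ler_pM2l//.
have -> : `|sin ((t - t0) / 2)| = `|sin x|.
  rewrite /x; have [h|h] := leP 0 (t - t0); first by rewrite (ger0_norm h).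
  by rewrite (ltr0_norm h) mulNr sinN normrN.
apply: le_trans (ler_norm _).
have x0 : 0 <= x by rewrite divr_ge0.
have xd : x <= pi - d.
  have dd1 : d <= t0 / 2 by rewrite !ge_min lexx orbT.
  have dd2 : d <= pi - t0 / 2 by rewrite !ge_min lexx !orbT.
  rewrite /x ler_pdivrMr// ler_norml; apply/andP; split; lra.
have [x1|x1] := leP x 1.
  apply: le_trans (sin_ge_cos1 _); last by rewrite x0.
  by rewrite ler_wpM2r// ge_min lexx.
have mono y : d <= y -> y <= pi / 2 -> sin d <= sin y.
  move=> dy y2; rewrite leNgt ltr_sin -?leNgt// in_itv/=; apply/andP; split; lra.
have sx : sin d <= sin x.
  have [x2|x2] := leP x (pi / 2); first by apply: mono => //; rewrite (le_trans d1)// ltW.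
  have -> : sin x = sin (pi - x) by rewrite sinB sinpi cospi; ring.
  by apply: mono; lra.
apply: le_trans sx; apply: (@le_trans _ _ (sin d / pi * x)).
  by rewrite ler_wpM2r// ge_min lexx orbT.
by rewrite mulrAC ler_pdivrMr// ler_pM2l//; lra.
Qed.

(** An arc of chordal radius [h] lies in the interval of radius h / c about [t0], so averages over
    arcs are dominated by the averages on the line that define Lebesgue points. *)
Lemma lebesgue_pt_mean (f : circle R -> R) t0 : L1 f -> 0 < t0 < 2 * pi ->
  lebesgue_pt ((fun t => f (cis t)) \_ (@period R)) t0 ->
  forall e, 0 < e -> exists2 s, 0 < s & forall h, 0 < h <= s ->
     mean (fun w => chord (cis t0) h w * `|f w - f (cis t0)|) <= e * h.
Proof.
move=> lf t01 /fine_cvgP[fin cv] e e0.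
have [c c0 hc] := chord_arc t01.
set F := (fun t => f (cis t)) \_ (@period R) in fin cv *.
have pi0 := twopi_gt0 R.
(* Chosen so that e' times the length 2 h / c of the interval is 2 pi e h. *)
pose e' := e * (2 * pi) * c / 2.
have e'0 : 0 < e' by rewrite divr_gt0// !mulr_gt0// pi_gt0.
have /cvgrPdist_lt/(_ _ e'0) cv' := cv.
have [s /= s0 hs] : \forall r \near (0 : R)^'+, (davg F t0 r < e'%:E)%E.
  near=> r; have fr : davg F t0 r \is a fin_num by near: r; exact: fin.
  rewrite -(fineK fr) lte_fin (le_lt_trans (ler_norm _))//.
  by rewrite -normrN -[- _]add0r; near: r; exact: cv'.
have P0 : period t0 by rewrite /period/= in_itv/=; case/andP: t01 => /ltW-> /ltW->.
have F0 : F t0 = f (cis t0) by rewrite /F patchE mem_set.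
exists (s * c / 2) => [|h /andP[h0 hsc]]; first by rewrite divr_gt0// mulr_gt0.
pose r := h / c; have r0 : 0 < r by rewrite divr_gt0.
have rs : r < s.
  rewrite /r ltr_pdivrMr//; apply: le_lt_trans hsc _.
  rewrite ltr_pdivrMr// ltr_pMr ?mulr_gt0//; lra.
have := hs r; rewrite /= sub0r normrN gtr0_norm// => /(_ rs r0).
have mball : measurable (ball t0 r : set (measurableTypeR R)) by exact: measurable_ball.
rewrite /davg /iavg (lebesgue_measure_ball _ (ltW r0)).
rewrite inver mulrn_eq0/= (gt_eqF r0).
set J := (\int[mu]_(y in ball t0 r) _)%E => hJ.
have {}hJ : (J < (2 * pi * (e * h))%:E)%E.
  have r2 : 0 < r *+ 2 by rewrite pmulrn_lgt0.
  move: hJ; rewrite muleC lte_pdivrMr// => hJ; apply: lt_le_trans hJ _.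
  rewrite -EFinM lee_fin /e' /r le_eqVlt; apply/orP; left; apply/eqP.
  by rewrite -mulr_natr; field; rewrite gt_eqF.
have lg : L1 (fun w => chord (cis t0) h w * `|f w - f (cis t0)|).
  apply: L1_bdM (chord_mcirc _ _) (chord_le1 _ _) _.
  by apply: L1_norm; apply: L1B => //; exact: L1_cst.
have mP := @measurable_period R.
have mF : measurable_fun setT F.
  by apply/(measurable_restrictT _ _).1 => //; exact: L1_mcirc.
rewrite /mean ler_pdivrMl// -lee_fin /Rintegral fineK; last exact: integrable_fin_num lg.
apply: le_trans (ltW hJ).
(* Both integrals are extended to the whole line; where the interval leaves the period, the
   right-hand integrand is still nonnegative. *)
rewrite /J integral_mkcond [leRHS]integral_mkcond.
apply: ge0_le_integral => //.
- move=> t _; rewrite patchE; case: ifP => // _.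
  by rewrite lee_fin mulr_ge0// chord_ge0.
- apply/(measurable_restrictT _ _).1 => //; apply/measurable_EFinP; exact: L1_mcirc lg.
- apply/(measurable_restrictT _ _).1 => //; apply/measurable_EFinP.
  apply: measurableT_comp => //; apply: measurable_funTS.
  by apply: measurable_funB => //; exact: measurable_cst.
- move=> t _; rewrite !patchE; case: ifPn => [tP|_]; last by case: ifP => // _; rewrite lee_fin.
  rewrite /chord; case: ifPn => hch; last by rewrite mul0r; case: ifP => // _; rewrite lee_fin.
  rewrite ifT; last first.
    apply/mem_set; rewrite -ball_normE /= distrC /r ltr_pdivlMr// mulrC.
    by apply: le_lt_trans hch; apply: hc; exact: set_mem.
  by rewrite mul1r F0 /= /F patchE tP.
Unshelve. all: by end_near. Qed.

Lemma ae_circle_interior (P : circle R -> Prop) :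
  {ae mu, forall t, 0 < t < 2 * pi -> P (cis t)} -> ae_circle P.
Proof.
move=> [N [mN N0 sN]]; exists (N `|` [set 0] `|` [set 2 * pi]); split.
- by apply: measurableU => //; apply: measurableU.
- have z (x : R) : mu [set x] = 0%E by exact: lebesgue_measure_set1.
  have zN : mu (N `|` [set 0]) = 0%E by apply: null_set_setU => //; exact: z.
  by apply: null_set_setU => //; [exact: measurableU|exact: z].
- move=> t /= /not_implyP[]; rewrite /period/= in_itv/= => /andP[].
  rewrite le_eqVlt => /orP[/eqP<- _ _|t0]; first by left; right.
  rewrite le_eqVlt => /orP[/eqP-> _|t1 nP]; first by right.
  by left; left; apply: sN => /= h; apply: nP; apply: h; rewrite t0.
Qed.

(** Since the kernel has mean 1, the error at w0 is at most the Poisson integral of |f - f w0|,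
    which tends to 0 at every Lebesgue point; these are almost all points by Lebesgue
    differentiation. *)
Lemma rpoisson_radial (f : circle R -> R) : L1 f ->
  ae_circle (fun w => rpoisson f (r%:C * val w) @[r --> (1 : R)^'-] --> f w).
Proof.
move=> lf.
have loc : locally_integrable setT ((fun t => f (cis t)) \_ (@period R)).
  apply: open_integrable_locally; first exact: openT.
  by rewrite -restrict_EFin; apply/(integrable_mkcond _ (@measurable_period R)).
apply: ae_circle_interior; have := lebesgue_differentiation loc.
apply: (@filterS _ _ (ae_filter_ringOfSetsType mu)) => t0 lp t01.
apply/cvgrPdist_le => e e0.
have lg : L1 (fun w => `|f w - f (cis t0)|).
  by apply: L1_norm; apply: L1B => //; exact: L1_cst.
have [d d0 hd] := rpoisson_approach lg (fun w => normr_ge0 _) (lebesgue_pt_mean lf t01 lp) e0.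
near=> r.
have r0 : 0 <= r by near: r; apply: nbhs_left_ge.
have r1 : r < 1 by near: r; exact: nbhs_left_lt.
have rd : 1 - d < r by near: r; apply: nbhs_left_gt; rewrite ltrBlDr ltrDl.
have z1 : normc (r%:C * val (cis t0)) < 1 by rewrite on_circle_norm.
have := hd r r0; rewrite rd r1 => /(_ isT); apply: le_trans.
have lc : L1 (fun=> f (cis t0)) by exact: L1_cst.
rewrite -[X in `|X - _|](rpoisson_cst (f (cis t0)) z1) /rpoisson -meanB; [|exact: L1_pker..].
apply: le_trans (norm_mean_le _) _; first by apply: L1B; exact: L1_pker.
apply: le_mean.
- by apply: L1_norm; apply: L1B; exact: L1_pker.
- exact: L1_pker.
- apply: aeW => t _; rewrite -mulrBr normrM ger0_norm; last by rewrite ltW// pker_gt0.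
  by rewrite distrC.
Unshelve. all: by end_near. Qed.

End Fatou.

(** * Bessel's inequality and completeness of L^2 *)

Section RieszFischer.
Variable R : realType.
Local Notation "x ^*" := (conjc x) : ring_scope.
Local Notation mu := (@lebesgue_measure R).
Implicit Types (u v g : circle R -> R[i]) (p : {poly R[i]}).

Lemma nrm2_ext u v : L2 u -> L2 v -> ae_circle (fun w => u w = v w) -> nrm2 u = nrm2 v.
Proof.
by move=> hu hv uv; apply: eq_mean; [exact: L2_L1..|]; apply: filterS uv => w ->.
Qed.

Lemma nrm2BC u v : nrm2 (fun w => u w - v w) = nrm2 (fun w => v w - u w).
Proof. by congr mean; apply/funext => w; rewrite normcBC. Qed.

Lemma nrm2B u v : L2 u -> L2 v ->
  nrm2 (fun w => u w - v w) = nrm2 u - 2 * Re (cmean (fun w => (v w)^* * u w)) + nrm2 v.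
Proof.
move=> hu hv; have hvu := L2M_CL1 (L2J hv) hu.
have lu := L2_L1 hu; have lv := L2_L1 hv; have l2 := L1Z 2 hvu.1.
rewrite /nrm2 /= -meanZ; last exact: hvu.1.
rewrite -meanB// -meanD//; last exact: L1B.
congr mean; apply/funext => w; rewrite !sqr_normc.
by case: (u w) (v w) => a b [c d] /=; ring.
Qed.

Let conj_pcirc p w : (pcirc p w)^* = \sum_(i < size p) (p`_i)^* * (val w)^* ^+ i.
Proof.
rewrite /pcirc horner_coef rmorph_sum; apply: eq_bigr => i _.
by rewrite rmorphM rmorphXn.
Qed.

Lemma cmean_conj_pcirc p u : CL1 u -> cmean (fun w => (pcirc p w)^* * u w) =
  \sum_(i < size p) (p`_i)^* * cmean (fun w => (val w)^* ^+ i * u w).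
Proof.
move=> hu; under eq_fun do rewrite conj_pcirc mulr_suml.
rewrite cmean_sum; last first.
  move=> i; have := CL1Z (p`_i)^* (CL1_expnJM i hu).
  by congr CL1; apply/funext => w; rewrite mulrA.
apply: eq_bigr => i _; rewrite -cmeanZ; last exact: CL1_expnJM.
by congr cmean; apply/funext => w; rewrite mulrA.
Qed.

Lemma cmean_pcirc_coef p n : cmean (fun w => (val w)^* ^+ n * pcirc p w) = p`_n.
Proof.
have := cmean_pcircX p 1 n; rewrite expr1n mulr1 => <-.
by congr cmean; apply/funext => w; rewrite mul1r.
Qed.

Lemma nrm2_cmean u : cmean (fun w => (u w)^* * u w) = (nrm2 u)%:C.
Proof.
rewrite -cmean_real; congr cmean; apply/funext => w.
by rewrite mulrC mulC_conj.
Qed.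

Lemma nrm2_pcirc p : nrm2 (pcirc p) = \sum_(i < size p) normc p`_i ^+ 2.
Proof.
apply: (@complexI R); rewrite -nrm2_cmean cmean_conj_pcirc; last exact: L2_CL1 (L2_pcirc p).
rewrite rmorph_sum; apply: eq_bigr => i _.
by rewrite cmean_pcirc_coef mulrC mulC_conj.
Qed.

Lemma nrm2_poly (c : nat -> R[i]) N :
  nrm2 (pcirc (\poly_(k < N) c k)) = \sum_(0 <= k < N) normc (c k) ^+ 2.
Proof.
set p := \poly_(k < N) c k; rewrite nrm2_pcirc big_mkord.
transitivity (\sum_(i < N) normc p`_i ^+ 2); last first.
  by apply: eq_bigr => i _; rewrite coef_poly ltn_ord.
rewrite (big_ord_widen N (fun i => normc p`_i ^+ 2)); last exact: size_poly.
rewrite big_mkcond; apply: eq_bigr => i _; case: ifPn => //; rewrite -leqNgt => h.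
by rewrite nth_default// normc0 expr0n.
Qed.

(** The squared distance from [u] to its N-th Fourier sum is nonnegative. *)
Lemma bessel u N : L2 u ->
  \sum_(0 <= k < N) normc (cmean (fun w => (val w)^* ^+ k * u w)) ^+ 2 <= nrm2 u.
Proof.
move=> hu; pose c k := cmean (fun w => (val w)^* ^+ k * u w).
set p := \poly_(k < N) c k.
have hp := L2_pcirc p.
have := nrm2_ge0 (L2B hu hp); rewrite nrm2B// -(nrm2_poly c N) -/p.
suff -> : cmean (fun w => (pcirc p w)^* * u w) = (nrm2 (pcirc p))%:C by move=> /=; lra.
rewrite cmean_conj_pcirc; last exact: L2_CL1.
rewrite nrm2_pcirc rmorph_sum; apply: eq_bigr => i _.
have iN : (i < N)%N by apply: leq_trans (ltn_ord i) (size_poly _ _).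
by rewrite coef_poly iN mulrC mulC_conj.
Qed.

Lemma cvgn_diff_le (a h : nat -> R) M : (forall n, `|a n.+1 - a n| <= h n) ->
  (forall N, \sum_(0 <= n < N) h n <= M) -> cvgn a.
Proof.
move=> ah hM.
have h0 n : 0 <= h n by apply: le_trans (ah n).
have ch : cvgn (series h).
  apply: nondecreasing_is_cvgn; first exact: nondecreasing_series.
  by exists M => _ [N _ <-]; exact: hM.
have : cvgn [series a n.+1 - a n]_n.
  by apply: normed_cvg; apply: (series_le_cvg _ h0 ah ch) => n; exact: normr_ge0.
move=> cs; have -> : a = (fun n => a 0%N + [series a n.+1 - a n]_n n).
  apply/funext => n; rewrite /series/= telescope_sumr// addrC subrK//.
by apply: is_cvgD => //; exact: is_cvg_cst.
Qed.

(** The increments have means at most 2^-n, so their sum is integrable, hence finite almost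
    everywhere, and the sequence converges absolutely there. *)
Lemma riesz_fischer_ae (u_ : nat -> circle R -> R[i]) : (forall n, L2 (u_ n)) ->
  (forall n, nrm2 (fun w => u_ n.+1 w - u_ n w) <= 4^-1 ^+ n) ->
  ae_circle (fun w => cvgn (fun n => Re (u_ n w)) /\ cvgn (fun n => Im (u_ n w))).
Proof.
move=> hu hd; pose h n w := normc (u_ n.+1 w - u_ n w).
have hL2 n : L2 (fun w => u_ n.+1 w - u_ n w) by exact: L2B.
have hL1 n : L1 (h n) by exact: CL1_normc (L2_CL1 (hL2 n)).
have hm n : mean (h n) <= 2^-1 ^+ n.
  rewrite -(@ler_pXn2r _ 2)// ?nnegrE ?exprn_ge0 ?invr_ge0//; last first.
    by apply: mean_ge0 => //; apply: aeW => t _; exact: normc_ge0.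
  apply: le_trans (sqr_mean_le (hL1 n) (L2_L1 (hL2 n))) (le_trans (hd n) _).
  rewrite le_eqVlt; apply/orP; left; apply/eqP.
  by rewrite -exprM mulnC exprM; congr (_ ^+ _); rewrite expr2 -invfM; congr (_^-1); ring.
pose f n t := (h n (cis t))%:E.
have mf n : measurable_fun (@period R) (f n).
  by apply/measurable_EFinP; exact: L1_mcirc.
have f0 n t : (@period R) t -> (0 <= f n t)%E by rewrite lee_fin normc_ge0.
have mP := @measurable_period R.
have fin : (\int[mu]_(t in @period R) (\sum_(n <oo) f n t) < +oo)%E.
  rewrite (integral_nneseries _ mP)//.
  apply: (@le_lt_trans _ _ (2 * pi * 2)%:E); last exact: ltry.
  apply: lime_le.
    by apply: is_cvg_nneseries => n _ _; apply: integral_ge0 => t; exact: f0.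
  apply: nearW => N.
  rewrite (eq_bigr (fun n => (2 * pi * mean (h n))%:E)); last first.
    move=> n _; rewrite /mean mulVKf ?gt_eqF ?twopi_gt0// /Rintegral fineK//.
    exact: integrable_fin_num (hL1 n).
  rewrite sumEFin lee_fin -mulr_sumr ler_pM2l ?twopi_gt0//.
  apply: (@le_trans _ _ (\sum_(0 <= n < N) 2^-1 ^+ n)); first by apply: ler_sum.
  have q01 : 0 <= (2^-1 : R) < 1 by rewrite invr_ge0 ler0n invf_lt1 ?ltr1n.
  apply: le_trans (geo_le 0 N q01) _.
  by rewrite expr0 le_eqVlt; apply/orP; left; apply/eqP; field.
have mS : measurable_fun (@period R) (fun t => \sum_(n <oo) f n t)%E.
  by apply: ge0_emeasurable_sum => // n t tP _; exact: f0.
have : mu.-integrable (@period R) (fun t => \sum_(n <oo) f n t)%E.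
  apply/integrableP; split => //.
  apply: le_lt_trans fin; rewrite le_eqVlt; apply/orP; left; apply/eqP.
  apply: eq_integral => t tP.
  by rewrite gee0_abs// nneseries_ge0// => n _ _; apply: f0; exact: set_mem.
move=> /(integrable_ae mP); apply: (@filterS _ _ (ae_filter_ringOfSetsType mu)) => t ft tP.
have {}ft := ft tP.
have hM N : \sum_(0 <= n < N) h n (cis t) <= fine (\sum_(n <oo) f n t)%E.
  rewrite -lee_fin fineK// -sumEFin.
  by apply: nneseries_lim_ge => *; exact: f0.
split.
- apply: cvgn_diff_le hM => n; rewrite -ReN -ReD; exact: Re_le_normc.
- apply: cvgn_diff_le hM => n; rewrite -ImN -ImD; exact: Im_le_normc.
Qed.

Lemma riesz_fischer (u_ : nat -> circle R -> R[i]) : (forall n, L2 (u_ n)) ->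
  (forall n m, (n <= m)%N -> nrm2 (fun w => u_ m w - u_ n w) <= 4^-1 ^+ n) ->
  exists2 g, L2 g & forall n, nrm2 (fun w => u_ n w - g w) <= 4^-1 ^+ n.
Proof.
move=> hu hd.
have hae := riesz_fischer_ae hu (fun n => hd n n.+1 (leqnSn n)).
(* The upper limit is defined and measurable everywhere and agrees with the limit where there is
   one; its other values are irrelevant. *)
pose l (f : nat -> circle R -> R) w : R := fine (limn_esup (fun n => (f n w)%:E)).
have ml f : (forall n, mcirc (f n)) -> mcirc (l f).
  move=> mf; apply: (measurableT_comp (f := fine)); first exact: fine_measurable.
  by apply: measurable_fun_limn_esup => n; apply/measurable_EFinP; exact: mf.
have cl f w : cvgn (fun n => f n w) -> (f n w) @[n --> \oo] --> l f w.
  move=> /cvg_ex[x cx]; suff -> : l f w = x by [].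
  have /cvg_limn_einf_sup[_ E] : (f n w)%:E @[n --> \oo] --> x%:E.
    by apply/cvg_EFin; [exact: nearW|].
  by rewrite /l E.
pose g w := l (fun n w => Re (u_ n w)) w +i* l (fun n w => Im (u_ n w)) w.
have mg : measurable_circle g.
  by apply/mcP; split; apply: ml => n; [apply: mc_Re|apply: mc_Im]; exact: L2_mc.
have cg : ae_circle (fun w => (u_ n w : R[i]^o) @[n --> \oo] --> (g w : R[i]^o)).
  apply: filterS hae => w [c1 c2]; apply: cvgC_ReIm.
  - exact: (cl (fun n w => Re (u_ n w))).
  - exact: (cl (fun n w => Im (u_ n w))).
(* Fatou's lemma, with [n] fixed and the later index tending to infinity, gives the distance to the
   limit and, for [n = 0], that the limit is in L^2. *)
have key n : L1 (fun w => normc (u_ n w - g w) ^+ 2) /\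
    mean (fun w => normc (u_ n w - g w) ^+ 2) <= 4^-1 ^+ n.
  apply: (mean_fatou (f_ := fun m w => normc (u_ (m + n)%N w - u_ n w) ^+ 2)).
  - by move=> m; apply: L2_L1; exact: L2B.
  - by move=> m w; exact: exprn_ge0.
  - by move=> m; apply: hd; exact: leq_addl.
  - by apply: mcircX; apply: mc_normc; apply: mcB => //; exact: L2_mc.
  - apply: filterS cg => w cw.
    have c1 : normc (u_ (m + n)%N w - u_ n w) @[m --> \oo] --> normc (g w - u_ n w).
      have : (u_ (m + n)%N w : R[i]^o) @[m --> \oo] --> (g w : R[i]^o).
        by rewrite (cvg_shiftn n (fun m => u_ m w : R[i]^o)).
      move=> /cvgCP h; apply: (@cvgC_normc R _ _ _ (fun m => u_ (m + n)%N w - u_ n w)).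
      apply/cvgCP => e e0; apply: filterS (h e e0) => m.
      by have -> : u_ (m + n)%N w - g w = u_ (m + n)%N w - u_ n w - (g w - u_ n w) by ring.
    rewrite normcBC; exact: (cvgM c1 c1).
exists g; last by move=> n; have [] := key n.
have [k _] := key 0%N.
have : L2 (fun w => u_ 0%N w - (u_ 0%N w - g w)).
  apply: L2B => //; apply/L2P; split => //.
  by apply: mcB => //; exact: L2_mc.
by under eq_fun do rewrite subKr.
Qed.

End RieszFischer.

(** * Boundary functions of H^2 and their Fourier description *)

Section BoundaryValues.
Variable R : realType.
Implicit Types (F G : R[i] -> R[i]) (f g : circle R -> R[i]) (p : {poly R[i]}).

Lemma boundary_values_ext F G f : (forall z, normc z < 1 -> F z = G z) ->
  boundary_values F f -> boundary_values G f.
Proof.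
move=> FG; apply: filterS => w; apply: cvg_trans; apply: near_eq_cvg.
near=> r; rewrite /on_circle FG// on_circle_norm//.
  by near: r; apply: nbhs_left_ge.
Unshelve. all: by end_near. Qed.

Lemma boundary_values_unique F f g : boundary_values F f -> boundary_values F g ->
  ae_circle (fun w => f w = g w).
Proof. by apply: filterS2 => w; exact: cvgC_unique. Qed.

Lemma boundary_values_ae F f g : ae_circle (fun w => f w = g w) ->
  boundary_values F f -> boundary_values F g.
Proof. by apply: filterS2 => w ->. Qed.

Lemma boundary_valuesM F G f g : boundary_values F f -> boundary_values G g ->
  boundary_values (fun z => F z * G z) (fun w => f w * g w).
Proof. by apply: filterS2 => w; exact: cvgCM. Qed.

Lemma boundary_values_poisson f : CL1 f -> boundary_values (poisson f) f.
Proof.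
move=> [f1 f2]; apply: filterS2 (rpoisson_radial f1) (rpoisson_radial f2) => w c1 c2.
apply: cvgC_ReIm.
- by under eq_fun do rewrite /on_circle Re_poisson.
- by under eq_fun do rewrite /on_circle Im_poisson.
Qed.

Lemma poisson_ae f g z : CL1 f -> CL1 g -> normc z < 1 ->
  ae_circle (fun w => f w = g w) -> poisson f z = poisson g z.
Proof.
move=> hf hg z1 fg; apply: eq_cmean; [exact: CL1_pker..|].
by apply: filterS fg => w ->.
Qed.

Lemma poissonB f g z : CL1 f -> CL1 g -> normc z < 1 ->
  poisson (fun w => f w - g w) z = poisson f z - poisson g z.
Proof.
move=> hf hg z1; rewrite /poisson -cmeanB; [|exact: CL1_pker..].
by congr cmean; apply/funext => w; rewrite mulrBr.
Qed.

Lemma normc_poisson_nrm2 f z : L2 f -> normc z < 1 ->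
  normc (poisson f z) ^+ 2 <= 2 / (1 - normc z) * nrm2 f.
Proof.
move=> hf z1; apply: le_trans (normc_poisson_sqr_le z1 hf) _; have l2 := L2_L1 hf.
rewrite -meanZ//; apply: le_mean; [exact: L1_pker|exact: L1Z|].
apply: aeW => t _; rewrite ler_wpM2r ?exprn_ge0//.
exact: le_trans (ler_norm _) (pker_le _ z1).
Qed.

(** Membership in the L^2 closure of the polynomials, the form in which orthogonality relations
    extend from polynomials to H^2_+. *)
Definition poly_approx f := forall e, 0 < e ->
  exists p, nrm2 (fun w => f w - pcirc p w) < e.

Lemma H2_disc_coef F : H2_disc F -> exists c : nat -> R[i],
  (forall z, normc z < 1 ->
    (\sum_(0 <= k < n) c k * z ^+ k : R[i]^o) @[n --> \oo] --> (F z : R[i]^o)) /\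
  exists M, forall N, \sum_(0 <= k < N) normc (c k) ^+ 2 <= M.
Proof.
move=> [[c hc] [M hM]]; exists c; split => //.
have lF : lunif F by apply: analytic_lunif; exists c.
exists ((2 * pi)^-1 * M) => N; set A := \sum_(0 <= k < N) _.
(* Bessel's inequality on the circle of radius r gives the coefficients c k r^k; for k < N each
   r^(2k) is at least r^(2N), a single factor that tends to 1 with r. *)
have h r : 0 <= r < 1 -> A * (r ^+ 2) ^+ N <= (2 * pi)^-1 * M.
  move=> r01; have l2 := lunif_L2 lF r01; have := hM r r01; rewrite L2_sqnorm//.
  apply: le_trans; apply: le_trans (bessel N l2); rewrite mulr_suml.
  have /andP[r0 r1] := r01; rewrite !big_mkord; apply: ler_sum => k _.
  rewrite (power_series_coef k hc r01) normcM normcX normc_real (ger0_norm r0) [leRHS]exprMn.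
  rewrite ler_wpM2l ?exprn_ge0// [leRHS]exprAC.
  by apply: ler_wiXn2l; rewrite ?exprn_ge0 ?exprn_ile1 ?(ltW r1)// ltnW.
have cA : A * (r ^+ 2) ^+ N @[r --> (1 : R)^'-] --> A * (1 ^+ 2) ^+ N.
  apply: cvg_at_left_filter.
  apply: cvgM; first exact: cvg_cst.
  by under eq_fun do rewrite -exprM; rewrite -exprM; exact: exprn_continuous.
rewrite !expr1n mulr1 in cA; rewrite -(cvg_lim _ cA)//.
apply: limr_le; first by apply/cvg_ex; exists A.
near=> r; apply: h; apply/andP; split.
  by near: r; exact: nbhs_left_ge.
by near: r; exact: nbhs_left_lt.
Unshelve. all: by end_near. Qed.

Lemma nondecreasing_bounded_tail (A : nat -> R) M :
  (forall n m, (n <= m)%N -> A n <= A m) -> (forall n, A n <= M) ->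
  forall e, 0 < e -> exists N, forall n m, (N <= n)%N -> (n <= m)%N -> A m - A n <= e.
Proof.
move=> nd bd e e0.
have cA : A @ \oo --> sup (range A).
  by apply: nondecreasing_cvgn => //; exists M => _ [n _ <-].
have hub : has_ubound (range A) by exists M => _ [n _ <-].
have /cvgrPdist_lt/(_ e e0)[N _ hN] := cA; exists N => n m Nn nm.
have := hN n Nn; have Am : A m <= sup (range A) by apply: ub_le_sup => //; exists m.
by move=> /(le_lt_trans (ler_norm _)); lra.
Qed.

(** Partial sums along a fast subsequence satisfy the hypothesis of [riesz_fischer]. That [N] can be
    taken beyond any [n] is what later identifies the coefficient of index [n] in the limit. *)
Lemma l2_synthesis (c : nat -> R[i]) M :
  (forall N, \sum_(0 <= k < N) normc (c k) ^+ 2 <= M) ->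
  exists2 g, L2 g & forall e n, 0 < e ->
    exists2 N, (n <= N)%N & nrm2 (fun w => g w - pcirc (\poly_(k < N) c k) w) < e.
Proof.
move=> hM; pose A N := \sum_(0 <= k < N) normc (c k) ^+ 2.
have nd n m : (n <= m)%N -> A n <= A m.
  move=> nm; rewrite /A (@big_cat_nat _ _ _ n 0 m)//= lerDl sumr_ge0// => k _.
  exact: exprn_ge0.
have [phi hphi] : exists phi : nat -> nat, forall j n m, (phi j <= n)%N -> (n <= m)%N ->
    A m - A n <= 4^-1 ^+ j.
  suff [phi h] : {phi : nat -> nat & forall j n m, (phi j <= n)%N -> (n <= m)%N ->
    A m - A n <= 4^-1 ^+ j} by exists phi.
  apply: (@choice _ _ (fun j N => forall n m, (N <= n)%N -> (n <= m)%N ->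
    A m - A n <= 4^-1 ^+ j)) => j.
  by apply: (nondecreasing_bounded_tail nd hM); rewrite exprn_gt0// invr_gt0.
(* Summing the thresholds makes the sequence monotone and above [phi j]; the summand [j] makes it
   unbounded. *)
pose N_ j := (\sum_(i < j.+1) phi i + j)%N.
have phiN j : (phi j <= N_ j)%N by rewrite /N_ big_ord_recr/= -addnA addnCA leq_addr.
have Nmono i j : (i <= j)%N -> (N_ i <= N_ j)%N.
  move=> ij; rewrite /N_ leq_add// -!(big_mkord xpredT phi).
  by rewrite [leqRHS](@big_cat_nat _ _ _ i.+1)//= leq_addr.
pose P j := \poly_(k < N_ j) c k.
have dP n m : (n <= m)%N -> nrm2 (fun w => pcirc (P m) w - pcirc (P n) w) <= 4^-1 ^+ n.
  move=> nm; apply: le_trans (hphi n (N_ n) (N_ m) (phiN n) (Nmono _ _ nm)).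
  pose d k := if (k < N_ n)%N then 0 else c k.
  have -> : (fun w => pcirc (P m) w - pcirc (P n) w) = pcirc (\poly_(k < N_ m) d k).
    apply/funext => w; rewrite /pcirc -hornerN -hornerD; congr (_.[_]).
    apply/polyP => k; rewrite coefD coefN !coef_poly /d.
    have NN := Nmono _ _ nm.
    have [h1|h1] := ltnP k (N_ n); last by case: ifP => _; rewrite ?subr0.
    by rewrite (leq_trans h1 NN) subrr.
  rewrite nrm2_poly /A (@big_cat_nat _ _ _ (N_ n))//=; last exact: Nmono.
  rewrite [leRHS](_ : _ = \sum_(N_ n <= k < N_ m) normc (c k) ^+ 2); last first.
    by rewrite (@big_cat_nat _ _ _ (N_ n) 0 (N_ m))//=; [ring|exact: Nmono].
  rewrite big1_seq ?add0r; last first.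
    by move=> k; rewrite mem_index_iota => /andP[_ /andP[_ kn]]; rewrite /d kn normc0 expr0n.
  apply: ler_sum_nat => k /andP[nk _]; rewrite /d ltnNge nk//=.
have [g g2 hg] := riesz_fischer (fun j => L2_pcirc (P j)) dP.
have small e : 0 < e -> exists J, forall j, (J <= j)%N -> nrm2 (fun w => g w - pcirc (P j) w) < e.
  move=> e0; have /cvgrPdist_lt/(_ e e0)[J _ hJ] : (4^-1 ^+ n) @[n --> \oo] --> (0 : R).
    by apply: cvg_expr; rewrite ger0_norm ?invr_ge0// invf_lt1 ?ltr1n.
  exists J => j Jj; rewrite nrm2BC; apply: le_lt_trans (hg j) _.
  have := hJ j Jj; rewrite sub0r normrN; apply: le_lt_trans; exact: ler_norm.
exists g => // e n /small[J hJ]; exists (N_ (J + n)%N).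
  exact: leq_trans (leq_addl J n) (leq_addl _ _).
by apply: hJ; exact: leq_addr.
Qed.

Lemma H2_disc_poisson F : H2_disc F -> exists g, [/\ L2 g, poly_approx g &
  forall z, normc z < 1 -> F z = poisson g z].
Proof.
move=> /H2_disc_coef[c [hc [M hM]]].
have [g g2 hg] := l2_synthesis hM; exists g; split => //.
- by move=> e /(hg _ 0%N)[N _ hN]; exists (\poly_(k < N) c k).
- move=> z z1; apply/eqP; rewrite -subr_eq0 -normc_eq0 eq_le normc_ge0 andbT.
  apply/ler_addgt0Pl => e e0; rewrite addr0.
  have z0 := normc_ge0 z; have e2 : 0 < e / 2 by rewrite divr_gt0.
  have zz : 0 <= normc z < 1 by rewrite z0.
  have [N hN] := power_series_lunif hc zz e2.
  pose K := 2 / (1 - normc z).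
  have K0 : 0 < K by rewrite divr_gt0// subr_gt0.
  (* Evaluation at z is bounded on L^2, with squared norm at most [K]; a squared error below this
     value moves the Poisson integral at z by at most e / 2. *)
  have d0 : 0 < (e / 2) ^+ 2 / K by rewrite divr_gt0// exprn_gt0.
  have [n Nn hn] := hg _ N d0.
  have h1 := hN n Nn z (lexx _).
  have hd := L2B g2 (L2_pcirc (\poly_(k < n) c k)).
  have h2 : normc (poisson g z - (\poly_(k < n) c k).[z]) <= e / 2.
    rewrite -(poisson_pcirc _ z1) -poissonB//; [|exact: L2_CL1 g2|exact: L2_CL1 (L2_pcirc _)].
    rewrite -(@ler_pXn2r _ 2)// ?nnegrE ?(ltW e2)//.
    apply: le_trans (normc_poisson_nrm2 hd z1) _.
    by rewrite -/K mulrC -ler_pdivlMr// ltW.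
  rewrite -(subrKA (\poly_(k < n) c k).[z]) (le_trans (normcD_le _ _))// [e]splitr.
  by apply: lerD; rewrite normcBC.
Qed.

Lemma boundary_values_exists F : H2_disc F -> exists g, [/\ L2 g, poly_approx g,
  boundary_values F g & forall z, normc z < 1 -> F z = poisson g z].
Proof.
move=> /H2_disc_poisson[g [g2 ga gF]]; exists g; split => //.
apply: boundary_values_ext (boundary_values_poisson (L2_CL1 g2)) => z z1.
by rewrite gF.
Qed.

Lemma poly_approx_ae f g : L2 f -> L2 g -> ae_circle (fun w => f w = g w) ->
  poly_approx f -> poly_approx g.
Proof.
move=> hf hg fg h e e0; have [p hp] := h e e0; exists p.
rewrite -(nrm2_ext (L2B hf (L2_pcirc p)))//; last by apply: filterS fg => w ->.
by apply: L2B => //; exact: L2_pcirc.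
Qed.

(** Radial limits are unique, so any boundary function agrees almost everywhere with the one
    synthesised from the Taylor coefficients and inherits its properties. *)
Lemma H2_boundary F f : L2 f -> H2_disc F -> boundary_values F f ->
  poly_approx f /\ forall z, normc z < 1 -> F z = poisson f z.
Proof.
move=> f2 hF bf; have [g [g2 ga bg gF]] := boundary_values_exists hF.
have gf := boundary_values_unique bg bf; split; first exact: poly_approx_ae gf ga.
by move=> z z1; rewrite gF// (poisson_ae _ _ _ gf)//; exact: L2_CL1.
Qed.

Lemma nrm2_expn n : nrm2 (fun w : circle R => val w ^+ n) = 1.
Proof.
rewrite -[RHS](@mean_cst R); congr mean; apply/funext => w.
by rewrite normc_circleX expr1n.
Qed.

Lemma L2_expn n : L2 (fun w : circle R => val w ^+ n).
Proof. by apply: (@L2_bd R _ 1 (@mc_circleX R n)) => w; rewrite normc_circleX. Qed.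

Lemma L2_expnM n f : L2 f -> L2 (fun w => val w ^+ n * f w).
Proof.
by apply: (@L2_bdM R _ _ 1 (@mc_circleX R n)); apply: aeW => t _; rewrite normc_circleX.
Qed.

Lemma poly_approx_orth u f : L2 u -> L2 f -> poly_approx f ->
  (forall p, cmean (fun w => u w * pcirc p w) = 0) -> cmean (fun w => u w * f w) = 0.
Proof.
move=> hu hf ha h0; apply/eqP; rewrite -normc_eq0 -sqrf_eq0 eq_le exprn_ge0// andbT.
apply/ler_addgt0Pl => e e0; rewrite addr0.
have n0 := nrm2_ge0 hu.
have d0 : 0 < e / (nrm2 u + 1) by rewrite divr_gt0// ltr_wpDl.
have [p hp] := ha _ d0; have hd := L2B hf (L2_pcirc p).
have -> : cmean (fun w => u w * f w) = cmean (fun w => u w * (f w - pcirc p w)).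
  under [in RHS]eq_fun do rewrite mulrBr.
  by rewrite cmeanB ?h0 ?subr0//; apply: L2M_CL1 => //; exact: L2_pcirc.
apply: le_trans (normc_cmeanM_le hu hd) _.
rewrite ltr_pdivlMr ?ltr_wpDl// in hp.
by have := nrm2_ge0 hd; nra.
Qed.

Lemma poly_approx_coef f n : L2 f -> poly_approx f -> (0 < n)%N ->
  cmean (fun w => val w ^+ n * f w) = 0.
Proof.
move=> hf ha n0; apply: poly_approx_orth => //; first exact: L2_expn.
by move=> p; exact: cmean_pcirc0.
Qed.

(** Conversely, when the coefficients of negative index vanish, the Poisson integral is analytic,
    has |f|^2 as the boundary data of a harmonic majorant, and has [f] as radial limits by Fatou's
    theorem. *)
Lemma H2pP f : H2p f <-> L2 f /\ forall n, (0 < n)%N -> cmean (fun w => val w ^+ n * f w) = 0.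
Proof.
split=> [[f2 [F [hF bF]]]|[f2 h]].
  have [ha _] := H2_boundary f2 hF bF; split => // n; exact: poly_approx_coef.
split => //; exists (poisson f); have f1 := L2_CL1 f2; split.
  apply: (H2_disc_bound (lunif_poisson f1 h) (L2_L1 f2)) => z z1.
  exact: normc_poisson_sqr_le.
exact: boundary_values_poisson.
Qed.

Lemma H2p_L2 f : H2p f -> L2 f. Proof. by case. Qed.

Lemma H2p_approx f : H2p f -> poly_approx f.
Proof. by move=> [f2 [F [hF bF]]]; have [] := H2_boundary f2 hF bF. Qed.

Lemma H2p_poisson f : H2p f ->
  [/\ lunif (poisson f), H2_disc (poisson f) & boundary_values (poisson f) f].
Proof.
move=> /H2pP[f2 h]; have f1 := L2_CL1 f2; have lf := lunif_poisson f1 h; split => //.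
  by apply: (H2_disc_bound lf (L2_L1 f2)) => z z1; exact: normc_poisson_sqr_le.
exact: boundary_values_poisson.
Qed.

Lemma H2p_ae f g : L2 g -> ae_circle (fun w => f w = g w) -> H2p f -> H2p g.
Proof.
move=> g2 fg [f2 [F [hF bF]]]; split; first exact: g2.
by exists F; split; [exact: hF|exact: boundary_values_ae bF].
Qed.

End BoundaryValues.

(** * Outer functions, Jensen's inequality, factorization and the Smirnov principle *)

Section OuterFunctions.
Variable R : realType.
Local Notation "x ^*" := (conjc x) : ring_scope.
Implicit Types (F G : R[i] -> R[i]) (f g : circle R -> R[i]) (k : circle R -> R).

Definition outer_fun k z : R[i] := cexp (herglotz (fun w => (k w)%:C) z).

Lemma outer_discP F : outer_disc F <-> exists c k, [/\ normc c = 1, L1 k &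
  forall z, normc z < 1 -> F z = c * outer_fun k z].
Proof.
have E k z : cexp (((2 * pi)^-1)%:C *
    cintegral (fun w => (val w + z) / (val w - z) * (k w)%:C)) = outer_fun k z.
  by rewrite cmeanE.
split=> -[c [k [c1 lk Fz]]]; exists c, k; split => // z z1.
- by rewrite Fz// E.
- by rewrite Fz// E.
Qed.

Lemma lunif_outer k : L1 k -> lunif (outer_fun k).
Proof. by move=> lk; apply: lunif_cexp; apply: lunif_herglotz; exact: CL1_real. Qed.

Lemma normc_outer k z : normc (outer_fun k z) = expR (rpoisson k z).
Proof. by rewrite normc_cexp Re_herglotz. Qed.

Lemma outer_neq0 k z : outer_fun k z != 0.
Proof. exact: cexp_neq0. Qed.

Lemma outer_funN k z : L1 k -> normc z < 1 ->
  outer_fun (fun w => - k w) z = (outer_fun k z)^-1.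
Proof.
move=> lk z1; rewrite -cexpN; congr cexp.
rewrite /herglotz -cmeanN; last by apply: CL1_hker => //; exact: CL1_real.
by congr cmean; apply/funext => w; rewrite rmorphN mulrN.
Qed.

Lemma rpoissonN k z : normc z < 1 -> L1 k -> rpoisson (fun w => - k w) z = - rpoisson k z.
Proof.
by move=> z1 lk; rewrite -mulN1r -rpoissonZ//; under [in RHS]eq_fun do rewrite mulN1r.
Qed.

Lemma rpoisson_ae (g h : circle R -> R) z : normc z < 1 -> L1 g -> L1 h ->
  ae_circle (fun w => g w = h w) -> rpoisson g z = rpoisson h z.
Proof.
by move=> z1 lg lh gh; apply: eq_mean; [exact: L1_pker..|]; apply: filterS gh => w ->.
Qed.

Lemma L1_ae (g h : circle R -> R) : mcirc g -> L1 h -> ae_circle (fun w => g w = h w) -> L1 g.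
Proof.
by move=> mg lh gh; apply: (L1_le mg (L1_norm lh)); apply: filterS gh => w ->.
Qed.

(** The modulus in the disc is exp of the Poisson integral of [k], to which Fatou's theorem
    applies. *)
Lemma outer_boundary_norm k c f : L1 k -> normc c = 1 ->
  boundary_values (fun z => c * outer_fun k z) f -> ae_circle (fun w => normc (f w) = expR (k w)).
Proof.
move=> lk c1; apply: filterS2 (rpoisson_radial lk) => w ck cf.
have b : normc (c * outer_fun k (r%:C * val w)) @[r --> (1 : R)^'-] --> normc (f w).
  exact: cvgC_normc cf.
rewrite (_ : (fun r => normc _) = fun r : R => expR (rpoisson k (r%:C * val w))) in b; last first.
  by apply/funext => r; rewrite normcM c1 mul1r normc_outer.
have : expR (rpoisson k (r%:C * val w)) @[r --> (1 : R)^'-] --> expR (k w).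
  by apply: (cvg_comp _ _ ck); exact: continuous_expR.
by move=> a; exact: (cvg_unique _ b a).
Qed.

Lemma outer_H2_disc k : L1 k -> L1 (fun w => expR (2 * k w)) -> H2_disc (outer_fun k).
Proof.
move=> lk le; apply: (H2_disc_bound (lunif_outer lk) le) => z z1.
rewrite normc_outer -expRM_natl -rpoissonZ//.
by apply: expR_rpoisson_le => //; exact: L1Z.
Qed.

Lemma H2_disc_bounded F M : lunif F -> (forall z, normc z < 1 -> normc (F z) <= M) -> H2_disc F.
Proof.
move=> lF FM; apply: (H2_disc_bound lF (L1_cst (M ^+ 2))) => z z1.
rewrite rpoisson_cst// lerXn2r ?nnegrE ?FM//.
exact: le_trans (FM z z1).
Qed.

Lemma normc_poisson_le1 f z : CL1 f -> normc z < 1 -> ae_circle (fun w => normc (f w) <= 1) ->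
  normc (poisson f z) <= 1.
Proof.
move=> hf z1 f1; rewrite -[leRHS](mean_pker z1); have hp := CL1_pker z1 hf.
apply: le_trans (normc_cmean_le hp) _; apply: le_mean; first exact: CL1_normc.
  by have := L1_pker z1 (@L1_cst R 1); under eq_fun do rewrite mulr1.
apply: filterS f1 => w f1; have p0 := ltW (pker_gt0 w z1).
by rewrite normcM normc_real (ger0_norm p0) ler_piMr.
Qed.

Lemma mcirc_ln f e : measurable_circle f -> mcirc (fun w => ln (normc (f w) + e)).
Proof.
move=> mf; apply: (@mcirc_comp _ (@ln R)); first exact: measurable_ln.
by apply: mcircD; [exact: mc_normc|exact: mcirc_cst].
Qed.

(** The function lies between ln e and |f| + e, both integrable. *)
Lemma L1_lnD f e : L2 f -> 0 < e -> L1 (fun w => ln (normc (f w) + e)).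
Proof.
move=> f2 e0; have l1 := CL1_normc (L2_CL1 f2).
apply: (L1_le (mcirc_ln e (L2_mc f2)) (L1D l1 (L1_cst (e + `|ln e|)))).
apply: aeW => t _; have n0 := normc_ge0 (f (cis t)).
have ne : 0 < normc (f (cis t)) + e by rewrite ltr_wpDl.
rewrite ler_norml; apply/andP; split; last first.
  by have := ln_sublinear ne; have := normr_ge0 (ln e); lra.
have : ln e <= ln (normc (f (cis t)) + e) by rewrite ler_ln ?posrE// lerDr.
have : - `|ln e| <= ln e by rewrite lerNl -normrN ler_norm.
by lra.
Qed.

(* [F / O] with [|O| = |f| + e] on the circle is in H^2 because [|O| >= e], has boundary
   values of modulus at most 1, and is the Poisson integral of these: this gives the
   Jensen inequality without factoring out the zeros of [F]. *)
Lemma normc_le_outer_eps F f e z : L2 f -> H2_disc F -> boundary_values F f -> 0 < e ->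
  normc z < 1 -> normc (F z) <= expR (rpoisson (fun w => ln (normc (f w) + e)) z).
Proof.
move=> f2 hF bF e0 z1; set k := fun w => ln (normc (f w) + e).
have lk : L1 k by exact: L1_lnD.
have lk' : L1 (fun w => - k w) by exact: L1N.
have ke w : ln e <= k w by rewrite ler_ln ?posrE ?ltr_wpDl// lerDr.
have Qe y : normc y < 1 -> normc (outer_fun (fun w => - k w) y) <= e^-1.
  move=> y1; rewrite normc_outer rpoissonN// -[leRHS]lnK ?posrE ?invr_gt0//.
  rewrite ler_expR lnV ?posrE// lerN2 -(rpoisson_cst (ln e) y1).
  by apply: rpoisson_le => //; [exact: L1_cst|exact: aeW].
have lQ := lunif_outer lk'.
have [q [q2 _ bq _]] := boundary_values_exists (H2_disc_bounded lQ Qe).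
have lF : lunif F by apply: analytic_lunif; case: hF.
have [_ Fp] := H2_boundary f2 hF bF.
have hG : H2_disc (fun z => F z * outer_fun (fun w => - k w) z).
  apply: (H2_disc_bound (lunifM lF lQ) (L1Z (e^-1 ^+ 2) (L2_L1 f2))) => y y1.
  rewrite rpoissonZ//; last exact: L2_L1.
  rewrite normcM exprMn mulrC; apply: ler_pM; rewrite ?exprn_ge0//.
    by rewrite lerXn2r ?nnegrE ?invr_ge0 ?(ltW e0)// Qe.
  by rewrite Fp// normc_poisson_sqr_le.
have [g [g2 _ bg gG]] := boundary_values_exists hG.
have nq : ae_circle (fun w => normc (q w) = expR (- k w)).
  apply: (outer_boundary_norm (c := 1)) lk' _ _; first exact: normc1.
  by apply: boundary_values_ext bq => y _; rewrite mul1r.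
have ng : ae_circle (fun w => normc (g w) <= 1).
  have gfq := boundary_values_unique bg (boundary_valuesM bF bq).
  apply: filterS2 gfq nq => w -> nq; rewrite normcM nq expRN lnK; last first.
    by rewrite posrE ltr_wpDl.
  by rewrite ler_pdivrMr ?ltr_wpDl// mul1r lerDl ltW.
have := normc_poisson_le1 (L2_CL1 g2) z1 ng; rewrite -gG// normcM normc_outer rpoissonN//.
by rewrite expRN ler_pdivrMr ?expR_gt0// mul1r.
Qed.

(** * Removal of the perturbation in Jensen's inequality *)

Section Jensen.
Variables (F : R[i] -> R[i]) (f : circle R -> R[i]) (z0 : R[i]).
Hypotheses (f2 : L2 f) (hF : H2_disc F) (bF : boundary_values F f).
Hypotheses (z01 : normc z0 < 1) (Fz0 : F z0 != 0).
Let k n w := ln (normc (f w) + n.+1%:R^-1).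

Let e_gt0 n : 0 < n.+1%:R^-1 :> R. Proof. by rewrite invr_gt0. Qed.

Let lk n : L1 (k n). Proof. exact: L1_lnD. Qed.

Let k_le n w : k n w <= k 0 w.
Proof.
by rewrite ler_ln ?posrE ?ltr_wpDl// lerD2l invr1 invf_le1// ler1n.
Qed.

Let lh n : L1 (fun w => pker z0 w * (k 0 w - k n w)).
Proof. by apply: L1_pker => //; exact: L1B. Qed.

Let h_ge0 n w : 0 <= pker z0 w * (k 0 w - k n w).
Proof. by rewrite mulr_ge0 ?subr_ge0// ltW// pker_gt0. Qed.

(** As ln |F z0| is at most the Poisson integral of every [k n] at [z0], this bounds the means of
    the nonnegative functions [pker z0 * (k 0 - k n)] uniformly in [n]. It is here that [F z0] must
    not vanish. *)
Let C := rpoisson (k 0) z0 - ln (normc (F z0)).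

Let mean_h n : mean (fun w => pker z0 w * (k 0 w - k n w)) <= C.
Proof.
under eq_fun do rewrite mulrBr.
rewrite meanB; [|exact: L1_pker..]; rewrite lerD2l lerN2.
rewrite -[leRHS]expRK ler_ln ?posrE ?normc_gt0 ?expR_gt0//.
exact: normc_le_outer_eps.
Qed.

(** Where [f] vanishes, [k 0 - k n] equals ln (n + 1), which is unbounded; the bound [C] on the
    means then forces the zero set to be null. This comes before any limit, because [k n] tends to
    ln |f| only off that set. *)
Lemma H2_neq0 : ae_circle (fun w => f w != 0).
Proof.
pose chi w : R := if normc (f w) == 0 then 1 else 0.
have chi0 w : 0 <= chi w by rewrite /chi; case: ifP.
have mchi : mcirc chi.
  apply: measurable_fun_if; first exact: (@measurable_period R).
  - by apply: measurable_fun_eqr; [exact: mc_normc (L2_mc f2)|exact: measurable_cst].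
  - exact: measurable_cst.
  - exact: measurable_cst.
have lchi : L1 chi.
  by apply: (@L1_bd _ _ 1) => // w; rewrite /chi; case: ifP; rewrite ?normr1 ?normr0.
pose c := (1 - normc z0) / 2.
have c0 : 0 < c by rewrite divr_gt0// subr_gt0.
have hm n : c * ln n.+1%:R * mean chi <= C.
  apply: le_trans (mean_h n); rewrite -meanZ//; apply: le_mean => //; first exact: L1Z.
  apply: aeW => t _; rewrite /chi; case: ifPn => [/eqP n0|_]; last by rewrite mulr0.
  rewrite mulr1 /k n0 !add0r invr1 ln1 lnV ?posrE// sub0r opprK.
  by rewrite ler_wpM2r ?pker_ge// ln_ge0// ler1n.
have m0 : mean chi = 0.
  apply/eqP; rewrite eq_le mean_ge0//; last exact: aeW.
  rewrite andbT leNgt; apply/negP => m0.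
  have cm : 0 < c * mean chi by rewrite mulr_gt0.
  pose x := expR (C / (c * mean chi) + 1).
  pose n := Num.truncn x.
  have xn : x < n.+1%:R by exact: truncnS_gt.
  have : C / (c * mean chi) + 1 < ln n.+1%:R.
    by rewrite -[ltLHS]expRK ltr_ln ?posrE ?expR_gt0.
  have := hm n; rewrite mulrAC -ler_pdivlMl// mulrC; lra.
apply: filterS (mean_eq0 lchi (aeW _ (fun t _ => chi0 _)) m0) => w.
by rewrite /chi normc_eq0; case: ifP => // _ /eqP; rewrite oner_eq0.
Qed.

Let cvg_k w : f w != 0 -> k n w @[n --> \oo] --> ln (normc (f w)).
Proof.
move=> fw; have n0 : 0 < normc (f w) by rewrite normc_gt0.
have : (normc (f w) + n.+1%:R^-1) @[n --> \oo] --> normc (f w) + 0.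
  by apply: cvgD; [exact: cvg_cst|exact: cvg_harmonic].
rewrite addr0 => h; apply: (cvg_comp _ _ h); exact: continuous_ln.
Qed.

Let mln : mcirc (fun w => ln (normc (f w))).
Proof.
by have := mcirc_ln 0 (L2_mc f2); under eq_fun do rewrite addr0.
Qed.

(** Fatou's lemma gives integrability against the Poisson kernel at [z0]; the kernel is bounded
    below, so the weight can be removed. *)
Lemma L1_ln_boundary : L1 (fun w => ln (normc (f w))).
Proof.
have [lH _] := @mean_fatou R (fun n w => pker z0 w * (k 0 w - k n w))
  (fun w => pker z0 w * (k 0 w - ln (normc (f w)))) C lh h_ge0 mean_h
  (mcircM (pker_mcirc z01) (mcircB (L1_mcirc (lk 0)) mln))
  (filterS (fun w fw => cvgM (cvg_cst _) (cvgB (cvg_cst _) (cvg_k fw))) H2_neq0).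
pose c := (1 - normc z0) / 2.
have c0 : 0 < c by rewrite divr_gt0// subr_gt0.
have lD : L1 (fun w => k 0 w - ln (normc (f w))).
  apply: (L1_le (mcircB (L1_mcirc (lk 0)) mln) (L1Z c^-1 (L1_norm lH))).
  apply: aeW => t _; rewrite normrM mulrA ler_peMl// ler_pdivlMl// mulr1.
  exact: le_trans (pker_ge _ z01) (ler_norm _).
by have := L1B (lk 0) lD; under eq_fun do rewrite subKr.
Qed.

(** Dominated convergence in [normc_le_outer_eps]: every [k n] lies between ln |f| and [k 0], both
    integrable. *)
Lemma jensen z : normc z < 1 -> normc (F z) <= expR (rpoisson (fun w => ln (normc (f w))) z).
Proof.
move=> z1; have ll := L1_ln_boundary.
have bd n : ae_circle (fun w => `|pker z w * k n w| <=
    2 / (1 - normc z) * (`|k 0 w| + `|ln (normc (f w))|)).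
  apply: filterS H2_neq0 => w fw; rewrite normrM; apply: ler_pM => //.
    exact: pker_le.
  have n0 : 0 < normc (f w) by rewrite normc_gt0.
  have l1 : ln (normc (f w)) <= k n w by rewrite ler_ln ?posrE ?ltr_wpDl// lerDl.
  have l2 := k_le n w; rewrite ler_norml; apply/andP; split.
    have := normr_ge0 (k 0 w).
    have : - `|ln (normc (f w))| <= ln (normc (f w)) by rewrite lerNl -normrN ler_norm.
    lra.
  by have := ler_norm (k 0 w); have := normr_ge0 (ln (normc (f w))); lra.
have [_ cv] := mean_dominated_cvg
  (fun n => mcircM (pker_mcirc z1) (L1_mcirc (lk n)))
  (mcircM (pker_mcirc z1) mln)
  (L1Z _ (L1D (L1_norm (lk 0)) (L1_norm ll)))
  (filterS (fun w fw => cvgM (cvg_cst _) (cvg_k fw)) H2_neq0) bd.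
have ce : expR (rpoisson (k n) z) @[n --> \oo] --> expR (rpoisson (fun w => ln (normc (f w))) z).
  by apply: (cvg_comp _ _ cv); exact: continuous_expR.
rewrite -(cvg_lim _ ce)//; apply: limr_ge; first by apply/cvg_ex; eexists; exact: ce.
by apply: nearW => n; exact: normc_le_outer_eps.
Qed.

End Jensen.

Lemma H2p_log f : H2p f -> ~ ae_circle (fun w => f w = 0) ->
  [/\ ae_circle (fun w => f w != 0), L1 (fun w => ln (normc (f w))) &
    forall z, normc z < 1 -> normc (poisson f z) <= expR (rpoisson (fun w => ln (normc (f w))) z)].
Proof.
move=> hf nf; have [lF hF bF] := H2p_poisson hf; have f2 := H2p_L2 hf.
(* If the Poisson integral vanished throughout the disc, so would its radial limits, which are
   [f]. *)
have [z0 [z01 Fz0]] : exists z0, normc z0 < 1 /\ poisson f z0 != 0.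
  apply: contrapT => /forallNP h; apply: nf.
  have b0 : boundary_values (fun=> 0) f.
    apply: boundary_values_ext bF => z z1; apply/eqP/negPn/negP => Fz.
    by apply: (h z); split.
  by apply: (boundary_values_unique b0); apply: aeW => t _; exact: cvg_cst.
split; first exact: H2_neq0 f2 hF bF z01 Fz0.
- exact: L1_ln_boundary f2 hF bF z01 Fz0.
- by move=> z; exact: jensen f2 hF bF z01 Fz0 z.
Qed.

Lemma Hinfty_disc_lunif F : Hinfty_disc F ->
  lunif F /\ exists2 M, 0 <= M & forall z, normc z < 1 -> normc (F z) <= M.
Proof.
move=> [aF [M hM]]; split; first exact: analytic_lunif.
by exists M => //; apply: le_trans (hM 0 _) => //; rewrite normc0.
Qed.

Lemma H2_discM F G : Hinfty_disc F -> H2_disc G -> H2_disc (fun z => F z * G z).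
Proof.
move=> /Hinfty_disc_lunif[lF [M M0 hM]] hG.
have [g [g2 _ _ gG]] := boundary_values_exists hG.
have lG : lunif G by apply: analytic_lunif; case: hG.
apply: (H2_disc_bound (lunifM lF lG) (L1Z (M ^+ 2) (L2_L1 g2))) => z z1.
rewrite rpoissonZ//; last exact: L2_L1.
rewrite normcM exprMn; apply: ler_pM; rewrite ?exprn_ge0//.
  by rewrite lerXn2r ?nnegrE ?hM.
by rewrite gG// normc_poisson_sqr_le.
Qed.

Lemma L2_LinftyM f g : Linfty f -> L2 g -> L2 (fun w => f w * g w).
Proof. by move=> [mf [M hM]] hg; exact: L2_bdM mf hM hg. Qed.

Lemma H2p_HinftyM f g : Hinfty f -> H2p g -> H2p (fun w => f w * g w).
Proof.
move=> [lf [F [hF bF]]] [g2 [G [hG bG]]]; split; first exact: L2_LinftyM.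
exists (fun z => F z * G z); split; first exact: H2_discM.
exact: boundary_valuesM.
Qed.

Lemma Hinfty_H2p f : Hinfty f -> H2p f.
Proof.
move=> [[mf [M hM]] [F [hF bF]]]; split.
  have := L2_bdM mf hM (L2_bd (mc_cst 1) (fun=> lexx _)).
  by under eq_fun do rewrite mulr1.
exists F; split => //; have [lF [K K0 hK]] := Hinfty_disc_lunif hF.
exact: H2_disc_bounded lF hK.
Qed.

(** Jensen's inequality bounds [J = F / O] by 1, which provides its boundary values; they have
    modulus 1 because [f] and the boundary function of [O] have the same modulus, almost everywhere
    nonzero. *)
Lemma inner_outer_factorization f : H2p f -> ~ ae_circle (fun w => f w = 0) ->
  exists j o, [/\ inner_function j, outer_H2p o & ae_circle (fun w => f w = j w * o w)].
Proof.
move=> hf nf; have [f0 lk jf] := H2p_log hf nf.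
have [lF hF bF] := H2p_poisson hf; have f2 := H2p_L2 hf.
set k := fun w => ln (normc (f w)) in lk jf *.
have ek : ae_circle (fun w => expR (k w) = normc (f w)).
  by apply: filterS f0 => w fw; rewrite lnK// posrE normc_gt0.
have le : L1 (fun w => expR (2 * k w)).
  apply: (L1_ae _ (L2_L1 f2)).
    apply: (@mcirc_comp _ (@expR R)); first exact: measurable_expR.
    by apply: mcircM; [exact: mcirc_cst|exact: L1_mcirc].
  by apply: filterS ek => w ek; rewrite expRM_natl ek.
have hO := outer_H2_disc lk le.
have [q [q2 _ bq _]] := boundary_values_exists hO.
have lk' := L1N lk.
(* Division by an outer function is multiplication by the outer function of [- k], which keeps [J] a
   locally uniform limit of polynomials. *)
pose J z := poisson f z * outer_fun (fun w => - k w) z.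
have lJ : lunif J by apply: lunifM => //; exact: lunif_outer.
have J1 z : normc z < 1 -> normc (J z) <= 1.
  move=> z1; rewrite normcM normc_outer rpoissonN// expRN.
  by rewrite ler_pdivrMr ?expR_gt0// mul1r jf.
have [j [j2 _ bj _]] := boundary_values_exists (H2_disc_bounded lJ J1).
have fjq : ae_circle (fun w => f w = j w * q w).
  apply: (boundary_values_unique bF).
  apply: (boundary_values_ext _ (boundary_valuesM bj bq)) => z z1.
  by rewrite /J outer_funN// mulfVK// outer_neq0.
have nq : ae_circle (fun w => normc (q w) = expR (k w)).
  apply: (outer_boundary_norm (c := 1)) lk _ _; first exact: normc1.
  by apply: boundary_values_ext bq => y _; rewrite mul1r.
have nj : ae_circle (fun w => normc (j w) = 1).
  apply: filterS2 (filterI fjq nq) (filterI ek f0) => w [fw qw] [ew fw0].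
  have n0 : normc (f w) != 0 by rewrite normc_eq0.
  apply: (mulIf n0); rewrite mul1r {2}fw normcM; congr (_ * _).
  by rewrite qw ew.
exists j, q; split; last exact: fjq.
- split; last exact: nj.
  split; first by split; [exact: L2_mc|exists 1; apply: filterS nj => w ->].
  exists J; split; last exact: bj.
  by split; [exact: lunif_analytic|exists 1].
- split; first exact: q2.
  exists (outer_fun k); split; [exact: hO|exact: bq|apply/outer_discP].
  exists 1, k; split; [exact: normc1|exact: lk|].
  by move=> z _; rewrite mul1r.
Qed.

Lemma outer_H2pP f : outer_H2p f -> exists c k, [/\ normc c = 1, L1 k,
  H2_disc (fun z => c * outer_fun k z), boundary_values (fun z => c * outer_fun k z) f &
  ae_circle (fun w => normc (f w) = expR (k w))].
Proof.
move=> [f2 [F [hF bF /outer_discP[c [k [c1 lk Fz]]]]]]; exists c, k.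
have bf : boundary_values (fun z => c * outer_fun k z) f by exact: boundary_values_ext bF.
split => //; last exact: outer_boundary_norm bf.
have [f' [f'2 _ _ gF]] := boundary_values_exists hF.
have lF : lunif F by apply: analytic_lunif; case: hF.
apply: (H2_disc_bound (lunif_ext Fz lF) (L2_L1 f'2)) => z z1.
by rewrite -Fz// gF// normc_poisson_sqr_le.
Qed.

Lemma outer_H2p_H2p f : outer_H2p f -> H2p f.
Proof. by move=> [f2 [F [hF bF _]]]; split => //; exists F. Qed.

Lemma outer_H2p_neq0 f : outer_H2p f -> ae_circle (fun w => f w != 0).
Proof.
move=> /outer_H2pP[c [k [_ _ _ _ h]]]; apply: filterS h => w fw.
by rewrite -normc_eq0 fw gt_eqF// expR_gt0.
Qed.

Lemma H2p_ae0 f : L2 f -> ae_circle (fun w => f w = 0) -> H2p f.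
Proof.
move=> f2 f0; apply/H2pP; split => // n _.
rewrite -[RHS](@cmean_cst R); apply: eq_cmean; [|exact: CL1_cst|].
  by apply: L2_CL1; exact: L2_expnM.
by apply: filterS f0 => w ->; rewrite mulr0.
Qed.

(* The Smirnov maximum principle: Jensen's inequality for the two numerators and the
   formula for the outer denominator bound [log |F|] by the Poisson integral of [log |g|]. *)
Lemma smirnov f h o g : H2p f -> H2p h -> outer_H2p o -> L2 g ->
  ae_circle (fun w => g w * o w = f w * h w) -> H2p g.
Proof.
move=> hf hh ho g2 gfh; have o0 := outer_H2p_neq0 ho.
have zero (u : circle R -> R[i]) : (forall w, u w = 0 -> f w * h w = 0) -> ae_circle (fun w => u w = 0) -> H2p g.
  move=> uf u0; apply: H2p_ae0 => //.
  apply: filterS2 (filterI u0 o0) gfh => w [uw ow] E; rewrite uf// in E.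
  by move/eqP : E; rewrite mulf_eq0 (negPf ow) orbF => /eqP.
have [f0|nf] := pselect (ae_circle (fun w => f w = 0)).
  by apply: (zero f) => // w ->; rewrite mul0r.
have [h0|nh] := pselect (ae_circle (fun w => h w = 0)).
  by apply: (zero h) => // w ->; rewrite mulr0.
have [fn0 lf jf] := H2p_log hf nf; have [hn0 lh jh] := H2p_log hh nh.
have [lF hF bF] := H2p_poisson hf; have [lH hH bH] := H2p_poisson hh.
have [c [k [c1 lk hO bo no]]] := outer_H2pP ho.
have c0 : c != 0 by rewrite -normc_eq0 c1 oner_eq0.
(* This is ln |g| almost everywhere. *)
pose K w := ln (normc (f w)) + ln (normc (h w)) + (- k w).
have lN := L1N lk.
have lfh := L1D lf lh; have lK : L1 K by exact: L1D lfh lN.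
pose Q z := c^-1 * outer_fun (fun w => - k w) z.
pose G z := poisson f z * poisson h z * Q z.
have lG : lunif G.
  apply: lunifM; first exact: lunifM.
  by apply: lunifM; [exact: lunif_cst|exact: lunif_outer].
have bG : boundary_values G g.
  have bQ : boundary_values Q (fun w => (o w)^-1).
    apply: (@boundary_values_ext _ (fun z => (c * outer_fun k z)^-1)).
      by move=> z z1; rewrite /Q outer_funN// invfM.
    by apply: filterS2 o0 bo => w ow; exact: cvgCV.
  apply: boundary_values_ae (boundary_valuesM (boundary_valuesM bF bH) bQ).
  by apply: filterS2 o0 gfh => w ow <-; rewrite mulfK.
split => //; exists G; split => //.
apply: (H2_disc_bound lG (L2_L1 g2)) => z z1.
have l2K : L1 (fun w => 2 * K w) by exact: L1Z.
have eK : ae_circle (fun w => expR (2 * K w) = normc (g w) ^+ 2).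
  apply: filterS2 (filterI fn0 hn0) (filterI (filterI no o0) gfh) => w [fw hw] [[ow ow0] E].
  rewrite expRM_natl /K !expRD !lnK ?posrE ?normc_gt0// expRN -ow; congr (_ ^+ _).
  by rewrite -normcM -normcV -normcM -E mulfK.
have leK : L1 (fun w => expR (2 * K w)).
  apply: (L1_ae _ (L2_L1 g2) eK).
  by apply: (@mcirc_comp _ (@expR R)); [exact: measurable_expR|exact: L1_mcirc].
rewrite -(rpoisson_ae z1 leK (L2_L1 g2) eK).
(* Jensen's inequality for exp makes the Poisson integral of |g|^2 = exp (2 K) a harmonic majorant
   of |G|^2. *)
apply: le_trans (expR_rpoisson_le z1 l2K leK).
rewrite rpoissonZ// expRM_natl lerXn2r ?nnegrE ?expR_ge0//.
rewrite /K (rpoissonD z1 lfh lN) (rpoissonD z1 lf lh) !expRD.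
rewrite /G normcM [normc (poisson f z * _)]normcM /Q [normc (c^-1 * _)]normcM.
rewrite normcV c1 invr1 mul1r normc_outer.
apply: ler_wpM2r; first exact: expR_ge0.
by apply: ler_pM; [exact: normc_ge0|exact: normc_ge0|exact: jf|exact: jh].
Qed.

Lemma poisson0 f : poisson f 0 = cmean f.
Proof.
congr cmean; apply/funext => w.
by rewrite /pker /hker addr0 subr0 divff ?mul1r// circle_neq0.
Qed.

(* An outer function has no nonconstant inner divisor: at the origin Jensen's inequality
   is an equality for the outer function, which forces [|J(0)| = 1]. *)
Lemma inner_dvd_outer j g o : inner_function j -> H2p g -> outer_H2p o ->
  ae_circle (fun w => o w = j w * g w) -> exists c, ae_circle (fun w => j w = c).
Proof.
move=> [hj nj] hg ho ojg.
have [c [k [c1 lk hO bo no]]] := outer_H2pP ho.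
have o2 := H2p_L2 (outer_H2p_H2p ho).
have j2 := H2p_L2 (Hinfty_H2p hj).
have [lG hG bG] := H2p_poisson hg.
have [_ [J [hJ bJ]]] := hj.
have HJ : H2_disc J by have [lJ [M M0 hM]] := Hinfty_disc_lunif hJ; exact: H2_disc_bounded lJ hM.
have [_ Jp] := H2_boundary j2 HJ bJ.
have bjg : boundary_values (fun z => J z * poisson g z) o.
  by apply: boundary_values_ae (boundary_valuesM bJ bG); apply: filterS ojg => w ->.
have n01 : normc (0 : R[i]) < 1 by rewrite normc0.
have E : c * outer_fun k 0 = J 0 * poisson g 0.
  have [_ e1] := H2_boundary o2 hO bo.
  have [_ e2] := H2_boundary o2 (H2_discM hJ hG) bjg.
  by rewrite (e1 0 n01) -(e2 0 n01).
have ng : ae_circle (fun w => normc (g w) = expR (k w)).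
  by apply: filterS2 (filterI nj no) ojg => w [nj' <-] ->; rewrite normcM nj' mul1r.
have ng0 : ~ ae_circle (fun w => g w = 0).
  move=> g0; have : @ae_circle R (fun=> False).
    apply: filterS2 ng g0 => w ngw g0w; move: ngw; rewrite g0w normc0 => /esym/eqP.
    by rewrite gt_eqF// expR_gt0.
  by have := @filter_not_empty _ _ (@ae_circle_filter R).
have [gn0 lg jg] := H2p_log hg ng0.
(* As |g| = exp k on the circle, Jensen gives |g(0)| <= exp of the Poisson integral of [k] at 0, and
   the latter is |J(0)| |g(0)|. *)
have J0 : 1 <= normc (J 0).
  have jg0 : normc (poisson g 0) <= expR (rpoisson k 0).
    have -> : rpoisson k 0 = rpoisson (fun w => ln (normc (g w))) 0.
      by apply: rpoisson_ae => //; apply: filterS ng => w ->; rewrite expRK.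
    exact: jg.
  have e0 := expR_gt0 (rpoisson k 0).
  have h : normc (J 0) * normc (poisson g 0) = expR (rpoisson k 0).
    by rewrite -normcM -E normcM c1 mul1r normc_outer.
  have b0 : 0 < normc (poisson g 0).
    rewrite lt_def normc_ge0 andbT; apply/eqP => b0.
    by move: e0; rewrite -h b0 mulr0 ltxx.
  rewrite leNgt -(ltr_pM2r b0) h mul1r; apply/negP => h'.
  by have := lt_le_trans h' jg0; rewrite ltxx.
(* The mean of [j] is J(0), so the squared distance from [j] to the constant [a] is 1 - |a|^2 <=
   0. *)
pose a := cmean j; exists a.
have Ja : J 0 = a by rewrite Jp// poisson0.
have nj1 : nrm2 j = 1.
  rewrite -[RHS](@mean_cst R); apply: eq_mean; [exact: L2_L1|exact: L1_cst|].
  by apply: filterS nj => w ->; rewrite expr1n.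
have ca : L2 (fun=> a : R[i]) by exact: L2_bd (mc_cst a) (fun=> lexx _).
have d2 := L2B j2 ca.
have : ae_circle (fun w => j w - a = 0).
  apply: nrm2_eq0 => //; apply/eqP; rewrite eq_le nrm2_ge0// andbT nrm2B// nj1.
  rewrite cmeanZ; last exact: L2_CL1.
  rewrite -/a [a^* * a]mulrC mulC_conj -[Re _]/(normc a ^+ 2) /nrm2 mean_cst.
  rewrite Ja in J0; have : 1 * 1 <= normc a * normc a by rewrite ler_pM.
  by rewrite expr2; lra.
by apply: filterS => w /eqP; rewrite subr_eq0 => /eqP.
Qed.

End OuterFunctions.

(** * The space H^2_-, the orthogonal projections and the kernel of a paired operator *)

Section PairedKernels.
Variable R : realType.
Local Notation "x ^*" := (conjc x) : ring_scope.
Implicit Types (a b f g h j o u : circle R -> R[i]).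

(** The antilinear involution under which being outer in H^2_- is defined; it exchanges H^2_- and
    H^2_+. *)
Definition flip f : circle R -> R[i] := fun w => (val w)^* * (f w)^*.

Lemma innerE f g : inner f g = cmean (fun w => f w * (g w)^*).
Proof. exact: cmeanE. Qed.

Lemma innerC f g : L2 f -> L2 g -> inner g f = (inner f g)^*.
Proof.
move=> f2 g2; rewrite !innerE -cmeanJ; last by apply: L2M_CL1 => //; exact: L2J.
by congr cmean; apply/funext => w; rewrite rmorphM /= conjcK mulrC.
Qed.

Lemma L2_flip f : L2 f -> L2 (flip f).
Proof.
move=> f2; apply: (@L2_bdM R (fun w => (val w)^*) (fun w => (f w)^*) 1).
- exact: mcJ (@mc_id R).
- by apply: aeW => t _; rewrite normcJ circle_normc.
- exact: L2J.
Qed.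

(** The factor conj z shifts the index by one: the coefficients of index n >= 0 of [f] become those
    of index - (n + 1) of [flip f], so the constant one is included. *)
Lemma cmean_flip f n : L2 f ->
  cmean (fun w => val w ^+ n.+1 * flip f w) = (cmean (fun w => (val w)^* ^+ n * f w))^*.
Proof.
move=> f2; rewrite -cmeanJ; last exact: CL1_expnJM (L2_CL1 f2).
congr cmean; apply/funext => w; rewrite /flip exprSr rmorphM rmorphXn /= conjcK.
by rewrite -mulrA [val w * _]mulrA circle_conj mul1r.
Qed.

(** For a polynomial in place of [g] this is a combination of vanishing coefficients of [f]; H^2_+
    is in the closure of the polynomials. *)
Lemma cmean_H2pM f g : H2p f -> H2p g -> cmean (fun w => val w * f w * g w) = 0.
Proof.
move=> hf hg; have f2 := H2p_L2 hf; have wf2 : L2 (fun w => val w * f w).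
  by have := L2_expnM 1 f2.
apply: (poly_approx_orth wf2 (H2p_L2 hg) (H2p_approx hg)) => p.
rewrite /pcirc; under eq_fun do rewrite horner_coef mulr_sumr.
have /H2pP[_ h0] := hf; rewrite cmean_sum => [|i].
  rewrite big1// => i _.
  transitivity (p`_i * cmean (fun w => val w ^+ i.+1 * f w)); last by rewrite h0// mulr0.
  rewrite -cmeanZ; last exact: CL1_expnM (L2_CL1 f2).
  by congr cmean; apply/funext => w; rewrite exprSr; ring.
have := CL1Z p`_i (CL1_expnM i.+1 (L2_CL1 f2)); congr CL1.
by apply/funext => w; rewrite exprSr; ring.
Qed.

Lemma H2p_expn n : H2p (fun w : circle R => val w ^+ n).
Proof.
apply/H2pP; split; first exact: L2_expn.
move=> m m0; under eq_fun do rewrite -exprD.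
by rewrite cmean_expn addn_eq0 -leqn0 leqNgt m0.
Qed.

Lemma H2mP f : H2m f <-> L2 f /\ forall n, cmean (fun w => (val w)^* ^+ n * f w) = 0.
Proof.
split=> -[f2 h]; split => //.
  move=> n; rewrite -(h _ (H2p_expn n)) innerE; congr cmean; apply/funext => w.
  by rewrite mulrC rmorphXn.
(* The inner product of [f] with an element [g] of H^2_+ is, up to conjugation, the mean of
   [w * flip f w * g w], which vanishes by [cmean_H2pM]. *)
have hf : H2p (flip f).
  apply/H2pP; split; first exact: L2_flip.
  by case=> // n _; rewrite cmean_flip// h conjc0.
move=> g hg; have g2 := H2p_L2 hg.
rewrite innerC// innerE; apply/eqP; rewrite conjc_eq0; apply/eqP.
rewrite -(cmean_H2pM hf hg); congr cmean; apply/funext => w.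
by rewrite /flip [val w * _]mulrA circle_conj mul1r mulrC.
Qed.

Lemma H2m_L2 f : H2m f -> L2 f. Proof. by case. Qed.

Lemma H2m_flip f : L2 f -> H2m f <-> H2p (flip f).
Proof.
move=> f2; rewrite H2mP H2pP; split=> -[_ h]; split => //.
- exact: L2_flip.
- by case=> // n _; rewrite cmean_flip// h conjc0.
- by move=> n; apply/eqP; rewrite -conjc_eq0 -cmean_flip// h.
Qed.

Lemma H2m_ae f g : L2 g -> ae_circle (fun w => f w = g w) -> H2m f -> H2m g.
Proof.
move=> g2 fg hf; have f2 := H2m_L2 hf; apply/(H2m_flip g2).
apply: H2p_ae (proj1 (H2m_flip f2) hf); first exact: L2_flip.
by apply: filterS fg => w; rewrite /flip => ->.
Qed.

Lemma H2pB f g : H2p f -> H2p g -> H2p (fun w => f w - g w).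
Proof.
move=> /H2pP[f2 hf] /H2pP[g2 hg]; apply/H2pP; split; first exact: L2B.
move=> n n0; under eq_fun do rewrite mulrBr.
by rewrite cmeanB ?hf ?hg ?subr0//; apply: CL1_expnM; exact: L2_CL1.
Qed.

Lemma H2mB f g : H2m f -> H2m g -> H2m (fun w => f w - g w).
Proof.
move=> /H2mP[f2 hf] /H2mP[g2 hg]; apply/H2mP; split; first exact: L2B.
move=> n; under eq_fun do rewrite mulrBr.
by rewrite cmeanB ?hf ?hg ?subr0//; apply: CL1_expnJM; exact: L2_CL1.
Qed.

Lemma H2p_H2m_eq0 f : H2p f -> H2m f -> ae_circle (fun w => f w = 0).
Proof.
move=> hf hm; have f2 := H2p_L2 hf; apply: nrm2_eq0 => //; apply: (@complexI R).
rewrite -nrm2_cmean; have [_ /(_ _ hf) E] := hm; rewrite -[RHS]E innerE.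
by congr cmean; apply/funext => w; rewrite mulrC.
Qed.

(** The projection is synthesised from the Fourier coefficients of index n >= 0, which are square
    summable by Bessel's inequality. *)
Lemma H2p_decomposition f : L2 f -> exists2 g, H2p g & H2m (fun w => f w - g w).
Proof.
move=> f2; pose c k := cmean (fun w => (val w)^* ^+ k * f w).
have [g g2 hg] := l2_synthesis (fun N => bessel N f2 : _ <= nrm2 f).
have ga : poly_approx g by move=> e /(hg _ 0%N)[N _ hN]; exists (\poly_(k < N) c k).
exists g; first by apply/H2pP; split => // n; exact: poly_approx_coef.
apply/H2mP; split; first exact: L2B.
move=> n; under eq_fun do rewrite mulrBr.
have cl u : L2 u -> CL1 (fun w => (val w)^* ^+ n * u w).
  by move=> u2; apply: CL1_expnJM; exact: L2_CL1.
rewrite cmeanB; [|exact: cl..]; rewrite -/(c n).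
apply/eqP; rewrite -normc_eq0 -sqrf_eq0 eq_le exprn_ge0// andbT.
apply/ler_addgt0Pl => e e0; rewrite addr0.
(* The degree must exceed [n] for the partial sum to carry the coefficient [c n]. *)
have [N nN hN] := hg e n.+1 e0.
have p2 := L2_pcirc (\poly_(k < N) c k); have d2 := L2B g2 p2.
have -> : c n = cmean (fun w => (val w)^* ^+ n * pcirc (\poly_(k < N) c k) w).
  by rewrite cmean_pcirc_coef coef_poly nN.
rewrite normcBC -cmeanB; [|exact: cl..].
under eq_fun do rewrite -mulrBr.
have wn2 : L2 (fun w : circle R => (val w)^* ^+ n).
  by under eq_fun do rewrite -rmorphXn; apply: L2J; exact: L2_expn.
apply: le_trans (normc_cmeanM_le wn2 d2) _; rewrite (_ : nrm2 _ = 1) ?mul1r ?ltW//.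
transitivity (nrm2 (fun w : circle R => val w ^+ n)); last exact: nrm2_expn.
by congr mean; apply/funext => w; rewrite -rmorphXn normcJ.
Qed.

(** With [g] the projection of [u] to H^2_+, the difference [u - g] lies in H^2_- and is orthogonal
    to it, hence to itself. *)
Lemma orthocompl_H2m u : orthocompl (@H2m R) u -> H2p u.
Proof.
move=> [u2 hu]; have [g hg hm] := H2p_decomposition u2.
have g2 := H2p_L2 hg; have d2 := H2m_L2 hm.
apply: (H2p_ae u2 _ hg).
have : inner (fun w => u w - g w) (fun w => u w - g w) = 0.
  have h1 := hu _ hm; have : inner g (fun w => u w - g w) = 0.
    by have [_ h] := hm; rewrite innerC// h// conjc0.
  move: h1; rewrite !innerE => h1 h2; under eq_fun do rewrite mulrBl.
  by rewrite cmeanB ?h1 ?h2 ?subr0//; apply: L2M_CL1 => //; exact: L2J.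
rewrite innerE => E; apply: filterS (nrm2_eq0 d2 _) => [w /eqP|].
  by rewrite subr_eq0 => /eqP ->.
apply: (@complexI R); rewrite -nrm2_cmean -[RHS]E.
by congr cmean; apply/funext => w; rewrite mulrC.
Qed.

Lemma orthoproj_H2p f : L2 f ->
  H2p (orthoproj (@H2p R) f) /\ H2m (fun w => f w - orthoproj (@H2p R) f w).
Proof.
move=> f2; have [g hg hm] := H2p_decomposition f2.
by have := @xgetPex _ (fun=> 0) [set g | H2p g /\ orthocompl (@H2p R) (fun w => f w - g w)]
  (ex_intro _ g (conj hg hm)).
Qed.

Lemma orthoproj_H2m f : L2 f ->
  H2m (orthoproj (@H2m R) f) /\ H2p (fun w => f w - orthoproj (@H2m R) f w).
Proof.
move=> f2; have [g hg hm] := H2p_decomposition f2; have g2 := H2p_L2 hg.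
have ho : orthocompl (@H2m R) (fun w => f w - (f w - g w)).
  split=> [|h hh]; first exact: L2B f2 (L2B f2 g2).
  have [h2 hh'] := hh; rewrite innerC ?(hh' g hg)//; last exact: L2B f2 (L2B f2 g2).
    rewrite (_ : (fun w => f w - (f w - g w)) = g); first by rewrite hh'// conjc0.
    by apply/funext => w; rewrite subKr.
have := @xgetPex _ (fun=> 0) [set g | H2m g /\ orthocompl (@H2m R) (fun w => f w - g w)]
  (ex_intro _ _ (conj hm ho)).
by move=> [h1 h2]; split; [exact: h1|exact: orthocompl_H2m h2].
Qed.

(** If the two projections add up to 0, each lies in both H^2_+ and H^2_- up to null sets, hence
    vanishes. *)
Lemma paired_kerP a b f : Linfty a -> Linfty b -> paired_ker a b f <->
  [/\ L2 f, H2m (fun w => a w * f w) & H2p (fun w => b w * f w)].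
Proof.
move=> la lb; split=> [[f2 h]|[f2 hm hp]].
  have af2 := L2_LinftyM la f2; have bf2 := L2_LinftyM lb f2.
  have [p1 p2] := orthoproj_H2p af2; have [q1 q2] := orthoproj_H2m bf2.
  set p := orthoproj _ _ in p1 p2; set q := orthoproj _ _ in q1 q2.
  (* This is p = - q, written with differences only so that [H2mB] applies. *)
  have pq : ae_circle (fun w => p w = q w - q w - q w).
    by apply: filterS h => w /eqP; rewrite addr_eq0 subrr sub0r => /eqP.
  have pm : H2m p.
    apply: H2m_ae (H2mB (H2mB q1 q1) q1); first exact: H2p_L2.
    by apply: filterS pq => w ->.
  have p0 := H2p_H2m_eq0 p1 pm.
  have q0 : ae_circle (fun w => q w = 0).
    by apply: filterS2 p0 pq => w -> /eqP; rewrite subrr sub0r eq_sym oppr_eq0 => /eqP.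
  split; first exact: f2.
  - by apply: H2m_ae p2; [exact: af2|apply: filterS p0 => w ->; rewrite subr0].
  - by apply: H2p_ae q2; [exact: bf2|apply: filterS q0 => w ->; rewrite subr0].
split; first exact: f2.
have [p1 p2] := orthoproj_H2p (H2m_L2 hm); have [q1 q2] := orthoproj_H2m (H2p_L2 hp).
have p0 : ae_circle (fun w => orthoproj (@H2p R) (fun w => a w * f w) w = 0).
  apply: H2p_H2m_eq0; first exact: p1.
  have := H2mB hm p2; congr H2m.
  by apply/funext => w; rewrite subKr.
have q0 : ae_circle (fun w => orthoproj (@H2m R) (fun w => b w * f w) w = 0).
  apply: H2p_H2m_eq0; last exact: q1.
  have := H2pB hp q2; congr H2p.
  by apply/funext => w; rewrite subKr.
by apply: filterS2 p0 q0 => w e1 e2; rewrite /paired_op e1 e2 addr0.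
Qed.

End PairedKernels.

(** * Multiplying kernel elements by inner functions, and comparison of kernels *)

Section KernelMultipliers.
Variable R : realType.
Local Notation "x ^*" := (conjc x) : ring_scope.
Implicit Types (a b ta tb f g h hm hp j o u : circle R -> R[i]).

Lemma outer_H2p_ae f g : L2 g -> ae_circle (fun w => f w = g w) -> outer_H2p f -> outer_H2p g.
Proof.
move=> g2 fg [f2 [F [hF bF oF]]]; split; first exact: g2.
by exists F; split; [exact: hF|exact: boundary_values_ae bF|exact: oF].
Qed.

Lemma outer_H2pZ (c : R[i]) f : normc c = 1 -> outer_H2p f -> outer_H2p (fun w => c * f w).
Proof.
move=> c1 [f2 [F [hF bF /outer_discP[d [k [d1 lk Fz]]]]]]; split; first exact: L2Z.
exists (fun z => c * F z); split.
- apply: H2_discM hF; split; first by apply: lunif_analytic; exact: lunif_cst.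
  by exists 1 => z _; rewrite c1.
- apply: (@boundary_valuesM R (fun=> c) F (fun=> c)); last exact: bF.
  by apply: aeW => t _; exact: cvg_cst.
- apply/outer_discP; exists (c * d), k; split => // [|z z1]; first by rewrite normcM c1 d1 mulr1.
  by rewrite Fz// mulrA.
Qed.

Lemma outer_Hinfty_H2p h : outer_Hinfty h -> outer_H2p h.
Proof.
move=> [lh [F [hF bF oF]]]; split.
  by apply: H2p_L2; apply: Hinfty_H2p; split => //; exists F.
exists F; split => //; have [lF [M _ hM]] := Hinfty_disc_lunif hF.
exact: H2_disc_bounded hM.
Qed.

Lemma inner_unit j : inner_function j ->
  ae_circle (fun w => j w * (j w)^* = 1) /\ ae_circle (fun w => (j w)^* * j w = 1).
Proof.
move=> [_ nj]; split; apply: filterS nj => w n1; last rewrite mulrC.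
all: by rewrite mulC_conj n1 expr1n.
Qed.

Lemma L2_innerM j f : inner_function j -> L2 f -> L2 (fun w => j w * f w).
Proof. by move=> [[lj _] _]; exact: L2_LinftyM. Qed.

Lemma L2_conj_innerM j f : inner_function j -> L2 f -> L2 (fun w => (j w)^* * f w).
Proof.
move=> [[[mj [M hM]] _] _]; apply: (L2_bdM (mcJ mj) (c := M)).
by apply: filterS hM => w; rewrite normcJ.
Qed.

Lemma flipM f g w : flip (fun v => f v * g v) w = (f w)^* * flip g w.
Proof. by rewrite /flip rmorphM /= mulrCA. Qed.

Lemma H2m_conj_HinftyM h f : conj_Hinfty h -> H2m f -> H2m (fun w => h w * f w).
Proof.
move=> hh hf; have f2 := H2m_L2 hf.
have hfl : H2p (flip (fun w => h w * f w)).
  rewrite (_ : flip _ = fun w => (h w)^* * flip f w); last exact/funext/flipM.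
  by apply: H2p_HinftyM hh _; exact/(H2m_flip f2).
apply/H2m_flip => //; have [[mh [M hM]] _] := hh.
apply: (L2_bdM _ (c := M)) => //.
  by have := mcJ mh; under eq_fun do rewrite conjcK.
by apply: filterS hM => w; rewrite normcJ.
Qed.

Lemma inner_conj_Hinfty j : inner_function j -> conj_Hinfty (fun w => (j w)^*).
Proof. by move=> [hj _]; rewrite /conj_Hinfty /=; under eq_fun do rewrite conjcK. Qed.

Section Fixed.
Variables (a b : circle R -> R[i]).
Hypotheses (la : Linfty a) (lb : Linfty b).

(** On the circle 1 / j = conj j, and multiplication by conj j preserves H^2_-, so the condition on
    [a f] survives the division. *)
Lemma paired_ker_div_inner f j g : paired_ker a b f -> inner_function j -> H2p g ->
  ae_circle (fun w => b w * f w = j w * g w) ->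
  paired_ker a b (fun w => (j w)^* * f w) /\
  ae_circle (fun w => b w * ((j w)^* * f w) = g w).
Proof.
move=> /(paired_kerP _ la lb)[f2 hm hp] ij hg e; have [_ cj] := inner_unit ij.
have f'2 := L2_conj_innerM ij f2.
have e' : ae_circle (fun w => b w * ((j w)^* * f w) = g w).
  by apply: filterS2 cj e => w jw ew; rewrite mulrCA ew mulrA jw mul1r.
split; last exact: e'.
apply/(paired_kerP _ la lb); split; first exact: f'2.
  under eq_fun do rewrite mulrCA.
  by apply: H2m_conj_HinftyM hm; exact: inner_conj_Hinfty.
apply: H2p_ae hg; first exact: L2_LinftyM.
by apply: filterS e' => w ->.
Qed.

(** [flip] turns multiplication by [j] into multiplication by conj j: the inner factor of the
    reflection of [a f] is removed by multiplying [f] by [j], which keeps [b f] in H^2_+. *)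
Lemma paired_ker_mul_inner f j g : paired_ker a b f -> inner_function j -> H2p g ->
  ae_circle (fun w => flip (fun v => a v * f v) w = j w * g w) ->
  paired_ker a b (fun w => j w * f w) /\
  ae_circle (fun w => flip (fun v => a v * (j v * f v)) w = g w).
Proof.
move=> /(paired_kerP _ la lb)[f2 hm hp] ij hg e; have [_ cj] := inner_unit ij.
have f'2 := L2_innerM ij f2.
have e' : ae_circle (fun w => flip (fun v => a v * (j v * f v)) w = g w).
  apply: filterS2 cj e => w jw ew.
  transitivity ((j w)^* * flip (fun v => a v * f v) w); last by rewrite ew mulrA jw mul1r.
  by rewrite -flipM; congr flip; apply/funext => v; rewrite mulrCA.
split; last exact: e'.
apply/(paired_kerP _ la lb); split; first exact: f'2.
  have af2 := L2_LinftyM la f'2; apply/(H2m_flip af2).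
  by apply: H2p_ae hg; [exact: L2_flip|apply: filterS e' => w ->].
by under eq_fun do rewrite mulrCA; apply: H2p_HinftyM hp; case: ij.
Qed.

End Fixed.

Lemma ae_neq0M a f : ae_circle (fun w => a w != 0) -> ~ ae_circle (fun w => f w = 0) ->
  ~ ae_circle (fun w => a w * f w = 0).
Proof.
move=> a0 f0 h; apply: f0; apply: filterS2 a0 h => w aw /eqP.
by rewrite mulf_eq0 (negbTE aw) => /eqP.
Qed.

Lemma flip_eq0 f w : (flip f w == 0) = (f w == 0).
Proof. by rewrite mulf_eq0 !conjc_eq0 (negbTE (circle_neq0 w)). Qed.

Lemma paired_ker_generators a b : symbol_pair a b ->
  (exists f, paired_ker a b f /\ ~ ae_circle (fun w => f w = 0)) ->
  (exists2 f, paired_ker a b f & outer_H2p (flip (fun w => a w * f w))) /\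
  (exists2 f, paired_ker a b f & outer_H2p (fun w => b w * f w)).
Proof.
move=> [la lb a0 b0 _] [f [kf f0]]; have [f2 hm hp] := proj1 (paired_kerP _ la lb) kf; split.
- have hfl := proj1 (H2m_flip (H2m_L2 hm)) hm.
  have n0 : ~ ae_circle (fun w => flip (fun v => a v * f v) w = 0).
    move=> h; apply: (ae_neq0M a0 f0); apply: filterS h => w /eqP.
    by rewrite flip_eq0 => /eqP.
  have [j [ o [ij oo e]]] := inner_outer_factorization hfl n0.
  have [k' e'] := paired_ker_mul_inner la lb kf ij (outer_H2p_H2p oo) e.
  exists (fun w => j w * f w); first exact: k'.
  apply: outer_H2p_ae oo.
    by apply: L2_flip; apply: L2_LinftyM => //; exact: L2_innerM.
  by apply: filterS e' => w ->.
- have [j [ o [ij oo e]]] := inner_outer_factorization hp (ae_neq0M b0 f0).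
  have [k' e'] := paired_ker_div_inner la lb kf ij (outer_H2p_H2p oo) e.
  exists (fun w => (j w)^* * f w); first exact: k'.
  apply: outer_H2p_ae oo.
    by apply: L2_LinftyM => //; exact: L2_conj_innerM.
  by apply: filterS e' => w ->.
Qed.

Lemma ratio_eq (x y u v t : R[i]) : x != 0 -> u != 0 -> y / x = v / u ->
  y * t * u = v * (x * t).
Proof.
move=> x0 u0 e; transitivity (y / x * (x * t) * u); first by rewrite mulrA divfK.
by rewrite e mulrAC divfK.
Qed.

(** Clearing denominators, [ta f psim = tpsim (a f)] and [tb f psip = tpsip (b f)]; the Smirnov
    principle applies directly to the second and, after reflection, to the first. *)
Lemma paired_ker_sub a b ta tb psim tpsim psip tpsip :
  symbol_pair a b -> symbol_pair ta tb ->
  H2m tpsim -> outer_H2m psim -> ae_circle (fun w => ta w / a w = tpsim w / psim w) ->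
  H2p tpsip -> outer_H2p psip -> ae_circle (fun w => tb w / b w = tpsip w / psip w) ->
  paired_ker a b `<=` paired_ker ta tb.
Proof.
move=> [la lb a0 b0 _] [lta ltb _ _ _] hm [_ om] em hp op ep f.
move=> /(paired_kerP _ la lb)[f2 fm fp]; apply/(paired_kerP _ lta ltb); split; first exact: f2.
- have taf2 := L2_LinftyM lta f2; apply/(H2m_flip taf2).
  apply: (smirnov (proj1 (H2m_flip (H2m_L2 hm)) hm)
    (proj1 (H2m_flip (H2m_L2 fm)) fm) om (L2_flip taf2)).
  have psi0 := outer_H2p_neq0 om.
  apply: filterS2 (filterI a0 em) psi0 => w [aw ew].
  rewrite (flip_eq0 psim) => pw; have := ratio_eq (f w) aw pw ew.
  (* Each side is a product of two functions to be reflected, hence conjugation and two factors conj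
     w. *)
  move=> /(congr1 (fun z => (val w)^* * (val w)^* * z^*)); rewrite /= => E.
  rewrite -/(flip psim w) /flip.
  transitivity ((val w)^* * (val w)^* * (ta w * f w * psim w)^*); first by rewrite rmorphM /=; ring.
  by rewrite E rmorphM /=; ring.
- apply: (smirnov hp fp op (L2_LinftyM ltb f2)).
  apply: filterS2 (filterI b0 ep) (outer_H2p_neq0 op) => w [bw ew] pw.
  exact: ratio_eq.
Qed.

Lemma ae_const_inner j c : inner_function j -> ae_circle (fun w => j w = c) -> normc c = 1.
Proof.
by move=> [_ nj] jc; have [w [n1 jw]] := filter_ex (filterI nj jc); rewrite -jw.
Qed.

(** If [tb f = j o] with [j] inner, then conj j f is still in the kernel for (ta, tb), hence in that
    for (a, b). So [j] divides the outer function [b f] in H^2_+ and must be constant. *)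
Lemma paired_ker_outer_plus a b ta tb f : symbol_pair a b -> symbol_pair ta tb ->
  paired_ker ta tb `<=` paired_ker a b -> paired_ker ta tb f ->
  outer_H2p (fun w => b w * f w) -> outer_H2p (fun w => tb w * f w).
Proof.
move=> [la lb _ _ _] [lta ltb _ tb0 _] sub kf ob.
have [f2 _ hp] := proj1 (paired_kerP _ lta ltb) kf.
have n0 : ~ ae_circle (fun w => tb w * f w = 0).
  apply: ae_neq0M => // f0.
  have [w [+ e]] := filter_ex (filterI (outer_H2p_neq0 ob) f0).
  by rewrite e mulr0 eqxx.
have [j [ o [ij oo e]]] := inner_outer_factorization hp n0.
have [k' _] := paired_ker_div_inner lta ltb kf ij (outer_H2p_H2p oo) e.
have [_ _ hb] := proj1 (paired_kerP _ la lb) (sub _ k').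
have [|c jc] := inner_dvd_outer ij hb ob.
  have [cj _] := inner_unit ij; apply: filterS cj => w jw.
  by rewrite mulrCA [j w * _]mulrA jw mul1r.
apply: outer_H2p_ae (outer_H2pZ (ae_const_inner ij jc) oo); first exact: L2_LinftyM.
by apply: filterS2 jc e => w <- ->.
Qed.

(** The mirror argument: [j f] is in the smaller kernel, so the inner factor [j] of the reflection
    of [ta f] divides that of [a f]. *)
Lemma paired_ker_outer_minus a b ta tb f : symbol_pair a b -> symbol_pair ta tb ->
  paired_ker ta tb `<=` paired_ker a b -> paired_ker ta tb f ->
  outer_H2p (flip (fun w => a w * f w)) -> outer_H2p (flip (fun w => ta w * f w)).
Proof.
move=> [la lb _ _ _] [lta ltb ta0 _ _] sub kf ob.
have [f2 hm _] := proj1 (paired_kerP _ lta ltb) kf.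
have n0 : ~ ae_circle (fun w => flip (fun v => ta v * f v) w = 0).
  move=> h; have {h} : ae_circle (fun w => ta w * f w = 0).
    by apply: filterS h => w /eqP; rewrite flip_eq0 => /eqP.
  apply: ae_neq0M => // f0.
  have [w [+ e]] := filter_ex (filterI (outer_H2p_neq0 ob) f0).
  by rewrite flip_eq0 e mulr0 eqxx.
have [j [ o [ij oo e]]] := inner_outer_factorization (proj1 (H2m_flip (H2m_L2 hm)) hm) n0.
have [k' _] := paired_ker_mul_inner lta ltb kf ij (outer_H2p_H2p oo) e.
have [_ hb _] := proj1 (paired_kerP _ la lb) (sub _ k').
have [|c jc] := inner_dvd_outer ij (proj1 (H2m_flip (H2m_L2 hb)) hb) ob.
  have [cj _] := inner_unit ij; apply: filterS cj => w jw.
  rewrite /flip !rmorphM /=; transitivity ((j w * (j w)^*) * ((val w)^* * ((a w)^* * (f w)^*))).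
    by rewrite jw mul1r.
  by ring.
apply: outer_H2p_ae (outer_H2pZ (ae_const_inner ij jc) oo).
  by apply: L2_flip; exact: L2_LinftyM.
by apply: filterS2 jc e => w <- ->.
Qed.

Lemma ratio_outer a ta f : ae_circle (fun w => a w * f w != 0) ->
  ae_circle (fun w => ta w / a w = (ta w * f w) / (a w * f w)).
Proof.
apply: filterS => w; rewrite mulf_eq0 negb_or => /andP[a0 f0].
by rewrite invfM mulrACA divff// mulr1.
Qed.

Lemma paired_ker_sub_witness a b ta tb f1 f2 : symbol_pair a b -> symbol_pair ta tb ->
  paired_ker a b `<=` paired_ker ta tb ->
  paired_ker a b f1 -> outer_H2p (flip (fun w => a w * f1 w)) ->
  paired_ker a b f2 -> outer_H2p (fun w => b w * f2 w) ->
  [/\ outer_H2m (fun w => a w * f1 w), H2m (fun w => ta w * f1 w),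
     ae_circle (fun w => ta w / a w = (ta w * f1 w) / (a w * f1 w)),
     H2p (fun w => tb w * f2 w) &
     ae_circle (fun w => tb w / b w = (tb w * f2 w) / (b w * f2 w))].
Proof.
move=> [la lb _ _ _] [lta ltb _ _ _] sub k1 o1 k2 o2.
have [_ m1 _] := proj1 (paired_kerP _ la lb) k1.
have [_ tm1 _] := proj1 (paired_kerP _ lta ltb) (sub _ k1).
have [_ _ tp2] := proj1 (paired_kerP _ lta ltb) (sub _ k2).
split; [by split; [exact: m1|exact: o1]|exact: tm1| |exact: tp2|].
- by apply: ratio_outer; apply: filterS (outer_H2p_neq0 o1) => w; rewrite flip_eq0.
- by apply: ratio_outer; exact: outer_H2p_neq0 o2.
Qed.

Lemma paired_ker_sub_mul a b hm hp : symbol_pair a b ->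
  symbol_pair (fun w => a w * hm w) (fun w => b w * hp w) ->
  conj_Hinfty hm -> Hinfty hp ->
  paired_ker a b `<=` paired_ker (fun w => a w * hm w) (fun w => b w * hp w).
Proof.
move=> [la lb _ _ _] [lta ltb _ _ _] hhm hhp f /(paired_kerP _ la lb)[f2 m p].
apply/(paired_kerP _ lta ltb); split; first exact: f2.
- by under eq_fun do rewrite [a _ * _]mulrC -mulrA; exact: H2m_conj_HinftyM.
- by under eq_fun do rewrite [b _ * _]mulrC -mulrA; exact: H2p_HinftyM.
Qed.

(** The Smirnov principle with the constant 1 as second numerator: [b f] is [b hp f] divided by the
    outer [hp], and likewise after reflection for [a f]. *)
Lemma mul_outer_paired_ker_sub a b hm hp : symbol_pair a b ->
  symbol_pair (fun w => a w * hm w) (fun w => b w * hp w) ->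
  outer_conj_Hinfty hm -> outer_Hinfty hp ->
  paired_ker (fun w => a w * hm w) (fun w => b w * hp w) `<=` paired_ker a b.
Proof.
move=> [la lb _ _ _] [lta ltb _ _ _] om op f /(paired_kerP _ lta ltb)[f2 m p].
have h1 : H2p (fun=> 1 : R[i]) := H2p_expn R 0.
apply/(paired_kerP _ la lb); split; first exact: f2.
- have af2 := L2_LinftyM la f2; apply/(H2m_flip af2).
  apply: (smirnov (proj1 (H2m_flip (H2m_L2 m)) m) h1 (outer_Hinfty_H2p om) (L2_flip af2)).
  by apply: aeW => t _; rewrite /flip !rmorphM /=; ring.
- apply: (smirnov p h1 (outer_Hinfty_H2p op) (L2_LinftyM lb f2)).
  by apply: aeW => t _; ring.
Qed.

(** Write [hp = u g]. Then conj u f is in the larger kernel, since [b hp] times it is [g b f]; were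
    it in the smaller one, [u] would divide the outer function [b f]. *)
Lemma mul_inner_paired_ker_plus a b hm hp f : symbol_pair a b ->
  symbol_pair (fun w => a w * hm w) (fun w => b w * hp w) ->
  conj_Hinfty hm -> has_nonconstant_inner_factor hp ->
  paired_ker a b f -> outer_H2p (fun w => b w * f w) ->
  ~ (paired_ker (fun w => a w * hm w) (fun w => b w * hp w) `<=` paired_ker a b).
Proof.
move=> [la lb _ _ _] [lta ltb _ _ _] hhm [u [g [iu nu hg e]]].
move=> /(paired_kerP _ la lb)[f2 m p] ob sub; apply: nu.
have [uc cu] := inner_unit iu; have v2 := L2_conj_innerM iu f2.
suff /sub /(paired_kerP _ la lb)[_ _ hb] : paired_ker (fun w => a w * hm w)
    (fun w => b w * hp w) (fun w => (u w)^* * f w).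
  apply: (inner_dvd_outer iu hb ob); apply: filterS uc => w uw.
  by rewrite mulrCA [u w * _]mulrA uw mul1r.
apply/(paired_kerP _ lta ltb); split; first exact: v2.
- rewrite (_ : (fun w => _) = (fun w => hm w * ((u w)^* * (a w * f w)))).
    apply: H2m_conj_HinftyM hhm _; apply: H2m_conj_HinftyM m; exact: inner_conj_Hinfty.
  by apply/funext => w; ring.
- apply: H2p_ae (H2p_HinftyM hg p); first exact: L2_LinftyM.
  apply: filterS2 cu e => w cw ->.
  by transitivity (g w * (b w * f w) * ((u w)^* * u w)); [rewrite cw mulr1|ring].
Qed.

(** Here the element outside the smaller kernel is [u f]: the conjugate of [hm] supplies the factor
    [u] that cancels conj u in the reflection of [a hm u f]. *)
Lemma mul_inner_paired_ker_minus a b hm hp f : symbol_pair a b ->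
  symbol_pair (fun w => a w * hm w) (fun w => b w * hp w) ->
  has_nonconstant_inner_factor (fun w => (hm w)^*) -> Hinfty hp ->
  paired_ker a b f -> outer_H2p (flip (fun w => a w * f w)) ->
  ~ (paired_ker (fun w => a w * hm w) (fun w => b w * hp w) `<=` paired_ker a b).
Proof.
move=> [la lb _ _ _] [lta ltb _ _ _] [u [g [iu nu hg e]]] hhp.
move=> /(paired_kerP _ la lb)[f2 m p] ob sub; apply: nu.
have [uc cu] := inner_unit iu; have v2 := L2_innerM iu f2.
have flm := proj1 (H2m_flip (H2m_L2 m)) m.
suff /sub /(paired_kerP _ la lb)[_ hb _] : paired_ker (fun w => a w * hm w)
    (fun w => b w * hp w) (fun w => u w * f w).
  apply: (inner_dvd_outer iu (proj1 (H2m_flip (H2m_L2 hb)) hb) ob).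
  apply: filterS uc => w uw; rewrite /flip !rmorphM /=.
  transitivity ((u w * (u w)^*) * ((val w)^* * ((a w)^* * (f w)^*))); first by rewrite uw mul1r.
  by ring.
have t2 := L2_LinftyM lta v2.
apply/(paired_kerP _ lta ltb); split; first exact: v2.
- apply/(H2m_flip t2); apply: H2p_ae (H2p_HinftyM hg flm); first exact: L2_flip.
  apply: filterS2 uc e => w cw ew; rewrite /flip !rmorphM /= ew.
  transitivity (g w * ((val w)^* * ((a w)^* * (f w)^*)) * (u w * (u w)^*)); last by ring.
  by rewrite cw mulr1.
- rewrite (_ : (fun w => _) = (fun w => hp w * (u w * (b w * f w)))).
    by apply: H2p_HinftyM hhp _; apply: H2p_HinftyM p; case: iu.
  by apply/funext => w; ring.
Qed.

End KernelMultipliers.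

Theorem proposition4p9 (R : realType) (a b ta tb : circle R -> R[i])
    (hab : symbol_pair a b) (htab : symbol_pair ta tb)
    (hker : exists f, paired_ker a b f /\ ~ ae_circle (fun w => f w = 0)) :
  (paired_ker a b `<=` paired_ker ta tb <->
     (exists psim tpsim : circle R -> R[i],
        [/\ H2m psim, H2m tpsim, outer_H2m psim
          & ae_circle (fun w => ta w / a w = tpsim w / psim w)]) /\
     (exists psip tpsip : circle R -> R[i],
        [/\ H2p psip, H2p tpsip, outer_H2p psip
          & ae_circle (fun w => tb w / b w = tpsip w / psip w)])) /\
  (paired_ker a b = paired_ker ta tb <->
     (exists psim tpsim : circle R -> R[i],
        [/\ H2m psim, H2m tpsim, outer_H2m psim, outer_H2m tpsim
          & ae_circle (fun w => ta w / a w = tpsim w / psim w)]) /\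
     (exists psip tpsip : circle R -> R[i],
        [/\ H2p psip, H2p tpsip, outer_H2p psip, outer_H2p tpsip
          & ae_circle (fun w => tb w / b w = tpsip w / psip w)])) /\
  (forall hm hp : circle R -> R[i],
     conj_Hinfty hm -> Hinfty hp ->
     symbol_pair (fun w => a w * hm w) (fun w => b w * hp w) ->
     [/\ paired_ker a b `<=`
           paired_ker (fun w => a w * hm w) (fun w => b w * hp w),
         has_nonconstant_inner_factor (fun w => (hm w)^*) \/
           has_nonconstant_inner_factor hp ->
         paired_ker a b `<`
           paired_ker (fun w => a w * hm w) (fun w => b w * hp w)
       & outer_conj_Hinfty hm -> outer_Hinfty hp ->
         paired_ker a b =
           paired_ker (fun w => a w * hm w) (fun w => b w * hp w)]).
Proof.
have [[f1 k1 o1] [f2 k2 o2]] := paired_ker_generators hab hker.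
have [la lb _ _ _] := hab.
have [_ m1 _] := proj1 (paired_kerP _ la lb) k1.
have [_ _ p2] := proj1 (paired_kerP _ la lb) k2.
split; [|split].
- split=> [sub|[[psim [tpsim [_ hm om em]]] [psip [tpsip [_ hp op ep]]]]].
    have [om tm em tp ep] := paired_ker_sub_witness hab htab sub k1 o1 k2 o2.
    by split; eexists; eexists; split; [exact: m1|exact: tm|exact: om|exact: em|
      exact: p2|exact: tp|exact: o2|exact: ep].
  exact: (paired_ker_sub hab htab hm om em hp op ep).
- split=> [E|[[psim [tpsim [m tm om tom em]]] [psip [tpsip [p tp op top ep]]]]].
    have sub : paired_ker a b `<=` paired_ker ta tb by rewrite E.
    have sub' : paired_ker ta tb `<=` paired_ker a b by rewrite E.
    have [om tm em tp ep] := paired_ker_sub_witness hab htab sub k1 o1 k2 o2.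
    have tom := paired_ker_outer_minus hab htab sub' (sub _ k1) o1.
    have top := paired_ker_outer_plus hab htab sub' (sub _ k2) o2.
    split; eexists; eexists; split.
    + exact: m1. + exact: tm. + exact: om. + by split; [exact: tm|exact: tom]. + exact: em.
    + exact: p2. + exact: tp. + exact: o2. + exact: top. + exact: ep.
  apply/seteqP; split; first exact: (paired_ker_sub hab htab tm om em tp op ep).
  (* With both numerators and denominators outer, the inverted quotients satisfy the condition of
     (i) with the two pairs exchanged. *)
  have inv (x y u v : circle R -> R[i]) : ae_circle (fun w => x w / y w = u w / v w) ->
      ae_circle (fun w => y w / x w = v w / u w).
    by apply: filterS => w e; rewrite -[LHS]invf_div e invf_div.
  exact: (paired_ker_sub htab hab m tom (inv _ _ _ _ em) p top (inv _ _ _ _ ep)).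
- move=> hm hp hhm hhp hs; have sub := paired_ker_sub_mul hab hs hhm hhp.
  split; first exact: sub.
  + case=> h; split; first exact: sub.
      exact: (mul_inner_paired_ker_minus hab hs h hhp k1 o1).
    exact: sub.
    exact: (mul_inner_paired_ker_plus hab hs hhm h k2 o2).
  + move=> om op; apply/seteqP; split; first exact: sub.
    exact: (mul_outer_paired_ker_sub hab hs om op).
Qed.
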